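(* Let $d,K\in\mathbb{N}$, $y\in\mathbb{R}^K$, $\nu\in\{0,1\}$, let $\Gamma\in\mathbb{R}^{K\times K}$ be symmetric positive definite, and let $G\in C^2(\mathbb{T}^d,\mathbb{R}^K)$. Set $\Phi(\theta)=\frac12|y-G(\theta)|_\Gamma^2$. Let $w$ be a standard $d$-dimensional Brownian motion. For $\delta,\sigma,\Delta>0$ and an integer $J>0$, let $\{\hat\theta_n,\hat\xi^{(1)}_n,\dots,\hat\xi^{(J)}_n\}_{n\ge0}$ be given by \[ \hat\theta_{n+1}=\hat\theta_n-\frac{1}{J\sigma}\sum_{j=1}^J\bigl\langle G(\hat\theta_n+\sigma\hat\xi_n^{(j)})-G(\hat\theta_n),\,G(\hat\theta_n)-y\bigr\rangle_\Gamma\,\hat\xi_n^{(j)}\,\Delta+\nu\sqrt{2\Delta}\,x_n, \] \[ \hat\xi^{(j)}_{n+1}=e^{-\Delta/\delta^2}\,\hat\xi_n^{(j)}+\sqrt{1-e^{-2\Delta/\delta^2}}\;x_n^{(j)},\qquad j=1,\dots,J, \] where $x_n=\Delta^{-1/2}(w_{(n+1)\Delta}-w_{n\Delta})$ and the $x_n^{(j)}$ are $\mathcal N(0,I_d)$ random variables, all of $x_n$, $x_n^{(j)}$ ($n\ge0$, $1\le j\le J$) being independent, with initial condition $(\hat\theta_0,\hat\xi_0^{(1)},\dots,\hat\xi_0^{(J)})=(\theta_0,\xi_0^{(1)},\dots,\xi_0^{(J)})$ (independent of $w$ and of the $x_n^{(j)}$) such that $(\xi_0^{(1)},\dots,\xi_0^{(J)})\sim\mathcal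 N(0,I_d)\times\dots\times\mathcal N(0,I_d)$. Let $\vartheta$ be the solution of \[ \dot\vartheta_t=-\nabla\Phi(\vartheta_t)+\nu\sqrt2\,\dot w_t,\qquad\vartheta_0=\theta_0, \] driven by the same $w$. Define $\beta=1$ if $G\in C^2(\mathbb{T}^d,\mathbb{R}^K)$ and $\beta=2$ if moreover $G\in C^3(\mathbb{T}^d,\mathbb{R}^K)$. Then for any $J>0$ and any $T>0$ there exists a constant $C=C(T,J)$ such that \[ \forall(\delta,\sigma,\Delta)\in(0,\infty)^3,\qquad \sup_{0\le n\le T/\Delta}\mathbb{E}\,|\hat\theta_n-\vartheta_{n\Delta}|^2\le C\Bigl(\Delta+\sigma^{2\beta}+\log(1+\delta^{-1})\,\delta^2\Bigr). \]
   Context: $\mathbb{T}^d$ is the $d$-dimensional torus; functions on $\mathbb{T}^d$ are identified with functions on $\mathbb{R}^d$ that are 1-periodic in each coordinate, and $\hat\theta_n-\vartheta_{n\Delta}$ is the difference of the corresponding $\mathbb{R}^d$-valued solutions started from the same point. For a symmetric positive definite matrix $A$, $\langle u,v\rangle_A=\langle u,A^{-1}v\rangle$ and $|u|_A^2=\langle u,u\rangle_A$, where $\langle\cdot,\cdot\rangle$ is the Euclidean inner product. The notation $C(T,J)$ means that $C$ does not depend on $\delta,\sigma,\Delta$; it may depend on the fixed problem data $d,K,G,y,\Gamma,\nu$. *)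

(* Defs.v *)
From HB Require Import structures.
From mathcomp Require Import all_boot all_order all_algebra finmap.
From mathcomp Require Import all_classical all_reals all_analysis.
Set Implicit Arguments.
Unset Strict Implicit.
Unset Printing Implicit Defensive.
Import Order.TTheory GRing.Theory Num.Theory.
Import numFieldNormedType.Exports.
Local Open Scope classical_set_scope.
Local Open Scope ring_scope.

(* Vectors of R^n are row vectors. The library norm on 'rV[R]_n is the max
   norm, so the Euclidean structure is given by [dot]. *)
Definition dot (R : realType) (n : nat) (u v : 'rV[R]_n) : R :=
  \sum_(i < n) u ord0 i * v ord0 i.

Definition enorm2 (R : realType) (n : nat) (u : 'rV[R]_n) : R := dot u u.

(* <u, v>_A = <u, A^-1 v> *)
Definition dot_mx (R : realType) (n : nat) (A : 'M[R]_n) (u v : 'rV[R]_n) : R :=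
  dot u (invmx A *m v^T)^T.

Definition spd (R : realType) (n : nat) (A : 'M[R]_n) : Prop :=
  A^T = A /\ forall u : 'rV[R]_n, u != 0 -> 0 < dot u (A *m u^T)^T.

Definition basis_vec (R : realType) (d : nat) (i : 'I_d) : 'rV[R]_d :=
  delta_mx ord0 i.

(* All partial derivatives of order at most k exist and are continuous. *)
Fixpoint Ck (R : realType) (d : nat) (V : normedModType R) (k : nat)
    (f : 'rV[R]_d -> V) : Prop :=
  match k with
  | 0%N => continuous f
  | k'.+1 => continuous f /\ forall i : 'I_d,
      (forall x, derivable f x (basis_vec R i)) /\
      Ck k' (fun x => 'D_(basis_vec R i) f x)
  end.

(* C^k(T^d, V), as 1-periodic functions on R^d. *)
Definition Ck_torus (R : realType) (d : nat) (V : normedModType R) (k : nat)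
    (f : 'rV[R]_d -> V) : Prop :=
  (forall x (i : 'I_d), f (x + basis_vec R i) = f x) /\ Ck k f.

Definition gradient (R : realType) (d : nat) (f : 'rV[R]_d -> R)
    (x : 'rV[R]_d) : 'rV[R]_d :=
  \row_(i < d) 'D_(basis_vec R i) f x.

Definition Phi (R : realType) (d K : nat) (y : 'rV[R]_K) (Gamma : 'M[R]_K)
    (G : 'rV[R]_d -> 'rV[R]_K) (theta : 'rV[R]_d) : R :=
  2^-1 * dot_mx Gamma (y - G theta) (y - G theta).

(* Only used for G in C^2(T^d, R^K). *)
Definition beta (R : realType) (d K : nat) (G : 'rV[R]_d -> 'rV[R]_K) : nat :=
  if `[< Ck_torus 3 G >] then 2%N else 1%N.

Definition random_vector (R : realType) (disp : measure_display)
    (Omega : measurableType disp) (d : nat) (X : Omega -> 'rV[R]_d) : Prop :=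
  forall i : 'I_d, measurable_fun setT (fun omega => X omega ord0 i).

(* The sigma-algebra generated by a set of random vectors. *)
Definition sigma_of (R : realType) (disp : measure_display)
    (Omega : measurableType disp) (d : nat) (S : set (Omega -> 'rV[R]_d)) :
    set (set Omega) :=
  <<s [set A | exists2 X, S X & exists (i : 'I_d) (B : set R),
         measurable B /\ A = (fun omega => X omega ord0 i) @^-1` B] >>.

Definition mutually_independent (R : realType) (disp : measure_display)
    (Omega : measurableType disp) (P : probability Omega R) (I : choiceType)
    (F : I -> set (set Omega)) : Prop :=
  forall (D : {fset I}) (A : I -> set Omega),
    (forall i, i \in D -> F i (A i)) ->
    P (\bigcap_(i in [set` D]) A i) = (\prod_(i <- D) P (A i))%E.

Definition independent2 (R : realType) (disp : measure_display)
    (Omega : measurableType disp) (P : probability Omega R)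
    (F1 F2 : set (set Omega)) : Prop :=
  forall A B, F1 A -> F2 B -> P (A `&` B) = (P A * P B)%E.

(* X ~ N(0, s^2 I_d): the law of X agrees on boxes with the d-fold product of
   N(0, s^2); the parameter of [normal_prob] is the standard deviation. *)
Definition gaussian_vector (R : realType) (disp : measure_display)
    (Omega : measurableType disp) (P : probability Omega R) (d : nat) (s : R)
    (X : Omega -> 'rV[R]_d) : Prop :=
  random_vector X /\
  forall B : 'I_d -> set R, (forall i, measurable (B i)) ->
    P [set omega | forall i, B i (X omega ord0 i)] =
    (\prod_(i < d) normal_prob 0 s (B i))%E.

(* Processes indexed by R are only constrained on times t >= 0. *)
Definition brownian_motion (R : realType) (disp : measure_display)
    (Omega : measurableType disp) (P : probability Omega R) (d : nat)
    (w : R -> Omega -> 'rV[R]_d) : Prop :=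
  [/\ forall t, 0 <= t -> random_vector (w t),
      {ae P, forall omega, w 0 omega = 0 /\
         {within `[0, +oo[, continuous (fun t => w t omega)}},
      forall s t, 0 <= s -> s < t ->
        gaussian_vector P (Num.sqrt (t - s))
          (fun omega => w t omega - w s omega) &
      forall t : nat -> R, 0 <= t 0%N ->
        {homo t : m n / (m < n)%N >-> m < n} ->
        mutually_independent P (fun n : nat => sigma_of
          [set (fun omega => w (t n.+1) omega - w (t n) omega)])].

(* x_n = Delta^(-1/2) (w_((n+1) Delta) - w_(n Delta)) *)
Definition bm_incr (R : realType) (Omega : Type) (d : nat) (Delta : R)
    (w : R -> Omega -> 'rV[R]_d) (n : nat) (omega : Omega) : 'rV[R]_d :=
  (Num.sqrt Delta)^-1 *: (w (n.+1%:R * Delta) omega - w (n%:R * Delta) omega).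

(* d(theta) = - grad f(theta) dt + c dw, theta_0 = theta0. The noise is
   additive, so the equation is the pathwise integral equation. *)
Definition langevin_solution (R : realType) (disp : measure_display)
    (Omega : measurableType disp) (P : probability Omega R) (d : nat)
    (f : 'rV[R]_d -> R) (c : R) (w : R -> Omega -> 'rV[R]_d)
    (theta0 : Omega -> 'rV[R]_d) (theta : R -> Omega -> 'rV[R]_d) : Prop :=
  (forall t, 0 <= t -> random_vector (theta t)) /\
  {ae P, forall omega,
     {within `[0, +oo[, continuous (fun t => theta t omega)} /\
     forall t, 0 <= t ->
       theta t omega = theta0 omega
         - \row_(i < d) (\int[lebesgue_measure]_(s in `[0, t])
                           gradient f (theta s omega) ord0 i)
         + c *: w t omega}.

Definition scheme (R : realType) (Omega : Type) (d K J : nat) (y : 'rV[R]_K)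
    (nu : R) (Gamma : 'M[R]_K) (G : 'rV[R]_d -> 'rV[R]_K)
    (delta sigma Delta : R)
    (theta0 : Omega -> 'rV[R]_d) (xi0 : 'I_J -> Omega -> 'rV[R]_d)
    (x : nat -> Omega -> 'rV[R]_d) (xj : nat -> 'I_J -> Omega -> 'rV[R]_d)
    (thetah : nat -> Omega -> 'rV[R]_d)
    (xih : nat -> 'I_J -> Omega -> 'rV[R]_d) : Prop :=
  forall omega,
  [/\ thetah 0%N omega = theta0 omega,
      forall j, xih 0%N j omega = xi0 j omega,
      forall n, thetah n.+1 omega = thetah n omega
        - Delta *: ((J%:R * sigma)^-1 *: \sum_(j < J)
            dot_mx Gamma
              (G (thetah n omega + sigma *: xih n j omega) - G (thetah n omega))
              (G (thetah n omega) - y) *: xih n j omega)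
        + (nu * Num.sqrt (2 * Delta)) *: x n omega &
      forall n j, xih n.+1 j omega =
        expR (- (Delta / delta ^+ 2)) *: xih n j omega
        + Num.sqrt (1 - expR (- (2 * Delta / delta ^+ 2))) *: xj n j omega].

(* Main.v *)
(* The errors of the two solutions are compared coordinatewise. Both are driven
   by the same Brownian increments, so the noise cancels and
     e_n = - (consistency error) - sum_k Delta (grad Phi(thetah_k) - grad Phi(v_k))
           + (error of the rectangle rule along the Langevin path),
   with grad Phi bounded and Lipschitz; discrete Gronwall reduces everything to
   the L^2 size of the other two terms. The rectangle rule costs O(Delta).
   In the consistency error, a Taylor expansion of the difference quotient leaves
     sum_k Delta c(thetah_k) h(xi_k)   with c bounded Lipschitz,
   where h is xi_a xi_b - delta_ab or, with a factor sigma, the third Hermite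
   polynomial or xi_a, plus a remainder O(sigma^beta). Each such h satisfies
   E[h(xi_(n+1)) | past] = lambda h(xi_n) with 0 <= lambda <= alpha =
   exp(-Delta/delta^2). Freezing c over a window of m steps, the L^2 norm
   squared of the sum is O(m Delta + alpha^m), and m Delta ~ 2 delta^2 log(1+1/delta)
   gives the logarithmic term. *)
Require Import Defs.
From HB Require Import structures.
From mathcomp Require Import all_boot all_order all_algebra finmap.
From mathcomp Require Import all_classical all_reals all_analysis.
From mathcomp Require Import measurable_realfun.
From mathcomp Require Import zify ring lra.
Set Implicit Arguments.
Unset Strict Implicit.
Unset Printing Implicit Defensive.
Import Order.TTheory GRing.Theory Num.Theory.
Import numFieldNormedType.Exports.
Local Open Scope classical_set_scope.
Local Open Scope ring_scope.

(** * Lipschitz functions and Taylor expansions *)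

Section Lipschitz.
Context (R : realType) (d : nat).
Implicit Types (f g : 'rV[R]_d -> R) (v x z : 'rV[R]_d).

(** The constant must be fixed before the probability space and the three parameters, so moments are
    not merely finite: they are carried with explicit bounds that depend on the problem data and the
    order alone. For the chain of [xi] this works because its moment generating function stays below
    that of a standard normal variable, whatever [delta] is; its law need not be identified.
    Conditional expectations are replaced by testing against variables measurable for the past,
    which is all that the expansion of a squared sum asks for. Nothing is assumed on the moments of
    [theta0], so only increments, differences and bounded functions of the solutions are ever
    integrated. Time integrals along a Langevin path are never integrated over [Omega]: they are
    limits of Riemann sums, second moments are bounded uniformly for these finite sums, and Fatou's
    lemma carries the bound over. *)

Definition l1norm v : R := \sum_(i < d) `|v ord0 i|.

(** The l1 norm suits arguments along axis-parallel paths: each coordinate contributes its own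
    increment and the contributions add up. *)
Definition lip (L : R) f := forall x z, `|f x - f z| <= L * l1norm (x - z).

(** Boundedness is built in because a product of Lipschitz functions is Lipschitz only when the
    factors are bounded; the coefficients of the expansion are such products. *)
Definition bounded_lip f :=
  exists2 L : R, 0 <= L & (forall x, `|f x| <= L) /\ lip L f.

Lemma l1norm_ge0 v : 0 <= l1norm v.
Proof. exact: sumr_ge0. Qed.

Lemma bounded_lip_cst (c : R) : bounded_lip (fun=> c).
Proof.
exists `|c| => //; split => // x z.
by rewrite subrr normr0 mulr_ge0 ?l1norm_ge0.
Qed.

Lemma bounded_lipD f g : bounded_lip f -> bounded_lip g ->
  bounded_lip (fun x => f x + g x).
Proof.
move=> [L L0 [fL fl]] [M M0 [gM gl]]; exists (L + M); first exact: addr_ge0.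
split=> [x|x z]; first by rewrite (le_trans (ler_normD _ _))// lerD.
rewrite opprD addrACA (le_trans (ler_normD _ _))// mulrDl lerD//.
Qed.

Lemma bounded_lipM f g : bounded_lip f -> bounded_lip g ->
  bounded_lip (fun x => f x * g x).
Proof.
move=> [L L0 [fL fl]] [M M0 [gM gl]].
exists (L * M + (L * M + L * M)); first by rewrite !addr_ge0// mulr_ge0.
split=> [x|x z].
  by rewrite normrM ler_wpDr ?addr_ge0 ?mulr_ge0// ler_pM.
have -> : f x * g x - f z * g z = (f x - f z) * g x + f z * (g x - g z) by ring.
rewrite (le_trans (ler_normD _ _))// !normrM mulrDl.
have n0 := l1norm_ge0 (x - z).
rewrite -[leLHS]add0r; apply: lerD; first by rewrite !mulr_ge0.
rewrite mulrDl; apply: lerD.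
  by rewrite [L * M * _]mulrAC; apply: ler_pM.
by rewrite -mulrA; apply: ler_pM.
Qed.

Lemma bounded_lip_sum (I : Type) (r : seq I) (F : I -> 'rV[R]_d -> R) :
  (forall i, bounded_lip (F i)) -> bounded_lip (fun x => \sum_(i <- r) F i x).
Proof.
move=> H; elim: r => [|a r IH].
  by under eq_fun do rewrite big_nil; exact: bounded_lip_cst.
by under eq_fun do rewrite big_cons; exact: bounded_lipD.
Qed.

End Lipschitz.

Section Taylor.
Context (R : realType) (d : nat).
Implicit Types (f g : 'rV[R]_d -> R) (v x z : 'rV[R]_d) (i j : 'I_d).
Local Notation e := (basis_vec R).
Local Notation "'D f i" := (fun x => 'D_(e i) f x) (at level 10, f, i at next level).

Lemma l1normD v z : l1norm (v + z) <= l1norm v + l1norm z.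
Proof.
by rewrite /l1norm -big_split; apply: ler_sum => i _; rewrite mxE ler_normD.
Qed.

Lemma l1normZ (a : R) v : l1norm (a *: v) = `|a| * l1norm v.
Proof. by rewrite /l1norm big_distrr; apply: eq_bigr => i _; rewrite mxE normrM. Qed.

Lemma l1norm_basis i : l1norm (e i : 'rV[R]_d) = 1.
Proof.
rewrite /l1norm (bigD1 i)//= big1 => [|j ji]; first by rewrite !mxE !eqxx normr1 addr0.
by rewrite !mxE (negbTE ji) normr0.
Qed.

Lemma ler_coord_l1norm v i : `|v ord0 i| <= l1norm v.
Proof. by rewrite /l1norm (bigD1 i)//= lerDl sumr_ge0. Qed.

Lemma is_derive_line f z i (t : R) : derivable f (z + t *: e i) (e i) ->
  is_derive t 1 (fun s : R => f (z + s *: e i)) ('D_(e i) f (z + t *: e i)).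
Proof.
move=> fd.
have E : (fun h : R => h^-1 *: (((fun s : R => f (z + s *: e i)) \o shift t) (h *: 1) -
    f (z + t *: e i))) =
  (fun h : R => h^-1 *: ((f \o shift (z + t *: e i)) (h *: e i) - f (z + t *: e i))).
  apply/funext => h /=; congr (_ *: (f _ - _)).
  by rewrite /= scalerDl addrCA -scalerA scale1r.
apply: DeriveDef.
  by rewrite /derivable E.
by rewrite /derive E.
Qed.

(** The intermediate point is located by absolute values only, so that both signs of [s] are
    covered. *)
Lemma line_mvt f z i (s : R) :
  (forall x, derivable f x (e i)) ->
  exists2 t : R, `|t| <= `|s| &
    f (z + s *: e i) - f z = s * 'D_(e i) f (z + t *: e i).
Proof.
move=> fd; pose phi (t : R) := f (z + t *: e i).
have phid (t : R) : is_derive t 1 phi ('D_(e i) f (z + t *: e i)).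
  exact: is_derive_line.
have phic : continuous phi.
  move=> t; apply: differentiable_continuous; apply/derivable1_diffP.
  exact: (@ex_derive _ _ _ _ _ _ _ (phid t)).
have phi0 : phi 0 = f z by rewrite /phi scale0r addr0.
have [s0|s0] := leP 0 s.
  have [|t] := @MVT_segment _ phi (fun t => 'D_(e i) f (z + t *: e i)) 0 s s0.
  exact: continuous_subspaceT.
  rewrite in_itv/= => /andP[t0 ts]; rewrite subr0 phi0 => H; exists t.
    by rewrite !ger0_norm.
  by rewrite -/(phi s) H mulrC.
have [|t] := @MVT_segment _ phi (fun t => 'D_(e i) f (z + t *: e i)) s 0 (ltW s0).
  exact: continuous_subspaceT.
rewrite in_itv/= => /andP[ts t0]; rewrite sub0r phi0 => H; exists t.
  by rewrite !ler0_norm// ?lerN2// ltW.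
by rewrite -/(phi s) -opprB H mulrN opprK mulrC.
Qed.

(** The corners of the path from [0] to [v] that runs through the coordinates in increasing
    order. *)
Definition axis_prefix v (k : nat) : 'rV[R]_d :=
  \row_i (if (i < k)%N then v ord0 i else 0).

Lemma axis_prefix0 v : axis_prefix v 0 = 0.
Proof. by apply/rowP => i; rewrite !mxE. Qed.

Lemma axis_prefix_full v : axis_prefix v d = v.
Proof. by apply/rowP => i; rewrite !mxE ltn_ord. Qed.

Lemma axis_prefixS v i : axis_prefix v i.+1 = axis_prefix v i + v ord0 i *: e i.
Proof.
apply/rowP => j; rewrite !mxE /= ltnS leq_eqVlt.
have [ji|ji] := eqVneq j i.
  by rewrite ji eqxx/= ltnn add0r mulr1.
by rewrite (_ : (nat_of_ord j == i) = false) ?mulr0 ?addr0//; apply/negbTE.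
Qed.

Lemma l1norm_axis_prefix v k : l1norm (axis_prefix v k) <= l1norm v.
Proof.
apply: ler_sum => i _; rewrite mxE; case: ifP => //.
by rewrite normr0.
Qed.

(* The increment is split along a path parallel to the axes, so that
   one-variable calculus suffices. *)
Lemma telescope_axis_prefix f x v : f (x + v) - f x =
  \sum_(i < d) (f (x + axis_prefix v i + v ord0 i *: e i) - f (x + axis_prefix v i)).
Proof.
under eq_bigr => i _ do rewrite -addrA -axis_prefixS.
rewrite -{1}(axis_prefix_full v) -[in f x](_ : x + axis_prefix v 0 = x); last by rewrite axis_prefix0 addr0.
rewrite -(big_mkord xpredT (fun k => f (x + axis_prefix v k.+1) - f (x + axis_prefix v k))).
by rewrite telescope_sumr.
Qed.

Lemma lip_of_partials f (M : R) : 0 <= M ->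
  (forall i x, derivable f x (e i)) -> (forall i x, `|'D_(e i) f x| <= M) ->
  lip M f.
Proof.
move=> M0 fd fM x z.
rewrite -{1}(subrK z x) [x - z + z]addrC telescope_axis_prefix.
rewrite (le_trans (ler_norm_sum _ _ _))// /l1norm big_distrr/=.
apply: ler_sum => i _.
have [t _ ->] := @line_mvt f (z + axis_prefix (x - z) i) i ((x - z) ord0 i) (fd i).
by rewrite normrM mulrC ler_wpM2r.
Qed.

(** On each leg of the axis path the mean value point is at l1 distance at most [l1norm v] (earlier
    legs) plus [l1norm v] (the leg itself) from [x], which gives the doubled factor. *)
Lemma taylor1 f (L : R) : 0 <= L ->
  (forall i x, derivable f x (e i)) -> (forall i, lip L ('D f i)) ->
  forall x v, `|f (x + v) - f x - \sum_(i < d) v ord0 i * 'D_(e i) f x|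
    <= L * (l1norm v + l1norm v) * l1norm v.
Proof.
move=> L0 fd fL x v.
rewrite telescope_axis_prefix -sumrB (le_trans (ler_norm_sum _ _ _))//.
rewrite [X in _ <= _ * X]/l1norm big_distrr/=.
apply: ler_sum => i _.
have [t tv ->] := @line_mvt f (x + axis_prefix v i) i (v ord0 i) (fd i).
rewrite -mulrBr normrM mulrC ler_wpM2r//.
rewrite (le_trans (fL i _ _))// ler_wpM2l//.
rewrite [x + _ + _ - _]addrAC [x + _ - x]addrAC subrr add0r.
rewrite (le_trans (l1normD _ _))// lerD ?l1norm_axis_prefix//.
rewrite l1normZ l1norm_basis mulr1 (le_trans tv)//.
exact: ler_coord_l1norm.
Qed.

(** The mean value theorem is used twice: on [phi], which is [f] minus the nonconstant part of its
    quadratic Taylor polynomial along the line, and on the first partial inside [dphi], which is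
    thereby of order [s ^+ 2]. The sharp factor 1/6 is not sought. *)
Lemma line_taylor2 f i (L : R) : 0 <= L ->
  (forall x, derivable f x (e i)) -> (forall x, derivable ('D f i) x (e i)) ->
  lip L ('D ('D f i) i) ->
  forall z (s : R), `|f (z + s *: e i) - f z - s * 'D_(e i) f z
     - s ^+ 2 / 2 * 'D_(e i) ('D f i) z| <= L * `|s| ^+ 3.
Proof.
move=> L0 fd fdd fL z s.
pose phi (t : R) := f (z + t *: e i) - t * 'D_(e i) f z
     - t ^+ 2 / 2 * 'D_(e i) ('D f i) z.
pose dphi (t : R) := 'D_(e i) f (z + t *: e i) - 'D_(e i) f z
     - t * 'D_(e i) ('D f i) z.
have phid (t : R) : is_derive t 1 phi (dphi t).
  have := is_derive_line (fd (z + t *: e i)) => H.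
  rewrite /phi /dphi.
  apply: is_derive_eq.
  rewrite !scaler0 add0r !scaler1 add0r /GRing.scale /=.
  by field.
have phic : continuous phi.
  move=> t; apply: differentiable_continuous; apply/derivable1_diffP.
  exact: (@ex_derive _ _ _ _ _ _ _ (phid t)).
have phi0 : phi 0 = f z.
  by rewrite /phi scale0r addr0 mul0r subr0 expr0n/= mul0r mul0r subr0.
have dphiE t : `|t| <= `|s| -> `|dphi t| <= L * `|s| ^+ 2.
  move=> ts; rewrite /dphi.
  have [r rt ->] := @line_mvt ('D f i) z i t fdd.
  rewrite -mulrBr normrM mulrC.
  have H : `|'D_(e i) ('D f i) (z + r *: e i) - 'D_(e i) ('D f i) z| <= L * `|s|.
    rewrite (le_trans (fL _ _))// ler_wpM2l//.
    rewrite [z + _ - _]addrAC subrr add0r l1normZ l1norm_basis mulr1.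
    exact: le_trans ts.
  by rewrite expr2 mulrA ler_pM.
have -> : f (z + s *: e i) - f z - s * 'D_(e i) f z
     - s ^+ 2 / 2 * 'D_(e i) ('D f i) z = phi s - phi 0.
  by rewrite phi0 /phi; ring.
suff [t ts ->] : exists2 t : R, `|t| <= `|s| & phi s - phi 0 = dphi t * s.
  by rewrite normrM exprSr mulrA ler_wpM2r// dphiE.
have [s0|s0] := leP 0 s.
  have [|t] := @MVT_segment _ phi dphi 0 s s0.
  exact: continuous_subspaceT.
  rewrite in_itv/= => /andP[t0 ts]; rewrite subr0 => H; exists t => //.
  by rewrite !ger0_norm.
have [|t] := @MVT_segment _ phi dphi s 0 (ltW s0).
  exact: continuous_subspaceT.
rewrite in_itv/= => /andP[ts t0]; rewrite sub0r => H; exists t.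
  by rewrite !ler0_norm// ?lerN2// ltW.
by rewrite -opprB H mulrN opprK.
Qed.

(** The second-order coefficients as the axis path produces them: leg [i] starts from a point
    displaced only in the coordinates [j < i], so each unordered pair occurs once, with the full
    mixed partial, and the diagonal with one half. Symmetry of second partials is thereby
    avoided. *)
Definition taylor_coef f (i j : 'I_d) (x : 'rV[R]_d) : R :=
  if (j < i)%N then 'D_(e j) ('D f i) x
  else if j == i then 2^-1 * 'D_(e i) ('D f i) x else 0.

(** Each leg is expanded to second order at its starting corner [z]; then the first partial is moved
    from [z] to [x] by [taylor1] and the second one by its Lipschitz bound. The three errors weigh
    1, 2 and 1 times [L * l1norm v ^+ 3], whence 4 per leg. *)
Lemma taylor2 f (L : R) : 0 <= L ->
  (forall i x, derivable f x (e i)) ->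
  (forall i j x, derivable ('D f i) x (e j)) ->
  (forall i j, lip L ('D ('D f i) j)) ->
  forall x v, `|f (x + v) - f x - \sum_(i < d) v ord0 i * 'D_(e i) f x
     - \sum_(i < d) \sum_(j < d) v ord0 i * v ord0 j * taylor_coef f i j x|
    <= 4 * d%:R * L * l1norm v ^+ 3.
Proof.
move=> L0 fd fdd fL x v.
have n0 := l1norm_ge0 v.
rewrite telescope_axis_prefix -!sumrB (le_trans (ler_norm_sum _ _ _))//.
have -> : 4 * d%:R * L * l1norm v ^+ 3 = \sum_(i < d) (4 * L * l1norm v ^+ 3).
  by rewrite sumr_const card_ord -[RHS]mulr_natr; ring.
apply: ler_sum => i _.
set z := x + axis_prefix v i; set s := v ord0 i.
have svn : `|s| <= l1norm v by exact: ler_coord_l1norm.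
have H1 := line_taylor2 L0 (fd i) (fun x => fdd i i x) (fL i i) z s.
have H2 := taylor1 L0 (fun j x => fdd i j x) (fun j => fL i j) x (axis_prefix v i).
have H3 : `|'D_(e i) ('D f i) z - 'D_(e i) ('D f i) x| <= L * l1norm v.
  rewrite (le_trans (fL i i _ _))// ler_wpM2l//.
  by rewrite /z [x + _ - _]addrAC subrr add0r l1norm_axis_prefix.
(* Only the coordinates below [i] survive in [axis_prefix v i], in agreement with the triangular
   [taylor_coef]. *)
have -> : \sum_(j < d) s * v ord0 j * taylor_coef f i j x =
    s * (\sum_(j < d) axis_prefix v i ord0 j * 'D_(e j) ('D f i) x)
    + s ^+ 2 / 2 * 'D_(e i) ('D f i) x.
  rewrite big_distrr/= (bigD1 i)//= [in RHS](bigD1 i)//=.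
  rewrite /taylor_coef ltnn eqxx mxE ltnn mul0r mulr0 add0r [in RHS]addrC.
  congr (_ + _); first by rewrite -/s; ring.
  apply: eq_bigr => j ji; rewrite mxE (negbTE ji); case: ifP => _; ring.
set S := \sum_(j < d) _ in H2 *.
set A := 'D_(e i) ('D f i) z in H1 H3 *.
set B := 'D_(e i) ('D f i) x in H3 *.
set u := 'D_(e i) f z in H1 *.
have -> : f (z + s *: e i) - f z - s * 'D_(e i) f x - (s * S + s ^+ 2 / 2 * B) =
  (f (z + s *: e i) - f z - s * u - s ^+ 2 / 2 * A) +
  (s * (u - 'D_(e i) f x - S) + s ^+ 2 / 2 * (A - B)) by ring.
have s2 : `|s ^+ 2 / 2| <= l1norm v ^+ 2.
  rewrite normrM normrX (_ : `|2^-1| = 2^-1 :> R); last by rewrite ger0_norm// invr_ge0.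
  rewrite ler_pdivrMr// (@le_trans _ _ (l1norm v ^+ 2))//.
    by rewrite lerXn2r// nnegrE.
  by rewrite ler_peMr ?exprn_ge0// ler1n.
rewrite (le_trans (ler_normD _ _))//.
have E : 4 * L * l1norm v ^+ 3 = L * l1norm v ^+ 3 + (2 * L * l1norm v ^+ 3 + L * l1norm v ^+ 3) by ring.
rewrite E; apply: lerD.
  by rewrite (le_trans H1)// ler_wpM2l// lerXn2r// nnegrE.
rewrite (le_trans (ler_normD _ _))// normrM [X in _ + X]normrM; apply: lerD.
  have -> : 2 * L * l1norm v ^+ 3 = l1norm v * (L * (l1norm v + l1norm v) * l1norm v) by ring.
  apply: ler_pM => //; rewrite (le_trans H2)//.
  by rewrite ler_pM ?mulr_ge0 ?addr_ge0 ?l1norm_ge0 ?l1norm_axis_prefix// ler_wpM2l// lerD ?l1norm_axis_prefix.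
have -> : L * l1norm v ^+ 3 = l1norm v ^+ 2 * (L * l1norm v) by ring.
by apply: ler_pM.
Qed.

End Taylor.

(** * The potential and its difference quotients *)

Section Torus.
Context (R : realType) (d : nat).
Implicit Types (f g : 'rV[R]_d -> R) (v x z : 'rV[R]_d) (i j : 'I_d).
Local Notation e := (basis_vec R).

Lemma periodicZ (V : Type) (f : 'rV[R]_d -> V) i :
  (forall x, f (x + e i) = f x) ->
  forall (n : int) x, f (x + n%:~R *: e i) = f x.
Proof.
move=> fe.
have fn (n : nat) x : f (x + n%:R *: e i) = f x.
  elim: n => [|n IH]; first by rewrite scale0r addr0.
  by rewrite -natr1 scalerDl scale1r addrA fe IH.
case=> n x; first exact: fn.
rewrite -[in RHS](fn n.+1) NegzE mulrNz.
by rewrite -[in LHS](fn n.+1) -addrA -scalerDl addNr scale0r addr0 fn.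
Qed.

Lemma periodic_prefix (V : Type) (f : 'rV[R]_d -> V) :
  (forall x i, f (x + e i) = f x) ->
  forall x v, (forall i, exists n : int, v ord0 i = n%:~R) -> f (x + v) = f x.
Proof.
move=> fe x v vn; rewrite -(axis_prefix_full v).
suff H k : (k <= d)%N -> f (x + axis_prefix v k) = f x by exact: H.
elim: k => [|k IH] kd; first by rewrite axis_prefix0 addr0.
rewrite (@axis_prefixS _ _ v (Ordinal kd)) addrA.
have [n ->] := vn (Ordinal kd).
rewrite periodicZ ?IH//; first exact: ltnW.
Qed.

(** Extreme values are attained on the compact unit cube, and removing integer parts moves every
    point into it. *)
Lemma bounded_periodic f : continuous f ->
  (forall x i, f (x + e i) = f x) -> exists M : R, forall x, `|f x| <= M.
Proof.
move=> fc fe.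
pose A := [set v : 'rV[R]_d | forall i, `[0, 1]%classic (v ord0 i)].
have cA : compact A by apply: (@rV_compact R d (fun=> `[0, 1]%classic)) => i; exact: segment_compact.
have A0 : A !=set0 by exists 0 => i /=; rewrite mxE in_itv/= lexx ler01.
have fcA : {within A, continuous f} by exact: continuous_subspaceT.
have [a _ fa] := EVT_max_rV A0 cA fcA.
have [b _ fb] := EVT_min_rV A0 cA fcA.
exists (Num.max `|f a| `|f b|) => x.
pose y : 'rV[R]_d := x + \row_i (- (Num.floor (x ord0 i)))%:~R.
have fxy : f y = f x.
  by apply: periodic_prefix => // i; exists (- Num.floor (x ord0 i)); rewrite mxE.
have Ay : A y.
  move=> i /=; rewrite !mxE mulrNz in_itv/= subr_ge0 ge_floor/=.
  by rewrite lerBlDr addrC -intrD1 ltW// floorD1_gt.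
have {}fa : f y <= f a by apply: fa; rewrite inE.
have {}fb : f b <= f y by apply: fb; rewrite inE.
rewrite -fxy le_max; have [y0|y0] := leP 0 (f y).
  by rewrite (ger0_norm y0) (le_trans fa (ler_norm _)).
by apply/orP; right; rewrite !ltr0_norm// ?lerN2// (le_lt_trans fb).
Qed.

Lemma derive_periodic (V : normedModType R) (f : 'rV[R]_d -> V) w v :
  (forall x, f (x + v) = f x) -> forall x, 'D_w f (x + v) = 'D_w f x.
Proof.
move=> fe x; rewrite /derive.
have -> : (fun h : R => h^-1 *: ((f \o shift (x + v)) (h *: w) - f (x + v))) =
    (fun h : R => h^-1 *: ((f \o shift x) (h *: w) - f x)) => //.
apply/funext => h /=; congr (_ *: _).
by rewrite fe addrA fe.
Qed.

Lemma Ck_torus_partial k f i : Ck_torus k.+1 f ->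
  (forall x, derivable f x (e i)) /\ Ck_torus k (fun x => 'D_(e i) f x).
Proof.
move=> [fe [fc /(_ i) [fd fk]]]; split => //; split => // x j.
by apply: derive_periodic => z; exact: fe.
Qed.

Lemma Ck_continuous (V : normedModType R) k (f : 'rV[R]_d -> V) : Ck k f -> continuous f.
Proof. by case: k => //= k []. Qed.

Lemma Ck_torus_bounded k f : Ck_torus k f -> exists2 M : R, 0 <= M & forall x, `|f x| <= M.
Proof.
move=> [fe /Ck_continuous fc].
have [M HM] := bounded_periodic fc fe.
by exists M => //; apply: le_trans (HM 0).
Qed.

(** The partials are continuous and periodic, hence bounded; this is where one order of smoothness
    is spent. *)
Lemma bounded_lip_torus k f : Ck_torus k.+1 f -> bounded_lip f.
Proof.
move=> fk; have [M0 M00 fM0] := Ck_torus_bounded fk.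
have /choice [N HN] i : exists N : R, 0 <= N /\ forall x, `|'D_(e i) f x| <= N.
  have [_ /Ck_torus_bounded [N]] := Ck_torus_partial i fk.
  by move=> N0 HN; exists N.
have HS i : N i <= \sum_j N j.
  by rewrite (bigD1 i)//= lerDl sumr_ge0// => j _; have [] := HN j.
have S0 : 0 <= \sum_j N j by rewrite sumr_ge0// => j _; have [] := HN j.
exists (M0 + \sum_j N j); first exact: addr_ge0.
split=> [x|]; first by rewrite ler_wpDr.
have H : lip (\sum_j N j) f.
  apply: lip_of_partials => // i x; first by have [] := Ck_torus_partial i fk.
  by apply: le_trans (HS i); have [_] := HN i.
by move=> x z; apply: le_trans (H x z) _; rewrite ler_wpM2r ?l1norm_ge0// lerDr.
Qed.

Lemma Ck_coord K k (F : 'rV[R]_d -> 'rV[R]_K) (j : 'I_K) :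
  Ck k F -> Ck k (fun x => F x ord0 j).
Proof.
elim: k F => [|k IH] F.
  move=> Fc x; apply: (@continuous_comp _ _ _ F (fun M : 'rV[R]_K => M ord0 j)).
    exact: Fc.
  exact: coord_continuous.
move=> [Fc FH]; split.
  move=> x; apply: (@continuous_comp _ _ _ F (fun M : 'rV[R]_K => M ord0 j)).
    exact: Fc.
  exact: coord_continuous.
move=> i; have [Fd Fk] := FH i; split.
  by move=> x; have /derivable_mxP := Fd x; exact.
have -> : (fun x => 'D_(e i) (fun x => F x ord0 j) x) =
    (fun x => ('D_(e i) F x) ord0 j).
  by apply/funext => x; rewrite derive_mx// mxE.
exact: IH.
Qed.

Lemma Ck_torus_coord K k (F : 'rV[R]_d -> 'rV[R]_K) (j : 'I_K) :
  Ck_torus k F -> Ck_torus k (fun x => F x ord0 j).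
Proof.
move=> [Fe Fk]; split; first by move=> x i; rewrite Fe.
exact: Ck_coord.
Qed.

End Torus.

Section Potential.
Context (R : realType) (d K : nat) (y : 'rV[R]_K) (Gamma : 'M[R]_K)
  (G : 'rV[R]_d -> 'rV[R]_K).
Hypothesis Gamma_sym : Gamma^T = Gamma.
Hypothesis GC2 : Ck_torus 2 G.
Local Notation e := (basis_vec R).
Local Notation Gk k := (fun x => G x ord0 k).

(** Coordinates of [Gamma^-1 (G theta - y)]. The gradient of the potential and the difference
    quotient are both combinations with these weights, which reduces the expansion to one for each
    coordinate of [G]. *)
Definition weight (k : 'I_K) (theta : 'rV[R]_d) : R :=
  \sum_(l < K) invmx Gamma k l * (G theta - y) ord0 l.

Lemma dot_mxE (u v : 'rV[R]_K) : dot_mx Gamma u v =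
  \sum_(k < K) u ord0 k * \sum_(l < K) invmx Gamma k l * v ord0 l.
Proof.
apply: eq_bigr => k _; rewrite !mxE; congr (_ * _).
by apply: eq_bigr => l _; rewrite mxE.
Qed.

Lemma dot_mx_weight (u : 'rV[R]_K) theta : dot_mx Gamma u (G theta - y) =
  \sum_(k < K) u ord0 k * weight k theta.
Proof. exact: dot_mxE. Qed.

Lemma bounded_lip_G k : bounded_lip (Gk k).
Proof. by apply: (@bounded_lip_torus _ _ 1); exact: Ck_torus_coord. Qed.

Lemma bounded_lip_partialG k i : bounded_lip (fun x => 'D_(e i) (Gk k) x).
Proof.
apply: (@bounded_lip_torus _ _ 0).
by have [] := Ck_torus_partial i (Ck_torus_coord k GC2).
Qed.

Lemma bounded_lip_weight k : bounded_lip (weight k).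
Proof.
apply: bounded_lip_sum => l; apply: bounded_lipM; first exact: bounded_lip_cst.
have -> : (fun x => (G x - y) ord0 l) = (fun x => G x ord0 l + (- y ord0 l)).
  by apply/funext => x; rewrite !mxE.
by apply: bounded_lipD; [exact: bounded_lip_G|exact: bounded_lip_cst].
Qed.

(** Differentiating the quadratic form gives two mirror-image double sums; symmetry of [invmx Gamma]
    identifies them and cancels the factor one half. *)
Lemma gradientE i theta : gradient (Phi y Gamma G) theta ord0 i =
  \sum_(k < K) 'D_(e i) (Gk k) theta * weight k theta.
Proof.
have sym k l : invmx Gamma k l = invmx Gamma l k.
  by rewrite -{1}Gamma_sym -trmx_inv mxE.
rewrite mxE.
have PhiE : Phi y Gamma G = (fun x => 2^-1 *: \sum_(k < K) \sum_(l < K)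
   invmx Gamma k l *: ((y ord0 k - G x ord0 k) * (y ord0 l - G x ord0 l))).
  apply/funext => x; rewrite /Phi dot_mxE; congr (_ * _).
  apply: eq_bigr => k _; rewrite big_distrr; apply: eq_bigr => l _.
  by rewrite !mxE /GRing.scale/=; ring.
have dG k : is_derive theta (e i) (Gk k) ('D_(e i) (Gk k) theta).
  apply: derivableP.
  by have [] := Ck_torus_partial i (Ck_torus_coord k GC2).
have dterm k l : is_derive theta (e i) (fun x =>
    invmx Gamma k l *: ((y ord0 k - G x ord0 k) * (y ord0 l - G x ord0 l)))
   (- invmx Gamma k l * ('D_(e i) (Gk k) theta * (y ord0 l - G theta ord0 l) +
       'D_(e i) (Gk l) theta * (y ord0 k - G theta ord0 k))).
  have := dG k; have := dG l => H1 H2.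
  apply: is_derive_eq.
  by rewrite /GRing.scale/= !add0r; ring.
have dsum : is_derive theta (e i) (Phi y Gamma G) (2^-1 *: \sum_(k < K) \sum_(l < K)
   (- invmx Gamma k l * ('D_(e i) (Gk k) theta * (y ord0 l - G theta ord0 l) +
       'D_(e i) (Gk l) theta * (y ord0 k - G theta ord0 k)))).
  rewrite PhiE; apply: is_deriveZ.
  rewrite (_ : (fun x => _) = \sum_(k < K) \sum_(l < K) (fun x : 'rV[R]_d =>
      invmx Gamma k l *: ((y ord0 k - G x ord0 k) * (y ord0 l - G x ord0 l)))); last first.
    apply/funext => x; rewrite fct_sumE; apply: eq_bigr => k _; by rewrite fct_sumE.
  by apply: is_derive_sum => k; exact: is_derive_sum.
rewrite derive_val.
have -> : \sum_(k < K) \sum_(l < K)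
   (- invmx Gamma k l * ('D_(e i) (Gk k) theta * (y ord0 l - G theta ord0 l) +
       'D_(e i) (Gk l) theta * (y ord0 k - G theta ord0 k))) =
  \sum_(k < K) \sum_(l < K) invmx Gamma k l * 'D_(e i) (Gk k) theta * (G theta - y) ord0 l +
  \sum_(k < K) \sum_(l < K) invmx Gamma k l * 'D_(e i) (Gk l) theta * (G theta - y) ord0 k.
  rewrite -big_split; apply: eq_bigr => k _; rewrite -big_split; apply: eq_bigr => l _.
  by rewrite !mxE /=; ring.
rewrite [X in _ + X]exchange_big/=.
under [X in _ + X]eq_bigr => l _ do under eq_bigr => k _ do rewrite sym.
set S := \sum_(k < K) \sum_(l < K) _.
have -> : 2^-1 *: (S + S) = S :> R by rewrite /GRing.scale/=; field.
apply: eq_bigr => k _; rewrite big_distrr/=; apply: eq_bigr => l _.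
by ring.
Qed.

Lemma bounded_lip_gradient i :
  bounded_lip (fun x => gradient (Phi y Gamma G) x ord0 i).
Proof.
under eq_fun do rewrite gradientE.
apply: bounded_lip_sum => k; apply: bounded_lipM.
  exact: bounded_lip_partialG.
exact: bounded_lip_weight.
Qed.

(** The Lipschitz bound of [G] absorbs [sigma^-1], so the drift gets moment bounds uniform in
    [sigma], large values included. *)
Lemma difference_quotient_bound : exists2 C : R, 0 <= C &
  forall (sigma : R) (theta xi : 'rV[R]_d), 0 < sigma ->
  `|sigma^-1 * dot_mx Gamma (G (theta + sigma *: xi) - G theta) (G theta - y)|
    <= C * l1norm xi.
Proof.
have /choice[M HM] k : exists M : R, 0 <= M /\ forall (sigma : R) (theta xi : 'rV[R]_d), 0 < sigma ->
    `|sigma^-1 * ((G (theta + sigma *: xi) - G theta) ord0 k * weight k theta)| <= M * l1norm xi.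
  have [L L0 [_ GL]] := bounded_lip_G k.
  have [W W0 [WW _]] := bounded_lip_weight k.
  exists (L * W); split; first exact: mulr_ge0.
  move=> s theta xi s0; rewrite mulrA normrM mulrAC ler_pM//.
  rewrite normrM normfV (gtr0_norm s0) ler_pdivrMl// !mxE.
  rewrite (le_trans (GL _ _))// [theta + _ - _]addrAC subrr add0r l1normZ.
  by rewrite gtr0_norm// mulrCA.
exists (\sum_k M k); first by rewrite sumr_ge0// => k _; have [] := HM k.
move=> s theta xi s0; rewrite dot_mx_weight big_distrr/= (le_trans (ler_norm_sum _ _ _))//.
rewrite big_distrl/=; apply: ler_sum => k _.
by have [_] := HM k; exact.
Qed.

(** A Taylor expansion of each coordinate of [G] with increment [sigma *: xi], divided by [sigma].
    With three derivatives the second-order term is kept explicitly, since bounding it would leave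
    an error of order [sigma] only; it is averaged later. *)
Lemma difference_quotient_expansion :
  exists (c : 'I_d -> 'I_d -> 'rV[R]_d -> R) (C : R),
  [/\ 0 <= C, forall i j, bounded_lip (c i j) &
  forall (sigma : R) (theta xi : 'rV[R]_d), 0 < sigma ->
  `|sigma^-1 * dot_mx Gamma (G (theta + sigma *: xi) - G theta) (G theta - y)
     - \sum_(i < d) xi ord0 i * gradient (Phi y Gamma G) theta ord0 i
     - sigma * \sum_(i < d) \sum_(j < d) xi ord0 i * xi ord0 j * c i j theta|
    <= C * sigma ^+ beta G * l1norm xi ^+ (beta G).+1].
Proof.
suff : exists (h : 'I_K -> 'I_d -> 'I_d -> 'rV[R]_d -> R) (C : 'I_K -> R),
  forall k, [/\ 0 <= C k, forall i j, bounded_lip (h k i j) &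
  forall (theta v : 'rV[R]_d),
  `|(G (theta + v) - G theta) ord0 k
     - \sum_(i < d) v ord0 i * 'D_(e i) (Gk k) theta
     - \sum_(i < d) \sum_(j < d) v ord0 i * v ord0 j * h k i j theta|
    <= C k * l1norm v ^+ (beta G).+1].
  move=> [h [C H]].
  have /choice[W HW] k : exists W : R, 0 <= W /\ forall x, `|weight k x| <= W.
    by have [W W0 [WW _]] := bounded_lip_weight k; exists W.
  exists (fun i j x => \sum_(k < K) h k i j x * weight k x).
  exists (\sum_k W k * C k); split.
  - by rewrite sumr_ge0// => k _; rewrite mulr_ge0//; [have [] := HW k|have [] := H k].
  - move=> i j; apply: bounded_lip_sum => k; apply: bounded_lipM.
      by have [_ ] := H k.
    exact: bounded_lip_weight.
  move=> s theta xi s0.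
  have -> : s^-1 * dot_mx Gamma (G (theta + s *: xi) - G theta) (G theta - y)
     - \sum_(i < d) xi ord0 i * gradient (Phi y Gamma G) theta ord0 i
     - s * \sum_(i < d) \sum_(j < d) xi ord0 i * xi ord0 j * (\sum_(k < K) h k i j theta * weight k theta)
    = \sum_(k < K) s^-1 * (weight k theta * ((G (theta + s *: xi) - G theta) ord0 k
     - \sum_(i < d) (s *: xi) ord0 i * 'D_(e i) (Gk k) theta
     - \sum_(i < d) \sum_(j < d) (s *: xi) ord0 i * (s *: xi) ord0 j * h k i j theta)).
    rewrite dot_mx_weight.
    under [\sum_(i < d) xi ord0 i * gradient _ _ _ _]eq_bigr => i _ do rewrite gradientE big_distrr/=.
    rewrite exchange_big/=.
    under [\sum_(i < d) \sum_(j < d) _ * (\sum_(k < K) _)]eq_bigr => i _ do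
      (under eq_bigr => j _ do rewrite big_distrr/=; rewrite exchange_big/=).
    rewrite [X in _ - s * X]exchange_big/= !big_distrr/= -!sumrB; apply: eq_bigr => k _.
    rewrite !mulrBr; congr (_ - _ - _); first by rewrite [weight _ _ * _]mulrC.
      rewrite !big_distrr/=; apply: eq_bigr => i _; rewrite mxE.
      by field; rewrite gt_eqF.
    rewrite !big_distrr/=; apply: eq_bigr => i _.
    rewrite !big_distrr/=; apply: eq_bigr => j _; rewrite !mxE.
    by field; rewrite gt_eqF.
  rewrite (le_trans (ler_norm_sum _ _ _))// !big_distrl/=.
  apply: ler_sum => k _; rewrite normrM normfV (gtr0_norm s0) ler_pdivrMl// normrM.
  have [_ HWk] := HW k; have [C0 _ Hk] := H k.
  have -> : s * (W k * C k * s ^+ beta G * l1norm xi ^+ (beta G).+1) =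
    W k * (C k * l1norm (s *: xi) ^+ (beta G).+1).
    by rewrite l1normZ gtr0_norm// exprMn (exprS s); move: (beta G) => b; ring.
  by rewrite ler_pM.
(* With two derivatives only, [beta G] is 1: the coefficients are taken to be zero and the quadratic
   term is part of the remainder. *)
rewrite /beta; case: asboolP => [GC3|_]; last first.
  suff /choice[C HC] k : exists C : R, 0 <= C /\
    forall (theta v : 'rV[R]_d),
    `|(G (theta + v) - G theta) ord0 k
      - \sum_(i < d) v ord0 i * 'D_(e i) (Gk k) theta| <= C * l1norm v ^+ 2.
    exists (fun _ _ _ _ => 0), C => k; have [C0 Hk] := HC k; split => //.
      by move=> i j; exact: bounded_lip_cst.
    move=> theta v; rewrite [X in _ - X]big1 ?subr0// => i _.
    by rewrite big1// => j _; rewrite mulr0.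
  have /choice[L HL] i : exists L : R, 0 <= L /\ lip L (fun x => 'D_(e i) (Gk k) x).
    by have [L L0 [_ HL]] := bounded_lip_partialG k i; exists L.
  have S0 : 0 <= \sum_j L j by rewrite sumr_ge0// => j _; have [] := HL j.
  exists (2 * \sum_j L j); split; first by rewrite mulr_ge0.
  move=> theta v; rewrite !mxE.
  have -> : 2 * (\sum_j L j) * l1norm v ^+ 2 = (\sum_j L j) * (l1norm v + l1norm v) * l1norm v.
    by ring.
  apply: (@taylor1 _ _ (Gk k)) => //.
    by move=> i x; have [] := Ck_torus_partial i (Ck_torus_coord k GC2).
  move=> i x z; have [Li0 Hi] := HL i; rewrite (le_trans (Hi _ _))// ler_wpM2r ?l1norm_ge0//.
  by rewrite (bigD1 i)//= lerDl sumr_ge0// => j _; have [] := HL j.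
have G3 k i : Ck_torus 2 (fun x => 'D_(e i) (Gk k) x).
  by have [] := Ck_torus_partial i (Ck_torus_coord k GC3).
have G4 k i j : Ck_torus 1 (fun x => 'D_(e j) (fun x => 'D_(e i) (Gk k) x) x).
  by have [] := Ck_torus_partial j (G3 k i).
have HL k : exists2 L : R, 0 <= L & forall i j, lip L (fun x => 'D_(e j) (fun x => 'D_(e i) (Gk k) x) x).
  have /choice[L HL] (p : 'I_d * 'I_d) : exists L : R, 0 <= L /\ lip L
      (fun x => 'D_(e p.2) (fun x => 'D_(e p.1) (Gk k) x) x).
    by have [L L0 [_ HL]] := bounded_lip_torus (G4 k p.1 p.2); exists L.
  exists (\sum_p L p); first by rewrite sumr_ge0// => j _; have [] := HL j.
  move=> i j x z; have [Li0 Hi] := HL (i, j); rewrite (le_trans (Hi _ _))// ler_wpM2r ?l1norm_ge0//.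
  by rewrite (bigD1 (i, j))//= lerDl sumr_ge0// => p _; have [] := HL p.
have /choice[L {}HL] k : exists L : R, 0 <= L /\
  forall i j, lip L (fun x => 'D_(e j) (fun x => 'D_(e i) (Gk k) x) x).
  by have [L L0 H] := HL k; exists L.
exists (fun k => taylor_coef (Gk k)), (fun k => 4 * d%:R * L k) => k.
have [L0 {}HL] := HL k; split; first by rewrite !mulr_ge0.
  move=> i j; rewrite /taylor_coef; case: (j < i)%N.
    exact: bounded_lip_torus (G4 k i j).
  case: (j == i); last exact: bounded_lip_cst.
  apply: bounded_lipM; first exact: bounded_lip_cst.
  exact: bounded_lip_torus (G4 k i i).
move=> theta v; rewrite !mxE.
apply: (@taylor2 _ _ (Gk k)) => //.
  by move=> i x; have [] := Ck_torus_partial i (Ck_torus_coord k GC2).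
by move=> i j x; have [] := Ck_torus_partial j (G3 k i).
Qed.

End Potential.

(** * Moments and independence *)

Section Moments.
Context (R : realType) (disp : measure_display) (Omega : measurableType disp)
  (P : probability Omega R).
Implicit Types (X Y : Omega -> R) (a b : nat -> R).

(* A class of variables with all moments, with explicit bounds [b q] on
   E|X|^q, so that constants can be chosen before the probability space. *)
Definition moments b X := measurable_fun setT X /\
  forall q, (\int[P]_w (`|X w| ^+ q)%:E <= (b q)%:E)%E.

Local Notation EE X := (Rintegral P setT X).

Lemma measurable_pow X q : measurable_fun setT X ->
  measurable_fun setT (fun w => (`|X w| ^+ q)%:E).
Proof.
move=> mX; apply/measurable_EFinP; apply: measurable_funX.
exact: measurableT_comp.
Qed.

Lemma moments_integrable b X : moments b X -> P.-integrable setT (EFin \o X).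
Proof.
move=> [mX /(_ 1%N) X1]; apply/integrableP; split; first exact/measurable_EFinP.
by rewrite (le_lt_trans _ (ltry (b 1%N)))// (le_trans _ X1).
Qed.

Lemma moments_le b X Y : measurable_fun setT X ->
  (forall w, `|X w| <= `|Y w|) -> moments b Y -> moments b X.
Proof.
move=> mX XY [mY Yb]; split => // q; apply: le_trans (Yb q).
apply: ge0_le_integral => //.
- exact: measurable_pow.
- exact: measurable_pow.
- by move=> w _; rewrite lee_fin lerXn2r// ?nnegrE.
Qed.

(** [|x + y|] is at most twice the larger of the two absolute values, which costs [2 ^+ q]. *)
Lemma momentsD a b X Y : moments a X -> moments b Y ->
  moments (fun q => 2 ^+ q * (a q + b q)) (fun w => X w + Y w).
Proof.
move=> [mX Xa] [mY Yb]; split=> [|q]; first exact: measurable_funD.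
have -> : (2 ^+ q * (a q + b q))%:E = ((2 ^+ q)%:E * ((a q)%:E + (b q)%:E))%E by [].
apply: (@le_trans _ _ (\int[P]_w ((2 ^+ q)%:E * ((`|X w| ^+ q)%:E + (`|Y w| ^+ q)%:E)))%E); last first.
  rewrite ge0_integralZl_EFin ?exprn_ge0//; last first.
  - by apply: emeasurable_funD; exact: measurable_pow.
  - by move=> w _; rewrite adde_ge0// lee_fin exprn_ge0.
  rewrite lee_pmul2l// ?lte_fin ?exprn_gt0// ge0_integralD//; try exact: measurable_pow.
  exact: leeD.
apply: ge0_le_integral => //.
- by apply: measurable_pow; exact: measurable_funD.
- apply: emeasurable_funM => //; apply: emeasurable_funD; exact: measurable_pow.
move=> w _; rewrite -EFinD -EFinM lee_fin.
wlog xy : X Y {mX mY Xa Yb} / `|X w| <= `|Y w|.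
  move=> H; have [/H//|/ltW /H] := leP `|X w| `|Y w|.
  by rewrite addrC [X in _ <= _ * X]addrC.
apply: (@le_trans _ _ ((2 * `|Y w|) ^+ q)).
  rewrite lerXn2r ?nnegrE// ?mulr_ge0//.
  by rewrite (le_trans (ler_normD _ _))// mulr_natl mulr2n lerD2r.
by rewrite exprMn ler_wpM2l ?exprn_ge0// lerDr exprn_ge0.
Qed.

(** From [2 * p * r <= p ^+ 2 + r ^+ 2]. Orders double at each product, which is why the class asks
    for all of them. *)
Lemma momentsM a b X Y : moments a X -> moments b Y ->
  moments (fun q => a (2 * q)%N + b (2 * q)%N) (fun w => X w * Y w).
Proof.
move=> [mX Xa] [mY Yb]; split=> [|q]; first exact: measurable_funM.
apply: (@le_trans _ _ (\int[P]_w ((`|X w| ^+ (2 * q))%:E + (`|Y w| ^+ (2 * q))%:E))%E); last first.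
  rewrite ge0_integralD//; try exact: measurable_pow.
  by rewrite EFinD; apply: leeD.
apply: ge0_le_integral => //.
- by apply: measurable_pow; exact: measurable_funM.
- by apply: emeasurable_funD; exact: measurable_pow.
move=> w _; rewrite -EFinD lee_fin normrM exprMn mulnC !exprM.
have := sqr_ge0 (`|X w| ^+ q - `|Y w| ^+ q).
have : 0 <= `|X w| ^+ q * `|Y w| ^+ q by rewrite mulr_ge0 ?exprn_ge0.
nra.
Qed.

Lemma moments_bounded X (M : R) : measurable_fun setT X ->
  (forall w, `|X w| <= M) -> moments (fun q => M ^+ q) X.
Proof.
move=> mX XM; split=> // q.
apply: (@le_trans _ _ (\int[P]_w (cst (M ^+ q)%:E) w)%E).
  apply: ge0_le_integral => //.
  - exact: measurable_pow.
  - by move=> w _; rewrite lee_fin lerXn2r ?nnegrE// (le_trans _ (XM w)).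
by rewrite integral_cst//= probability_setT mule1.
Qed.

Lemma moments_cst (c : R) : moments (fun q => `|c| ^+ q) (fun=> c).
Proof. exact: moments_bounded. Qed.

Lemma momentsZ b X (c : R) : moments b X ->
  moments (fun q => `|c| ^+ q * b q) (fun w => c * X w).
Proof.
move=> [mX Xb]; split=> [|q]; first exact: measurable_funM.
under eq_integral do rewrite normrM exprMn EFinM.
rewrite ge0_integralZl_EFin ?exprn_ge0//.
- by rewrite EFinM lee_wpmul2l// lee_fin exprn_ge0.
- exact: measurable_pow.
Qed.

Lemma moments_weaken a b X : (forall q, a q <= b q) -> moments a X -> moments b X.
Proof. by move=> ab [mX Xa]; split => // q; rewrite (le_trans (Xa q))// lee_fin. Qed.

Lemma momentsN b X : moments b X -> moments b (fun w => - X w).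
Proof.
move=> Xb; have := Xb.1 => mX.
by apply: moments_le Xb => [|w]; [exact: measurableT_comp|rewrite normrN].
Qed.

Lemma moments_norm b X : moments b X -> moments b (fun w => `|X w|).
Proof.
move=> Xb; have := Xb.1 => mX.
by apply: moments_le Xb => [|w]; [exact: measurableT_comp|rewrite normr_id].
Qed.

Lemma momentsB a b X Y : moments a X -> moments b Y ->
  moments (fun q => 2 ^+ q * (a q + b q)) (fun w => X w - Y w).
Proof. by move=> Xa /momentsN; exact: momentsD. Qed.

(** Only the number of summands and their common bound enter, so the result is available before the
    probability space. *)
Fixpoint sum_bound (n : nat) (b : nat -> R) : nat -> R :=
  if n is n'.+1 then (fun q => 2 ^+ q * (b q + sum_bound n' b q))
  else (fun q => `|0 : R| ^+ q).

Lemma moments_sum (I : Type) (r : seq I) (F : I -> Omega -> R) b :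
  (forall i, moments b (F i)) ->
  moments (sum_bound (size r) b) (fun w => \sum_(i <- r) F i w).
Proof.
move=> H; elim: r => [|i r IH] /=.
  rewrite (_ : (fun w => \sum_(i <- [::]) F i w) = fun=> 0) //; first exact: moments_cst.
  by apply/funext => w; rewrite big_nil.
rewrite (_ : (fun w => \sum_(j <- i :: r) F j w) = fun w => F i w + \sum_(j <- r) F j w) //; first exact: momentsD.
by apply/funext => w; rewrite big_cons.
Qed.

Lemma moments_sum_ord n (F : 'I_n -> Omega -> R) b :
  (forall i, moments b (F i)) ->
  moments (sum_bound n b) (fun w => \sum_(i < n) F i w).
Proof.
move=> H; have := moments_sum (index_enum 'I_n) H.
by rewrite [size _](_ : _ = n)// -[RHS](size_enum_ord n) enumT.
Qed.

Lemma moments_bound_ge0 b X q : moments b X -> 0 <= b q.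
Proof.
move=> [_ /(_ q)]; rewrite -lee_fin; apply: le_trans.
by apply: integral_ge0 => w _; rewrite lee_fin exprn_ge0.
Qed.

Lemma mean_le b X : moments b X -> EE X <= b 1%N.
Proof.
move=> Xb; have iX := moments_integrable Xb.
rewrite (le_trans (ler_norm _))// (le_trans (le_normr_Rintegral _ _))//.
rewrite -lee_fin; apply: le_trans (Xb.2 1%N).
rewrite /Rintegral fineK//.
rewrite ge0_fin_numE; last by apply: integral_ge0 => w _; rewrite lee_fin.
by rewrite (le_lt_trans _ (ltry (b 1%N)))// (le_trans _ (Xb.2 1%N)).
Qed.

Lemma mean_norm_le b X : moments b X -> `|EE X| <= b 1%N.
Proof.
move=> Xb; rewrite ler_norml mean_le// andbT lerNl.
have := mean_le (momentsN Xb).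
rewrite -[X in X <= _ -> _](_ : - EE X = _)//.
rewrite -mulN1r -RintegralZl//; last exact: moments_integrable Xb.
by apply: eq_Rintegral => w _; rewrite mulN1r.
Qed.

Lemma meanD a b X Y : moments a X -> moments b Y ->
  EE (fun w => X w + Y w) = EE X + EE Y.
Proof. by move=> Xa Yb; rewrite RintegralD//; [exact: moments_integrable Xa|exact: moments_integrable Yb]. Qed.

Lemma meanZ b X (c : R) : moments b X -> EE (fun w => c * X w) = c * EE X.
Proof. by move=> Xb; rewrite RintegralZl//; exact: moments_integrable Xb. Qed.

Lemma meanB a b X Y : moments a X -> moments b Y ->
  EE (fun w => X w - Y w) = EE X - EE Y.
Proof. by move=> Xa Yb; rewrite RintegralB//; [exact: moments_integrable Xa|exact: moments_integrable Yb]. Qed.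

Lemma mean_mono a b X Y : moments a X -> moments b Y ->
  (forall w, X w <= Y w) -> EE X <= EE Y.
Proof.
by move=> Xa Yb XY; rewrite le_Rintegral//; [exact: moments_integrable Xa|exact: moments_integrable Yb].
Qed.

Lemma mean_cst (c : R) : \int[P]_w c = c.
Proof. by rewrite Rintegral_cst//= probability_setT mulr1. Qed.

Lemma mean_EFin b X : moments b X -> (forall w, 0 <= X w) ->
  (\int[P]_w (X w)%:E)%E = (EE X)%:E.
Proof.
move=> Xb X0; rewrite /Rintegral fineK//; exact: integrable_fin_num (moments_integrable Xb).
Qed.

Section Independence.

Definition indep X Y := forall A B : set R, measurable A -> measurable B ->
  P (X @^-1` A `&` Y @^-1` B) = (P (X @^-1` A) * P (Y @^-1` B))%E.

(** Independence says that the law of the pair agrees with the product law on rectangles, hence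
    everywhere; then Tonelli applies. *)
Lemma indep_ge0 X Y (f g : R -> R) : measurable_fun setT X -> measurable_fun setT Y ->
  indep X Y -> measurable_fun setT f -> measurable_fun setT g ->
  (forall x, 0 <= f x) -> (forall x, 0 <= g x) ->
  (\int[P]_w (f (X w) * g (Y w))%:E =
   (\int[P]_w (f (X w))%:E) * (\int[P]_w (g (Y w))%:E))%E.
Proof.
move=> mX mY iXY mf mg f0 g0.
pose X' : {mfun Omega >-> R} := mfun_Sub (mem_set mX).
pose Y' : {mfun Omega >-> R} := mfun_Sub (mem_set mY).
have mZ : measurable_fun setT (fun w => (X w, Y w)) by exact: measurable_fun_pair.
pose Z : {mfun Omega >-> (R * R)%type} := mfun_Sub (mem_set mZ).
pose h (z : (measurableTypeR R * measurableTypeR R)%type) : \bar R := (f z.1 * g z.2)%:E.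
have mh : measurable_fun (setT : set (R * R)%type) h.
  apply/measurable_EFinP; apply: measurable_funM; exact: measurableT_comp.
have h0 z : (0 <= h z)%E by rewrite lee_fin mulr_ge0.
have mfE : measurable_fun setT (EFin \o f) by exact/measurable_EFinP.
have mgE : measurable_fun setT (EFin \o g) by exact/measurable_EFinP.
transitivity (\int[distribution P Z]_z h z)%E.
  by rewrite ge0_integral_distribution.
transitivity (\int[distribution P X' \x distribution P Y']_z h z)%E.
  apply: eq_measure_integral => A mA _.
  by apply/esym; apply: product_measure_unique.
rewrite fubini_tonelli1// /fubini_F.
transitivity (\int[distribution P X']_x ((f x)%:E * \int[distribution P Y']_y (g y)%:E))%E.
  apply: eq_integral => x _; rewrite /h/=.
  under eq_integral do rewrite EFinM.
  by rewrite ge0_integralZl_EFin// => y _; rewrite lee_fin.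
rewrite ge0_integralZr//; last by apply: integral_ge0 => y _; rewrite lee_fin.
  by rewrite !ge0_integral_distribution// => y; rewrite lee_fin.
by move=> x _; rewrite lee_fin.
Qed.

(** Both factors are split into positive and negative parts, which are functions of the variables
    and so obey the product rule for nonnegative functions. *)
Lemma mean_indep a b X Y : moments a X -> moments b Y -> indep X Y ->
  EE (fun w => X w * Y w) = EE X * EE Y.
Proof.
move=> Xa Yb iXY.
pose p (x : R) := Num.max x 0; pose m (x : R) := Num.max (- x) 0.
have mp : measurable_fun setT p by apply: measurable_maxr.
have mm : measurable_fun setT m by apply: measurable_maxr => //; exact: measurableT_comp.
have p0 x : 0 <= p x by rewrite le_max lexx orbT.
have m0 x : 0 <= m x by rewrite le_max lexx orbT.
have pmE x : x = p x - m x.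
  rewrite /p /m; have [x0|x0] := leP 0 x; last first.
    by rewrite max_l ?sub0r ?opprK// oppr_ge0 ltW.
  by rewrite max_r ?subr0// oppr_le0.
have pn x : `|p x| <= `|x|.
  by rewrite ger0_norm// /p ge_max normr_ge0 ler_norm.
have mn x : `|m x| <= `|x|.
  by rewrite ger0_norm// /m ge_max normr_ge0 -normrN ler_norm.
have Xp : moments a (fun w => p (X w)).
  by apply: (moments_le _ _ Xa) => //; exact: measurableT_comp Xa.1.
have Xm : moments a (fun w => m (X w)).
  by apply: (moments_le _ _ Xa) => //; exact: measurableT_comp Xa.1.
have Yp : moments b (fun w => p (Y w)).
  by apply: (moments_le _ _ Yb) => //; exact: measurableT_comp Yb.1.
have Ym : moments b (fun w => m (Y w)).
  by apply: (moments_le _ _ Yb) => //; exact: measurableT_comp Yb.1.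
have key (f g : R -> R) : measurable_fun setT f -> measurable_fun setT g ->
    (forall x, 0 <= f x) -> (forall x, 0 <= g x) ->
    moments a (fun w => f (X w)) -> moments b (fun w => g (Y w)) ->
    EE (fun w => f (X w) * g (Y w)) = EE (fun w => f (X w)) * EE (fun w => g (Y w)).
  move=> mf mg f0 g0 fX gY.
  rewrite /Rintegral (indep_ge0 Xa.1 Yb.1 iXY mf mg f0 g0) fineM//.
    exact: integrable_fin_num (moments_integrable fX).
  exact: integrable_fin_num (moments_integrable gY).
transitivity (EE (fun w => (p (X w) * p (Y w) + m (X w) * m (Y w)) -
   (p (X w) * m (Y w) + m (X w) * p (Y w)))).
  apply: eq_Rintegral => w _; rewrite [in LHS](pmE (X w)) [in LHS](pmE (Y w)); ring.
rewrite (meanB (momentsD (momentsM Xp Yp) (momentsM Xm Ym))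
  (momentsD (momentsM Xp Ym) (momentsM Xm Yp))).
rewrite (meanD (momentsM Xp Yp) (momentsM Xm Ym)) (meanD (momentsM Xp Ym) (momentsM Xm Yp)).
rewrite !key//.
have -> : EE X = EE (fun w => p (X w)) - EE (fun w => m (X w)).
  by rewrite -(meanB Xp Xm); apply: eq_Rintegral => w _; rewrite -pmE.
have -> : EE Y = EE (fun w => p (Y w)) - EE (fun w => m (Y w)).
  by rewrite -(meanB Yp Ym); apply: eq_Rintegral => w _; rewrite -pmE.
ring.
Qed.

End Independence.
End Moments.

(** * Gaussian variables *)

Section LipMeasurable.
Context (R : realType) (disp : measure_display) (T : measurableType disp) (d : nat).

Lemma l1norm_dense (x : 'rV[R]_d) (e : R) : 0 < e ->
  exists q : 'rV[rat]_d, l1norm (x - map_mx ratr q) <= e.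
Proof.
move=> e0; pose h : R := e / d.+1%:R.
have h0 : 0 < h by rewrite divr_gt0.
have /choice[q Hq] i : exists q : rat, `|x ord0 i - ratr q| <= h.
  have /rat_in_itvoo[q] : x ord0 i - h < x ord0 i + h by rewrite ltrD2l gtrN.
  rewrite in_itv/= => /andP[q1 q2]; exists q.
  by rewrite ler_distlC; apply/andP; split; [rewrite lerBlDr -lerBlDr ltW|rewrite -lerBlDr lerBlDr]; lra.
exists (\row_i q i); rewrite /l1norm.
apply: (@le_trans _ _ (\sum_(i < d) h)).
  by apply: ler_sum => i _; rewrite !mxE.
rewrite sumr_const card_ord -mulr_natr /h mulrAC ler_pdivrMr// ler_pM2l//.
by rewrite ler_nat.
Qed.

(** McShane's formula: [f x] is the infimum over rational points [q] of [f q + L * l1norm (x - q)],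
    so a sublevel set is a countable union of sublevel sets of functions of the coordinates. The
    argument works for any sigma-algebra on the source, in particular for a generated one. *)
Lemma measurable_lip (f : 'rV[R]_d -> R) (L : R) (X : T -> 'rV[R]_d) : 0 <= L ->
  lip L f -> (forall i, measurable_fun setT (fun w => X w ord0 i)) ->
  measurable_fun setT (fun w => f (X w)).
Proof.
move=> L0 fL mX; apply: (measurability _ (RGenInftyO.measurableE R)).
move=> _ [_ [a ->] <-]; rewrite setTI.
pose g (q : 'rV[rat]_d) w : R := f (map_mx ratr q) + L * l1norm (X w - map_mx ratr q).
have mg q : measurable_fun setT (g q).
  apply: measurable_funD => //; apply: measurable_funM => //.
  apply: measurable_sum => i; apply: measurableT_comp => //.
  under eq_fun do rewrite !mxE.
  exact: measurable_funB.
have -> : (fun w => f (X w)) @^-1` `]-oo, a[%classic =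
    \bigcup_(q : 'rV[rat]_d) (g q @^-1` `]-oo, a[%classic).
  apply/seteqP; split => w /=.
    rewrite in_itv/= => fa.
    (* The error on [f] at the rational point and the penalty are each at most [L * e], together
       less than half of the gap [a - f (X w)]. *)
    pose e := (a - f (X w)) / (4 * (L + 1)).
    have L1 : 0 < 4 * (L + 1) by lra.
    have e0 : 0 < e by rewrite divr_gt0// subr_gt0.
    have [q Hq] := l1norm_dense (X w) e0.
    exists q => //=; rewrite in_itv/= /g.
    have H1 : `|f (X w) - f (map_mx ratr q)| <= L * e.
      by rewrite (le_trans (fL _ _))// ler_wpM2l.
    have H2 : L * l1norm (X w - map_mx ratr q) <= L * e by rewrite ler_wpM2l.
    have H3 : e * (4 * (L + 1)) = a - f (X w) by rewrite /e divfK// gt_eqF.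
    move: H1; rewrite ler_norml => /andP[H1 _].
    have Le : 0 <= L * e by rewrite mulr_ge0// ltW.
    nra.
  move=> [q _] /=; rewrite !in_itv/= /g => ga.
  rewrite (le_lt_trans _ ga)// addrC -lerBlDr (le_trans (ler_norm _))//.
apply: countable_bigcupT_measurable; first exact: countableP.
move=> q; rewrite -[X in measurable X]setTI; exact: mg.
Qed.

End LipMeasurable.

(** * Generated sigma-algebras, adaptedness and independence *)

Section SigmaAlgebras.
Context (R : realType) (disp : measure_display) (Omega : measurableType disp)
  (P : probability Omega R) (d : nat).
Implicit Types (S : set (Omega -> 'rV[R]_d)) (X : Omega -> 'rV[R]_d).

Definition gens S : set (set Omega) :=
  [set A | exists2 X, S X & exists (i : 'I_d) (B : set R),
     measurable B /\ A = (fun omega => X omega ord0 i) @^-1` B].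

(** Measurability with respect to [sigma_of S], encoded by giving the domain the generated
    sigma-algebra as its structure. *)
Definition adapted S (f : Omega -> R) :=
  measurable_fun setT (f : g_sigma_algebraType (gens S) -> R).

Lemma adapted_preimage S f (B : set R) : adapted S f -> measurable B ->
  sigma_of S (f @^-1` B).
Proof. by move=> mf mB; have := mf measurableT B mB; rewrite setTI. Qed.

Lemma adapted_coord S X i : S X -> adapted S (fun w => X w ord0 i).
Proof.
move=> SX _ B mB; rewrite setTI; apply: sub_sigma_algebra.
by exists X => //; exists i, B.
Qed.

Lemma sigma_of_sub S S' :
  (forall X, S X -> forall i, adapted S' (fun w => X w ord0 i)) ->
  sigma_of S `<=` sigma_of S'.
Proof.
move=> H; apply: smallest_sub; first exact: smallest_sigma_algebra.
by move=> _ [X SX [i [B [mB ->]]]]; exact: adapted_preimage (H X SX i) mB.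
Qed.

Lemma adapted_sub S S' f : sigma_of S `<=` sigma_of S' -> adapted S f -> adapted S' f.
Proof.
by move=> SS' mf mD B mB; rewrite setTI; apply: SS'; exact: adapted_preimage.
Qed.

Lemma sigma_of_measurable S : (forall X, S X -> random_vector X) ->
  sigma_of S `<=` measurable.
Proof.
move=> H; apply: smallest_sub; first exact: sigma_algebra_measurable.
move=> _ [X SX [i [B [mB ->]]]].
by rewrite -[X in measurable X]setTI; exact: (H X SX i).
Qed.

Lemma adapted_measurable S f : (forall X, S X -> random_vector X) ->
  adapted S f -> measurable_fun setT f.
Proof.
move=> H mf _ B mB; rewrite setTI; apply: (sigma_of_measurable H).
exact: adapted_preimage.
Qed.

Lemma indep_of_independent2 S S' f g : independent2 P (sigma_of S) (sigma_of S') ->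
  adapted S f -> adapted S' g -> indep P f g.
Proof.
by move=> H mf mg A B mA mB; apply: H; exact: adapted_preimage.
Qed.

(** Uniqueness of finite measures on a class stable under intersection: [P] restricted to [C] and
    [P] scaled by [P C] agree on [G], hence on what it generates. *)
Lemma product_rule_generated (G : set (set Omega)) (C : set Omega) :
  measurable C -> G `<=` measurable -> setI_closed G -> G setT ->
  (forall A, G A -> P (A `&` C) = (P A * P C)%E) ->
  forall A, <<s G >> A -> P (A `&` C) = (P A * P C)%E.
Proof.
move=> mC Gm GI GT GC A sA.
have PC0 : 0 <= fine (P C) by rewrite fine_ge0.
have PCE : (fine (P C))%:E = P C by rewrite fineK// fin_num_measure.
have H := @g_sigma_algebra_measure_unique _ _ _ G Gm (fun=> setT) _ _
   (mrestr P mC) (mscale (NngNum PC0) P) GI _ _ A sA.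
move: H; rewrite /mrestr /mscale/= muleC => H.
rewrite -PCE; apply: H => //.
- by apply: bigcup_const; exists 0%N.
- by move=> B GB; rewrite /mrestr /mscale/= GC// -[in LHS]PCE muleC.
- by move=> _; rewrite /mrestr setTI (le_lt_trans (probability_le1 _ _))// ltry.
Qed.

End SigmaAlgebras.

Section GaussianMoments.
Context (R : realType) (disp : measure_display) (Omega : measurableType disp)
  (P : probability Omega R).
Implicit Types (X : Omega -> R).
Local Notation EE X := (Rintegral P setT X).

Definition gaussian_rv (s : R) X := measurable_fun setT X /\
  forall B : set R, measurable B -> P (X @^-1` B) = normal_prob 0 s B.

(** A bound on the generating function by that of the standard normal law. It passes along the
    autoregression by independence alone and controls every moment. *)
Definition subgaussian X := measurable_fun setT X /\
  forall t : R, (\int[P]_w (expR (t * X w))%:E <= (expR (t ^+ 2 / 2))%:E)%E.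

(** From [|x| ^+ q <= q! (e^x + e^-x)] and the generating function at 1 and -1. *)
Definition gaussian_bound (q : nat) : R := q`!%:R * (2 * expR (2^-1)).

Lemma pow_le_exp (q : nat) (x : R) : `|x| ^+ q <= q`!%:R * (expR x + expR (- x)).
Proof.
have H (z : R) : 0 <= z -> z ^+ q <= q`!%:R * expR z.
  case: q => [|q] z0; first by rewrite expr0 fact0 mul1r -[leLHS]expR0 ler_expR.
  have := expR_ge1Dxn q z0; rewrite -lerBrDl => H.
  rewrite mulrC -ler_pdivrMr ?ltr0n ?fact_gt0//.
  by rewrite (le_trans H)// gerBl.
rewrite (le_trans (H _ (normr_ge0 x)))// ler_wpM2l//.
have [x0|x0] := leP 0 x; first by rewrite ger0_norm// lerDl expR_ge0.
by rewrite ltr0_norm// lerDr expR_ge0.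
Qed.

Lemma measurable_expM X (t : R) : measurable_fun setT X ->
  measurable_fun setT (fun w => (expR (t * X w))%:E).
Proof.
move=> mX; apply/measurable_EFinP; apply: measurableT_comp => //.
exact: measurable_funM.
Qed.

Lemma subgaussian_moments X : subgaussian X -> moments P gaussian_bound X.
Proof.
move=> [mX Xb]; split=> // q.
apply: (@le_trans _ _ (\int[P]_w ((q`!%:R)%:E * ((expR (1 * X w))%:E + (expR (-1 * X w))%:E)))%E).
  apply: ge0_le_integral => //.
  - exact: measurable_pow.
  - apply: emeasurable_funM => //; apply: emeasurable_funD; exact: measurable_expM.
  - by move=> w _; rewrite -EFinD -EFinM lee_fin mul1r mulN1r; exact: pow_le_exp.
rewrite ge0_integralZl_EFin//.
- rewrite EFinM lee_wpmul2l ?lee_fin// ge0_integralD//; try exact: measurable_expM.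
  apply: le_trans (leeD (Xb 1) (Xb (-1))) _.
  by rewrite -EFinD lee_fin sqrrN expr1n mul1r mulr_natl mulr2n.
- by move=> w _; rewrite -EFinD lee_fin addr_ge0 ?expR_ge0.
- by apply: emeasurable_funD; exact: measurable_expM.
Qed.

(** The Radon-Nikodym derivative in the change of variables is almost everywhere the normal density,
    as both have the same integral over every measurable set. *)
Lemma integral_normal_prob_ge0 (s : R) (f : R -> R) : measurable_fun setT f ->
  (forall x, 0 <= f x) ->
  (\int[normal_prob 0 s]_x (f x)%:E =
   \int[lebesgue_measure]_x (f x * normal_pdf 0 s x)%:E)%E.
Proof.
move=> mf f0.
have dom := @normal_prob_dominates R 0 s.
have mfE : measurable_fun setT (EFin \o f) by exact/measurable_EFinP.
rewrite -(Radon_Nikodym_SigmaFinite.change_of_variables dom)//.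
have mpdf : measurable_fun setT (EFin \o normal_pdf 0 s).
  by apply/measurable_EFinP; exact: measurable_normal_pdf.
have iRN := Radon_Nikodym_SigmaFinite.f_integrable dom.
have mRN := measurable_int _ iRN.
under [RHS]eq_integral do rewrite EFinM.
apply: ae_eq_integral => //.
- exact: emeasurable_funM.
- exact: emeasurable_funM.
- apply: ae_eqe_mul2l.
  apply: integral_ae_eq => //.
  by move=> E _ mE; rewrite -Radon_Nikodym_SigmaFinite.f_integral.
Qed.

(** Completing the square turns the tilted density into a multiple of the normal density with mean
    [t * s ^+ 2], whose integral is 1. *)
Lemma normal_mgf (s t : R) : s != 0 ->
  (\int[normal_prob 0 s]_x (expR (t * x))%:E = (expR (t ^+ 2 * s ^+ 2 / 2))%:E)%E.
Proof.
move=> s0; rewrite integral_normal_prob_ge0//; last first.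
  by apply: measurableT_comp => //; exact: measurable_funM.
rewrite -[RHS]mule1 -(integral_normal_pdf (t * s ^+ 2) s) -ge0_integralZl_EFin ?expR_ge0//.
- apply: eq_integral => x _; rewrite -EFinM; congr (_%:E).
  rewrite !normal_pdfE// /normal_fun mulrCA [RHS]mulrCA; congr (_ * _).
  by rewrite -!expRD; congr expR; field.
- by move=> x _; rewrite lee_fin normal_pdf_ge0.
- by apply/measurable_EFinP; exact: measurable_normal_pdf.
Qed.

Lemma gaussian_rv_mgf (s t : R) X : s != 0 -> gaussian_rv s X ->
  (\int[P]_w (expR (t * X w))%:E = (expR (t ^+ 2 * s ^+ 2 / 2))%:E)%E.
Proof.
move=> s0 [mX XB]; rewrite -normal_mgf//.
have mX' : @measurable_fun _ _ Omega (measurableTypeR R) setT X.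
  by move=> _ B mB; exact: mX.
pose X' : {mfun Omega >-> measurableTypeR R} :=
  @mfun_Sub _ _ Omega (measurableTypeR R) X (mem_set mX').
transitivity (\int[distribution P X']_x (expR (t * x))%:E)%E.
  rewrite ge0_integral_distribution//.
  apply/measurable_EFinP; apply: measurableT_comp => //; exact: measurable_funM.
by apply: eq_measure_integral => A mA _; exact: XB.
Qed.

Lemma gaussian_rv_subgaussian (s : R) X : 0 < s -> gaussian_rv s X ->
  subgaussian (fun w => s^-1 * X w).
Proof.
move=> s0 gX; split; first by apply: measurable_funM => //; exact: gX.1.
move=> t; under eq_integral do rewrite mulrA.
rewrite (gaussian_rv_mgf _ _ gX) ?gt_eqF// lee_fin ler_expR.
by rewrite le_eqVlt; apply/orP; left; apply/eqP; field; rewrite gt_eqF.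
Qed.

(* Variance proxies add up under independence; here they are the squares of
   the coefficients of a stationary autoregression. *)
Lemma subgaussian_indep_comb X Y (a b : R) : subgaussian X -> subgaussian Y ->
  indep P X Y -> a ^+ 2 + b ^+ 2 = 1 -> subgaussian (fun w => a * X w + b * Y w).
Proof.
move=> [mX Xb] [mY Yb] iXY ab; split.
  by apply: measurable_funD; apply: measurable_funM.
move=> t.
under eq_integral do rewrite mulrDr expRD !mulrA.
rewrite (@indep_ge0 _ _ _ _ _ _ (fun x => expR (t * a * x)) (fun x => expR (t * b * x)))//.
- apply: le_trans (lee_pmul _ _ (Xb (t * a)) (Yb (t * b))) _.
  + by apply: integral_ge0 => w _; rewrite lee_fin expR_ge0.
  + by apply: integral_ge0 => w _; rewrite lee_fin expR_ge0.
  rewrite -EFinM -expRD lee_fin ler_expR.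
  have -> : (t * a) ^+ 2 / 2 + (t * b) ^+ 2 / 2 = t ^+ 2 / 2 * (a ^+ 2 + b ^+ 2) by ring.
  by rewrite ab mulr1.
- by apply: measurableT_comp => //; exact: measurable_funM.
- by apply: measurableT_comp => //; exact: measurable_funM.
Qed.

End GaussianMoments.

(** * Exponential remainders, and exact normal moments up to order three *)

Section ExpTaylor.
Context (R : realType).

(** One integration, through the mean value theorem, raises the order of vanishing at 0 by one;
    iterating it from [expR] replaces a Taylor formula with remainder. *)
Lemma exp_remainder_step (k : nat) (f df : R -> R) :
  (forall x : R, is_derive x 1 f (df x)) -> f 0 = 0 ->
  (forall x, `|df x| <= `|x| ^+ k * expR `|x|) ->
  forall x, `|f x| <= `|x| ^+ k.+1 * expR `|x|.
Proof.
move=> fd f0 dfb x.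
have fc : continuous f.
  move=> t; apply: differentiable_continuous; apply/derivable1_diffP.
  exact: (@ex_derive _ _ _ _ _ _ _ (fd t)).
suff [t tx ->] : exists2 t : R, `|t| <= `|x| & f x = df t * x.
  rewrite normrM exprSr mulrAC ler_wpM2r// (le_trans (dfb t))//.
  by rewrite ler_pM ?exprn_ge0 ?expR_ge0 ?ler_expR// lerXn2r ?nnegrE.
have [x0|x0] := leP 0 x.
  have [|t] := @MVT_segment _ f df 0 x x0.
    exact: continuous_subspaceT.
  rewrite in_itv/= => /andP[t0 tx]; rewrite f0 !subr0 => H; exists t => //.
  by rewrite !ger0_norm.
have [|t] := @MVT_segment _ f df x 0 (ltW x0).
  exact: continuous_subspaceT.
rewrite in_itv/= => /andP[tx t0]; rewrite f0 !sub0r => H; exists t.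
  by rewrite !ler0_norm// ?lerN2// ltW.
by apply: oppr_inj; rewrite H mulrN.
Qed.

Lemma exp_taylor3 (x : R) :
  `|expR x - (1 + x + x ^+ 2 / 2 + x ^+ 3 / 6)| <= `|x| ^+ 4 * expR `|x|.
Proof.
move: x; apply: (@exp_remainder_step 3 _ (fun x => expR x - (1 + x + x ^+ 2 / 2))).
- move=> x; apply: is_derive_eq.
  by rewrite !scaler0 !add0r /GRing.scale/=; field.
- by rewrite expR0 !expr0n/= !mul0r !addr0 subrr.
apply: (@exp_remainder_step 2 _ (fun x => expR x - (1 + x))).
- move=> x; apply: is_derive_eq.
  by rewrite !scaler0 !add0r /GRing.scale/=; field.
- by rewrite expR0 !expr0n/= !mul0r !addr0 subrr.
apply: (@exp_remainder_step 1 _ (fun x => expR x - 1)).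
- move=> x; apply: is_derive_eq.
  by rewrite !add0r.
- by rewrite expR0 addr0 subrr.
apply: (@exp_remainder_step 0 _ expR).
- by move=> x; apply: is_derive_eq; rewrite subr0.
- by rewrite expR0 subrr.
by move=> x; rewrite expr0 mul1r ger0_norm ?expR_ge0// ler_expR ler_norm.
Qed.

Lemma eq0_of_small (a B : R) : 0 <= B ->
  (forall t : R, 0 < t -> t <= 1 -> `|a| <= B * t) -> a = 0.
Proof.
move=> B0 H; apply/eqP; rewrite -normr_le0 leNgt; apply/negP => a0.
have B1 : 0 < 2 * (B + 1) by lra.
(* At this [t] the bound [B * t] is at most half of [|a|]. *)
pose t := Num.min 1 (`|a| / (2 * (B + 1))).
have t0 : 0 < t by rewrite lt_min ltr01 divr_gt0.
have t1 : t <= 1 by rewrite ge_min lexx.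
have t2 : t * (2 * (B + 1)) <= `|a| by rewrite -ler_pdivlMr// ge_min lexx orbT.
have := H t t0 t1.
nra.
Qed.

End ExpTaylor.

Section ExactMoments.
Context (R : realType) (disp : measure_display) (Omega : measurableType disp)
  (P : probability Omega R).
Implicit Types (X : Omega -> R).
Local Notation EE X := (Rintegral P setT X).

Lemma gaussian_rv1_subgaussian X : gaussian_rv P 1 X -> subgaussian P X.
Proof.
move=> /(gaussian_rv_subgaussian ltr01) H.
by rewrite (_ : X = (fun w => 1^-1 * X w))//; apply/funext => w; rewrite invr1 mul1r.
Qed.

Lemma exp_moments X (t : R) : gaussian_rv P 1 X ->
  exists b, moments P b (fun w => expR (t * X w)).
Proof.
move=> gX; exists (fun q => expR ((q%:R * t) ^+ 2 / 2)).
split=> [|q]; first by apply: measurableT_comp => //; apply: measurable_funM => //; exact: gX.1.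
under eq_integral do rewrite ger0_norm ?expR_ge0// -expRM_natl mulrA.
by rewrite (gaussian_rv_mgf _ _ gX)// expr1n mulr1.
Qed.

(** The moments are read off the generating function: comparing its cubic Taylor polynomial in [t]
    with that of [expR (t ^+ 2 / 2)] leaves a polynomial of degree three and size [O(t^4)], whose
    coefficients must vanish. *)
Lemma gaussian_rv1_moments X : gaussian_rv P 1 X ->
  [/\ EE X = 0, EE (fun w => X w ^+ 2) = 1 & EE (fun w => X w ^+ 3) = 0].
Proof.
move=> gX; have mX := subgaussian_moments (gaussian_rv1_subgaussian gX).
have mX2 : moments P _ (fun w => X w ^+ 2) := momentsM mX mX.
have mX3 : exists b, moments P b (fun w => X w ^+ 3).
  by eexists; under eq_fun do rewrite exprS; exact: (momentsM mX mX2).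
have [b3 {}mX3] := mX3.
have [bp mp] := exp_moments 1 gX.
have [bm mm] := exp_moments (-1) gX.
have mX4 : moments P _ (fun w => X w ^+ 2 * X w ^+ 2) := momentsM mX2 mX2.
have mD := momentsM mX4 (momentsD mp mm).
set m1 := EE X; set m2 := EE (fun w => X w ^+ 2); set m3 := EE (fun w => X w ^+ 3).
(* A majorant, uniform in [|t| <= 1], of the mean Taylor remainder of [expR (t * X w)] divided by
   [t ^+ 4]. *)
set C := EE (fun w => (X w ^+ 2 * X w ^+ 2) * (expR (1 * X w) + expR (-1 * X w))) in mD *.
have C0 : 0 <= C.
  apply: Rintegral_ge0 => w _; rewrite mulr_ge0 ?addr_ge0 ?expR_ge0//.
  by rewrite mulr_ge0 ?sqr_ge0.
pose B := C + expR 1.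
have B0 : 0 <= B by rewrite addr_ge0 ?expR_ge0.
have key (t : R) : `|t| <= 1 ->
    `|t * m1 + t ^+ 2 * ((m2 - 1) / 2) + t ^+ 3 * (m3 / 6)| <= B * `|t| ^+ 4.
  move=> t1; have [bt mt] := exp_moments t gX.
  have mq := momentsD (momentsD (momentsD (moments_cst P 1) (momentsZ t mX)) (momentsZ (t ^+ 2 / 2) mX2))
     (momentsZ (t ^+ 3 / 6) mX3).
  have mr := momentsB mt mq.
  have Eq : EE (fun w => 1 + t * X w + t ^+ 2 / 2 * X w ^+ 2 + t ^+ 3 / 6 * X w ^+ 3) =
     1 + t * m1 + t ^+ 2 / 2 * m2 + t ^+ 3 / 6 * m3.
    rewrite (meanD (momentsD (momentsD (moments_cst P 1) (momentsZ t mX)) (momentsZ (t ^+ 2 / 2) mX2))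
     (momentsZ (t ^+ 3 / 6) mX3)).
    rewrite (meanD (momentsD (moments_cst P 1) (momentsZ t mX)) (momentsZ (t ^+ 2 / 2) mX2)).
    rewrite (meanD (moments_cst P 1) (momentsZ t mX)) mean_cst.
    by rewrite (meanZ _ mX) (meanZ _ mX2) (meanZ _ mX3).
  have Et : EE (fun w => expR (t * X w)) = expR (t ^+ 2 / 2).
    by rewrite /Rintegral (gaussian_rv_mgf _ _ gX)//= expr1n mulr1.
  have Er : `|expR (t ^+ 2 / 2) - (1 + t * m1 + t ^+ 2 / 2 * m2 + t ^+ 3 / 6 * m3)| <= C * `|t| ^+ 4.
    rewrite -Et -Eq -(meanB mt mq) (le_trans (le_normr_Rintegral _ (moments_integrable mr)))//.
    rewrite [leRHS]mulrC /C -(meanZ _ mD).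
    have nr := moments_norm mr.
    apply: (mean_mono nr (momentsZ _ mD)) => w.
    have -> : 1 + t * X w + t ^+ 2 / 2 * X w ^+ 2 + t ^+ 3 / 6 * X w ^+ 3 =
      1 + (t * X w) + (t * X w) ^+ 2 / 2 + (t * X w) ^+ 3 / 6 by ring.
    rewrite (le_trans (exp_taylor3 _))// normrM exprMn -[leLHS]mulrA ler_wpM2l ?exprn_ge0//.
    have -> : `|X w| ^+ 4 = X w ^+ 2 * X w ^+ 2.
      by rewrite -normrX ger0_norm ?exprn_even_ge0// -exprD.
    apply: ler_wpM2l; first by rewrite mulr_ge0 ?sqr_ge0.
    rewrite mul1r mulN1r.
    have tX : `|t| * `|X w| <= `|X w| by rewrite ler_piMl.
    apply: (@le_trans _ _ (expR `|X w|)); first by rewrite ler_expR.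
    have [x0|x0] := leP 0 (X w); first by rewrite ger0_norm// lerDl expR_ge0.
    by rewrite ltr0_norm// lerDr expR_ge0.
  have Ee : `|expR (t ^+ 2 / 2) - (1 + t ^+ 2 / 2)| <= expR 1 * `|t| ^+ 4.
    have h0 : 0 <= t ^+ 2 / 2 by rewrite divr_ge0 ?sqr_ge0.
    have h1 : t ^+ 2 / 2 <= 1.
      have : t ^+ 2 <= 1 by rewrite -real_normK ?num_real// exprn_ile1.
      lra.
    have Q : `|expR (t ^+ 2 / 2) - (1 + t ^+ 2 / 2)| <= `|t ^+ 2 / 2| ^+ 2 * expR `|t ^+ 2 / 2|.
      apply: (@exp_remainder_step _ 1 (fun x => expR x - (1 + x)) (fun x => expR x - 1)).
      - move=> x; apply: is_derive_eq.
        by rewrite !add0r.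
      - by rewrite expR0 addr0 subrr.
      apply: (@exp_remainder_step _ 0 (fun x => expR x - 1) expR).
      - by move=> x; apply: is_derive_eq; rewrite subr0.
      - by rewrite expR0 subrr.
      by move=> x; rewrite expr0 mul1r ger0_norm ?expR_ge0// ler_expR ler_norm.
    rewrite (le_trans Q)// mulrC ger0_norm// ler_pM ?expR_ge0 ?sqr_ge0 ?ler_expR//.
    rewrite -normrX ger0_norm ?exprn_even_ge0//.
    have -> : t ^+ 4 = (t ^+ 2) ^+ 2 by rewrite -exprM.
    rewrite lerXn2r ?nnegrE ?sqr_ge0//; have := sqr_ge0 t; lra.
  have -> : t * m1 + t ^+ 2 * ((m2 - 1) / 2) + t ^+ 3 * (m3 / 6) =
     (expR (t ^+ 2 / 2) - (1 + t ^+ 2 / 2)) -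
     (expR (t ^+ 2 / 2) - (1 + t * m1 + t ^+ 2 / 2 * m2 + t ^+ 3 / 6 * m3)) by field.
  by rewrite (le_trans (ler_normB _ _))// /B mulrDl addrC lerD.
(* Adding and subtracting the values at [t] and [- t] separates the even coefficient from the two
   odd ones. *)
have ev (t : R) : 0 < t -> t <= 1 -> `|t ^+ 2 * ((m2 - 1) / 2)| <= B * t ^+ 4.
  move=> t0 t1; have t0' := ltW t0.
  have := key t; have := key (- t); rewrite normrN (ger0_norm t0') => /(_ t1) H1 /(_ t1) H2.
  have -> : t ^+ 2 * ((m2 - 1) / 2) =
    ((t * m1 + t ^+ 2 * ((m2 - 1) / 2) + t ^+ 3 * (m3 / 6)) +
    (- t * m1 + (- t) ^+ 2 * ((m2 - 1) / 2) + (- t) ^+ 3 * (m3 / 6))) / 2 by field.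
  rewrite normrM (_ : `|2^-1| = 2^-1 :> R) ?ler_pdivrMr//; last by rewrite ger0_norm ?invr_ge0.
  by rewrite (le_trans (ler_normD _ _))// mulr_natr mulr2n lerD.
have od (t : R) : 0 < t -> t <= 1 -> `|t * m1 + t ^+ 3 * (m3 / 6)| <= B * t ^+ 4.
  move=> t0 t1; have t0' := ltW t0.
  have := key t; have := key (- t); rewrite normrN (ger0_norm t0') => /(_ t1) H1 /(_ t1) H2.
  have -> : t * m1 + t ^+ 3 * (m3 / 6) =
    ((t * m1 + t ^+ 2 * ((m2 - 1) / 2) + t ^+ 3 * (m3 / 6)) -
    (- t * m1 + (- t) ^+ 2 * ((m2 - 1) / 2) + (- t) ^+ 3 * (m3 / 6))) / 2 by field.
  rewrite normrM (_ : `|2^-1| = 2^-1 :> R) ?ler_pdivrMr//; last by rewrite ger0_norm ?invr_ge0.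
  by rewrite (le_trans (ler_normB _ _))// mulr_natr mulr2n lerD.
(* The cubic term counts as an error here; [m3] is reached once [m1] is known to vanish. *)
have E1 : m1 = 0.
  apply: (@eq0_of_small _ _ (B + `|m3 / 6|)) => [|t t0 t1]; first exact: addr_ge0.
  have := od t t0 t1 => H.
  have H' : `|t * m1| <= B * t ^+ 4 + t ^+ 3 * `|m3 / 6|.
    rewrite -[t * m1](addrK (t ^+ 3 * (m3 / 6))) (le_trans (ler_normB _ _))// lerD//.
    by rewrite normrM ger0_norm// exprn_ge0// ltW.
  rewrite -(ler_pM2l t0) -{1}(ger0_norm (ltW t0)) -normrM (le_trans H')//.
  have -> : t * ((B + `|m3 / 6|) * t) = B * t ^+ 2 + t ^+ 2 * `|m3 / 6| by ring.
  have t0' := ltW t0.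
  apply: lerD; first by rewrite ler_wpM2l// ler_wiXn2l.
  by rewrite ler_wpM2r// ler_wiXn2l.
have E2 : (m2 - 1) / 2 = 0.
  apply: (@eq0_of_small _ _ B) => // t t0 t1.
  have := ev t t0 t1; have t2 : 0 < t ^+ 2 by rewrite exprn_gt0.
  rewrite normrM (ger0_norm (ltW t2)) => H.
  rewrite -(ler_pM2l t2) (le_trans H)//.
  have -> : t ^+ 2 * (B * t) = B * t ^+ 3 by ring.
  by rewrite ler_wpM2l// ler_wiXn2l// ltW.
have E3 : m3 / 6 = 0.
  apply: (@eq0_of_small _ _ B) => // t t0 t1.
  have := od t t0 t1; have t3 : 0 < t ^+ 3 by rewrite exprn_gt0.
  rewrite E1 mulr0 add0r normrM (ger0_norm (ltW t3)) => H.
  rewrite -(ler_pM2l t3) (le_trans H)//.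
  by rewrite le_eqVlt; apply/orP; left; apply/eqP; ring.
split => //; lra.
Qed.

End ExactMoments.

Section AllMoments.
Context (R : realType) (disp : measure_display) (Omega : measurableType disp)
  (P : probability Omega R).
Implicit Types (X Y : Omega -> R).
Local Notation EE X := (Rintegral P setT X).

(** For places where no bound enters a constant and only integrability is at stake. *)
Definition all_moments X := exists b, moments P b X.

Lemma all_momentsD X Y : all_moments X -> all_moments Y -> all_moments (fun w => X w + Y w).
Proof. by move=> [a Xa] [b Yb]; eexists; exact: momentsD Xa Yb. Qed.

Lemma all_momentsB X Y : all_moments X -> all_moments Y -> all_moments (fun w => X w - Y w).
Proof. by move=> [a Xa] [b Yb]; eexists; exact: momentsB Xa Yb. Qed.

Lemma all_momentsM X Y : all_moments X -> all_moments Y -> all_moments (fun w => X w * Y w).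
Proof. by move=> [a Xa] [b Yb]; eexists; exact: momentsM Xa Yb. Qed.

Lemma all_moments_cst (c : R) : all_moments (fun=> c).
Proof. by eexists; exact: moments_cst. Qed.

Lemma all_moments_measurable X : all_moments X -> measurable_fun setT X.
Proof. by case=> b []. Qed.

Lemma all_meanD X Y : all_moments X -> all_moments Y ->
  EE (fun w => X w + Y w) = EE X + EE Y.
Proof. by move=> [a Xa] [b Yb]; exact: meanD Xa Yb. Qed.

Lemma all_meanB X Y : all_moments X -> all_moments Y ->
  EE (fun w => X w - Y w) = EE X - EE Y.
Proof. by move=> [a Xa] [b Yb]; exact: meanB Xa Yb. Qed.

Lemma all_meanZ (c : R) X : all_moments X -> EE (fun w => c * X w) = c * EE X.
Proof. by move=> [a Xa]; exact: meanZ Xa. Qed.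

Lemma all_mean_indep X Y : all_moments X -> all_moments Y -> indep P X Y ->
  EE (fun w => X w * Y w) = EE X * EE Y.
Proof. by move=> [a Xa] [b Yb]; exact: mean_indep Xa Yb. Qed.

End AllMoments.

Section GaussianVectors.
Context (R : realType) (disp : measure_display) (Omega : measurableType disp)
  (P : probability Omega R) (d : nat).
Local Notation EE X := (Rintegral P setT X).

Lemma gaussian_vector_coord (s : R) (X : Omega -> 'rV[R]_d) a :
  gaussian_vector P s X -> gaussian_rv P s (fun w => X w ord0 a).
Proof.
move=> [mX XB]; split; first exact: mX.
move=> B mB; have := XB (fun k => if k == a then B else setT) _.
rewrite (bigD1 a)//= eqxx big1 ?mule1; last first.
  by move=> k /negbTE ->; exact: probability_setT.
move=> <-; last by move=> k; case: ifP.
congr (P _); apply/seteqP; split => w /=.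
  by move=> Bw k; case: (eqVneq k a) => [->|].
by move=> /(_ a); rewrite eqxx.
Qed.

Context (X : Omega -> 'rV[R]_d).
Hypothesis gX : gaussian_vector P 1 X.
Local Notation x a := (fun w => X w ord0 a).

Lemma coord_all_moments a : all_moments P (x a).
Proof.
eexists; apply: subgaussian_moments; apply: gaussian_rv1_subgaussian.
exact: gaussian_vector_coord.
Qed.

(** Rectangles in the coordinates [a] and [b] form a class stable under intersection, on which the
    box formula gives the product rule; [a = b] is allowed. *)
Lemma indep_coord2 a b c : c != a -> c != b ->
  indep P (fun w => X w ord0 a * X w ord0 b) (x c).
Proof.
move=> ca cb A C mA mC; have [mX XB] := gX.
pose G := [set E | exists (A1 B1 : set R), [/\ measurable A1, measurable B1 &
   E = x a @^-1` A1 `&` x b @^-1` B1]].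
have mpre k (B : set R) : measurable B -> measurable (x k @^-1` B).
  by move=> mB; rewrite -[X in measurable X]setTI; exact: mX.
apply: (@product_rule_generated _ _ _ P G).
- exact: mpre.
- by move=> _ [A1 [B1 [mA1 mB1 ->]]]; apply: measurableI; exact: mpre.
- move=> _ _ [A1 [B1 [mA1 mB1 ->]]] [A2 [B2 [mA2 mB2 ->]]].
  exists (A1 `&` A2), (B1 `&` B2); split; [exact: measurableI|exact: measurableI|].
  by rewrite !preimage_setI setIACA.
- by exists setT, setT; split => //; rewrite !preimage_setT setTI.
- move=> _ [A1 [B1 [mA1 mB1 ->]]].
  pose box (D : set R) k : set R := (if k == a then A1 else setT) `&`
     (if k == b then B1 else setT) `&` (if k == c then D else setT).
  have mbox D k : measurable D -> measurable (box D k).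
    by move=> mD; apply: measurableI; [apply: measurableI|]; case: ifP.
  have boxE D : [set w | forall k, box D k (X w ord0 k)] =
      x a @^-1` A1 `&` x b @^-1` B1 `&` x c @^-1` D.
    apply/seteqP; split => w /=.
      move=> H; have := H a; have := H b; have := H c; rewrite /box !eqxx /=.
      by move=> [_ ?] [[_ ?] _] [[? _] _].
    move=> [[H1 H2] H3] k; rewrite /box.
    by split; [split|]; case: eqVneq => // ->.
  have boxP D : measurable D -> P (x a @^-1` A1 `&` x b @^-1` B1 `&` x c @^-1` D) =
     (normal_prob 0 1 D * \prod_(k < d | k != c) normal_prob 0 1 (box setT k))%E.
    move=> mD; rewrite -boxE XB; last by move=> k; exact: mbox.
    rewrite (bigD1 c)//=; congr (_ * _)%E.
      by rewrite /box eqxx (negbTE ca) (negbTE cb) !setTI.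
    by apply: eq_bigr => k /negbTE kc; rewrite /box kc.
  have H1 := boxP _ mC.
  have H2 := boxP _ (@measurableT _ (measurableTypeR R)).
  rewrite preimage_setT setIT probability_setT mul1e in H2.
  rewrite H1 H2 muleC; congr (_ * _)%E.
  by rewrite (gaussian_vector_coord c gX).2.
- suff : measurable_fun setT ((fun w => X w ord0 a * X w ord0 b) :
      g_sigma_algebraType G -> R) by move/(_ measurableT A mA); rewrite setTI.
  apply: (@measurable_funM _ (g_sigma_algebraType G)).
    move=> _ B mB; rewrite setTI; apply: sub_sigma_algebra.
    by exists B, setT; split => //; rewrite preimage_setT setIT.
  move=> _ B mB; rewrite setTI; apply: sub_sigma_algebra.
  by exists setT, B; split => //; rewrite preimage_setT setTI.
Qed.

Lemma indep_coord a c : c != a -> indep P (x a) (x c).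
Proof.
move=> ca A C mA mC; have [mX XB] := gX.
pose box k : set R := (if k == a then A else setT) `&` (if k == c then C else setT).
have -> : x a @^-1` A `&` x c @^-1` C = [set w | forall k, box k (X w ord0 k)].
  apply/seteqP; split => w /=.
    move=> [H1 H2] k; rewrite /box.
    by split; case: eqVneq => // ->.
  move=> H; have := H a; have := H c; rewrite /box !eqxx /=.
  by move=> [_ ?] [? _].
rewrite XB; last by move=> k; apply: measurableI; case: ifP.
rewrite (bigD1 a)//= (bigD1 c)//= big1 ?mule1; last first.
  by move=> k /andP[/negbTE ka /negbTE kc]; rewrite /box ka kc setTI; exact: probability_setT.
rewrite /box !eqxx (negbTE ca) eq_sym (negbTE ca) setTI setIT.
by rewrite (gaussian_vector_coord a gX).2// (gaussian_vector_coord c gX).2.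
Qed.

Lemma mean_coord a : EE (x a) = 0.
Proof. by have [] := gaussian_rv1_moments (gaussian_vector_coord a gX). Qed.

Lemma mean_coord2 a b : EE (fun w => X w ord0 a * X w ord0 b) = (a == b)%:R.
Proof.
have [->|ab] := eqVneq a b.
  by have [_ <- _] := gaussian_rv1_moments (gaussian_vector_coord b gX).
rewrite (all_mean_indep (coord_all_moments a) (coord_all_moments b)) ?mean_coord ?mulr0//.
by apply: indep_coord; rewrite eq_sym.
Qed.

(** If some index differs from the other two, its factor is independent of their product and has
    mean zero; otherwise all three agree and the third moment appears. *)
Lemma mean_coord3 a b c :
  EE (fun w => X w ord0 a * X w ord0 b * X w ord0 c) = 0.
Proof.
have step a' b' c' : c' != a' -> c' != b' ->
    EE (fun w => X w ord0 a' * X w ord0 b' * X w ord0 c') = 0.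
  move=> ca cb; rewrite (all_mean_indep _ (coord_all_moments c')).
  - by rewrite mean_coord mulr0.
  - by apply: all_momentsM; exact: coord_all_moments.
  - exact: indep_coord2.
have [ab|ab] := eqVneq a b; last first.
  have [ca|ca] := eqVneq c a.
    rewrite -(step a c b) //; last 2 first.
    - by rewrite eq_sym.
    - by rewrite ca eq_sym.
    by apply: eq_Rintegral => w _; ring.
  have [cb|cb] := eqVneq c b; last exact: step.
  rewrite -(step b c a) //; last by rewrite cb.
  by apply: eq_Rintegral => w _; ring.
have [ca|ca] := eqVneq c a; last by apply: step; rewrite // -ab.
have [_ _ <-] := gaussian_rv1_moments (gaussian_vector_coord c gX).
by apply: eq_Rintegral => w _; rewrite -ab -ca; ring.
Qed.

End GaussianVectors.

(** * Independence of fresh noise from the past *)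

Section History.
Context (R : realType) (disp : measure_display) (Omega : measurableType disp)
  (P : probability Omega R) (d : nat).

Lemma sigma_ofT (S : set (Omega -> 'rV[R]_d)) : sigma_of S setT.
Proof.
have := @measurableT _ (g_sigma_algebraType (gens S)); exact.
Qed.

(** The past is generated by intersections of an initial event with finitely many noise events of
    index in [Q]. On these, independence from [W] splits off the initial event, both with and
    without the event of [i0], and mutual independence then splits off [i0]. *)
Lemma independent2_history (I : choiceType) (X : I -> Omega -> 'rV[R]_d)
    (S0 W : set (Omega -> 'rV[R]_d)) (Q : set I) (i0 : I) :
  (forall i, random_vector (X i)) -> (forall Y, S0 Y -> random_vector Y) ->
  mutually_independent P (fun i => sigma_of [set X i]) ->
  independent2 P (sigma_of S0) (sigma_of W) ->
  (forall i, sigma_of [set X i] `<=` sigma_of W) -> ~ Q i0 ->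
  independent2 P (sigma_of (S0 `|` [set X i | i in Q])) (sigma_of [set X i0]).
Proof.
move=> rX rS0 indX indS XW Qi0 A C sA sC.
have mXi i : sigma_of [set X i] `<=` measurable.
  by apply: sigma_of_measurable => _ ->.
have mS0 := sigma_of_measurable rS0.
pose Pi := [set E | exists (A0 : set Omega) (D : {fset I}) (B : I -> set Omega),
  [/\ sigma_of S0 A0, (forall i, i \in D -> Q i /\ sigma_of [set X i] (B i)) &
   E = A0 `&` \bigcap_(i in [set` D]) B i]].
have sigI (S : set (Omega -> 'rV[R]_d)) E F : sigma_of S E -> sigma_of S F -> sigma_of S (E `&` F).
  by move=> sE sF; exact: (@measurableI _ (g_sigma_algebraType (gens S))).
have sigbig (S : set (Omega -> 'rV[R]_d)) (D : {fset I}) (B : I -> set Omega) :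
    (forall i, i \in D -> sigma_of S (B i)) -> sigma_of S (\bigcap_(i in [set` D]) B i).
  move=> H; apply: (@fin_bigcap_measurable _ (g_sigma_algebraType (gens S))) => //.
apply: (@product_rule_generated _ _ _ P Pi) => //.
- exact: mXi sC.
- move=> _ [A0 [D [B [sA0 HB ->]]]]; apply: measurableI; first exact: mS0.
  by apply: fin_bigcap_measurable => // i /HB[_]; exact: mXi.
- move=> _ _ [A1 [D1 [B1 [sA1 HB1 ->]]]] [A2 [D2 [B2 [sA2 HB2 ->]]]].
  (* Indices absent from one family are padded by [setT], so that the union of the index sets serves
     both. *)
  exists (A1 `&` A2), (D1 `|` D2)%fset, (fun i => (if i \in D1 then B1 i else setT) `&`
     (if i \in D2 then B2 i else setT)); split; first exact: sigI.
    move=> i; rewrite in_fsetU => iD; split.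
      by case/orP: iD => [/HB1[]|/HB2[]].
    apply: sigI.
      by case: (boolP (i \in D1)) => [/HB1[]//|_]; exact: sigma_ofT.
    by case: (boolP (i \in D2)) => [/HB2[]//|_]; exact: sigma_ofT.
  rewrite setIACA; congr (_ `&` _); apply/seteqP; split => w.
    by move=> [H1 H2] i _; split; case: ifP => // iD; [exact: H1|exact: H2].
  move=> H; split => i /= iD; have := H i; rewrite /= in_fsetU iD ?orbT.
    by move=> /(_ isT)[].
  by move=> /(_ isT)[].
- exists setT, fset0, (fun=> setT); split; [exact: sigma_ofT|by []|].
  by rewrite setTI; apply/seteqP; split.
- move=> _ [A0 [D [B [sA0 HB ->]]]].
  have i0D : i0 \notin D by apply/negP => /HB[].
  pose D' := (i0 |` D)%fset; pose B' i := if i == i0 then C else B i.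
  have HB' i : i \in D' -> sigma_of [set X i] (B' i).
    rewrite /D' in_fset1U /B'; case: eqVneq => [-> //|_ /= /HB[]//].
  have E1 : A0 `&` \bigcap_(i in [set` D]) B i `&` C = A0 `&` \bigcap_(i in [set` D']) B' i.
    rewrite -setIA; congr (_ `&` _); apply/seteqP; split => w.
      move=> [H1 H2] i /=; rewrite /D' in_fset1U /B'; case: eqVneq => //= _ iD.
      exact: H1.
    move=> H; split => [i /= iD|].
      have := H i; rewrite /= /D' in_fset1U iD orbT /B' => /(_ isT).
      by case: eqVneq => // ii0; rewrite ii0 (negbTE i0D) in iD.
    by have := H i0; rewrite /= /D' fset1U1 /B' eqxx; exact.
  have E2 : P (\bigcap_(i in [set` D']) B' i) = (P C * \prod_(i <- D) P (B i))%E.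
    rewrite indX// /D' big_fsetU1//= /B' eqxx; congr (_ * _)%E.
    apply: eq_big_seq => i iD; case: eqVneq => // ii0.
    by rewrite ii0 (negbTE i0D) in iD.
  rewrite E1 indS//; last first.
    by apply: sigbig => i /HB'; exact: XW.
  rewrite E2 indS//; last by apply: sigbig => i /HB[_]; exact: XW.
  rewrite indX; last by move=> i /HB[].
  by rewrite -muleA [(P C * _)%E]muleC.
- move: A sA; apply: sub_sigma_algebra2 => _ [Y [SY|[i Qi <-]] [k [B [mB ->]]]].
    exists (  (fun w => Y w ord0 k) @^-1` B), fset0, (fun=> setT); split => //.
      exact: adapted_preimage (adapted_coord _ SY) mB.
    by rewrite (_ : \bigcap_(_ in _) _ = setT) ?setIT//; apply/seteqP; split.
  exists setT, [fset i]%fset, (fun=> (fun w => X i w ord0 k) @^-1` B); split.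
  - exact: sigma_ofT.
  - move=> i'; rewrite inE => /eqP ->; split => //.
    exact: (adapted_preimage (adapted_coord (S := [set X i]) _ erefl) mB).
  - rewrite setTI; apply/seteqP; split => w /=.
      by move=> H i' _.
    by move=> /(_ i); rewrite /= inE eqxx; exact.
Qed.

End History.

(** * Averaging along an autoregression *)

Section Autoregression.
Context (R : realType) (disp : measure_display) (Omega : measurableType disp)
  (P : probability Omega R) (d : nat).
Local Notation EE X := (Rintegral P setT X).

Lemma adaptedD (S : set (Omega -> 'rV[R]_d)) f g : adapted S f -> adapted S g -> adapted S (fun w => f w + g w).
Proof. exact: measurable_funD. Qed.

Lemma adaptedB (S : set (Omega -> 'rV[R]_d)) f g : adapted S f -> adapted S g -> adapted S (fun w => f w - g w).
Proof. exact: measurable_funB. Qed.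

Lemma adaptedM (S : set (Omega -> 'rV[R]_d)) f g : adapted S f -> adapted S g -> adapted S (fun w => f w * g w).
Proof. exact: measurable_funM. Qed.

Lemma adapted_cst (S : set (Omega -> 'rV[R]_d)) (c : R) : adapted S (fun=> c).
Proof. exact: measurable_cst. Qed.

Context (H : nat -> set (Omega -> 'rV[R]_d)) (xi x : nat -> Omega -> 'rV[R]_d)
  (alpha s : R).
Hypothesis alpha_s : alpha ^+ 2 + s ^+ 2 = 1.
Hypothesis xi0 : gaussian_vector P 1 (xi 0%N).
Hypothesis xS : forall n w, xi n.+1 w = alpha *: xi n w + s *: x n w.
Hypothesis gx : forall n, gaussian_vector P 1 (x n).
Hypothesis xi_adapted : forall n a, adapted (H n) (fun w => xi n w ord0 a).
Hypothesis x_indep : forall n, independent2 P (sigma_of (H n)) (sigma_of [set x n]).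

Lemma x_adapted n a : adapted [set x n] (fun w => x n w ord0 a).
Proof. exact: adapted_coord. Qed.

(** The identity [alpha ^+ 2 + s ^+ 2 = 1] keeps the variance proxy equal to 1 at every time, so no
    moment bound degrades with [n] or with [alpha]. *)
Lemma xi_subgaussian n a : subgaussian P (fun w => xi n w ord0 a).
Proof.
elim: n => [|n IH].
  exact: gaussian_rv1_subgaussian (gaussian_vector_coord a xi0).
rewrite (_ : (fun w => _) = (fun w => alpha * xi n w ord0 a + s * x n w ord0 a)); last first.
  by apply/funext => w; rewrite xS !mxE.
apply: subgaussian_indep_comb => //.
  exact: gaussian_rv1_subgaussian (gaussian_vector_coord a (gx n)).
apply: (indep_of_independent2 (@x_indep n)); [exact: xi_adapted|exact: x_adapted].
Qed.

Lemma xi_moments n a : moments P (gaussian_bound R) (fun w => xi n w ord0 a).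
Proof. exact/subgaussian_moments/xi_subgaussian. Qed.

Lemma xi_all_moments n a : all_moments P (fun w => xi n w ord0 a).
Proof. by eexists; exact: xi_moments. Qed.

(* E[h_(n+1) | past] = lambda h_n, tested against past variables. *)
Definition contracts (lambda : R) (h : nat -> Omega -> R) :=
  forall n Y, adapted (H n) Y -> all_moments P Y ->
  EE (fun w => Y w * h n.+1 w) = lambda * EE (fun w => Y w * h n w).

Lemma mean_past_noise n U V : adapted (H n) U -> all_moments P U ->
  adapted [set x n] V -> all_moments P V ->
  EE (fun w => U w * V w) = EE U * EE V.
Proof.
move=> aU mU aV mV; apply: all_mean_indep => //.
exact: (indep_of_independent2 (@x_indep n) aU aV).
Qed.

Let x_moments n a : all_moments P (fun w => x n w ord0 a).
Proof. exact: coord_all_moments (gx n) a. Qed.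

Ltac adapted_tac := repeat first [assumption | apply: adapted_cst
  | apply: adaptedD | apply: adaptedB | apply: adaptedM | apply: xi_adapted | apply: x_adapted].
Ltac moments_tac := repeat first [assumption | exact: all_moments_cst
  | exact: xi_all_moments | exact: x_moments
  | apply: all_momentsD | apply: all_momentsB | apply: all_momentsM].

Lemma contracts_linear a : contracts alpha (fun n w => xi n w ord0 a).
Proof.
move=> n Y aY mY.
transitivity (EE (fun w => alpha * (Y w * xi n w ord0 a) + s * (Y w * x n w ord0 a))).
  by apply: eq_Rintegral => w _; rewrite xS !mxE; ring.
rewrite all_meanD; [|by moments_tac|by moments_tac].
rewrite !all_meanZ; [|by moments_tac|by moments_tac].
rewrite (mean_past_noise (n := n) (V := fun w => x n w ord0 a)); [|by adapted_tac|by moments_tac|by adapted_tac|by moments_tac].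
by rewrite (mean_coord (gx n)) !mulr0 addr0.
Qed.

(** The Hermite polynomial of degree two is an eigenfunction of the autoregression: cross terms have
    mean zero, and the constant [s ^+ 2 = 1 - alpha ^+ 2] left by the noise is exactly what the
    centering requires. *)
Lemma contracts_quadratic a b :
  contracts (alpha ^+ 2) (fun n w => xi n w ord0 a * xi n w ord0 b - (a == b)%:R).
Proof.
move=> n Y aY mY; set D := (a == b)%:R.
have s2 : s ^+ 2 = 1 - alpha ^+ 2 by rewrite -alpha_s; ring.
transitivity (EE (fun w => alpha ^+ 2 * (Y w * (xi n w ord0 a * xi n w ord0 b))
   + (alpha * s) * ((Y w * xi n w ord0 a) * x n w ord0 b)
   + (alpha * s) * ((Y w * xi n w ord0 b) * x n w ord0 a)
   + s ^+ 2 * (Y w * (x n w ord0 a * x n w ord0 b)) - D * Y w)).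
  by apply: eq_Rintegral => w _; rewrite xS !mxE; ring.
rewrite all_meanB; [|by moments_tac|by moments_tac].
rewrite !all_meanD; [|by moments_tac..].
rewrite !all_meanZ; [|by moments_tac..].
rewrite (mean_past_noise (n := n) (V := fun w => x n w ord0 b)); [|by adapted_tac|by moments_tac|by adapted_tac|by moments_tac].
rewrite (mean_past_noise (n := n) (V := fun w => x n w ord0 a)); [|by adapted_tac|by moments_tac|by adapted_tac|by moments_tac].
rewrite (mean_past_noise (n := n) (V := fun w => x n w ord0 a * x n w ord0 b));
  [|by adapted_tac|by moments_tac|by adapted_tac|by moments_tac].
rewrite !(mean_coord (gx n)) (mean_coord2 (gx n)).
have -> : EE (fun w => Y w * (xi n w ord0 a * xi n w ord0 b - D)) =
   EE (fun w => Y w * (xi n w ord0 a * xi n w ord0 b)) - D * EE Y.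
  rewrite -all_meanZ; [|by moments_tac]; rewrite -all_meanB; [|by moments_tac|by moments_tac].
  by apply: eq_Rintegral => w _; ring.
by rewrite s2 -/D; ring.
Qed.

(** The Hermite polynomial of degree three: its linear correction cancels the terms in which two
    noise factors pair up. *)
Lemma contracts_cubic a b c :
  contracts (alpha ^+ 3) (fun n w => xi n w ord0 a * xi n w ord0 b * xi n w ord0 c
    - ((a == b)%:R * xi n w ord0 c + (b == c)%:R * xi n w ord0 a + (a == c)%:R * xi n w ord0 b)).
Proof.
move=> n Y aY mY; set D1 := (a == b)%:R; set D2 := (b == c)%:R; set D3 := (a == c)%:R.
have s2 : s ^+ 2 = 1 - alpha ^+ 2 by rewrite -alpha_s; ring.
(* The linear correction is left at time [n.+1], so that [contracts_linear] disposes of it. *)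
transitivity (EE (fun w => alpha ^+ 3 * (Y w * (xi n w ord0 a * xi n w ord0 b * xi n w ord0 c))
   + (alpha ^+ 2 * s) * ((Y w * xi n w ord0 a * xi n w ord0 b) * x n w ord0 c)
   + (alpha ^+ 2 * s) * ((Y w * xi n w ord0 b * xi n w ord0 c) * x n w ord0 a)
   + (alpha ^+ 2 * s) * ((Y w * xi n w ord0 a * xi n w ord0 c) * x n w ord0 b)
   + (alpha * s ^+ 2) * ((Y w * xi n w ord0 a) * (x n w ord0 b * x n w ord0 c))
   + (alpha * s ^+ 2) * ((Y w * xi n w ord0 b) * (x n w ord0 a * x n w ord0 c))
   + (alpha * s ^+ 2) * ((Y w * xi n w ord0 c) * (x n w ord0 a * x n w ord0 b))
   + s ^+ 3 * (Y w * (x n w ord0 a * x n w ord0 b * x n w ord0 c))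
   - (D1 * (Y w * xi n.+1 w ord0 c) + D2 * (Y w * xi n.+1 w ord0 a) + D3 * (Y w * xi n.+1 w ord0 b)))).
  by apply: eq_Rintegral => w _; rewrite xS !mxE; ring.
rewrite all_meanB; [|by moments_tac|by moments_tac].
rewrite !all_meanD; [|by moments_tac..].
rewrite !all_meanZ; [|by moments_tac..].
rewrite (mean_past_noise (n := n) (V := fun w => x n w ord0 c)); [|by adapted_tac|by moments_tac|by adapted_tac|by moments_tac].
rewrite (mean_past_noise (n := n) (V := fun w => x n w ord0 a)); [|by adapted_tac|by moments_tac|by adapted_tac|by moments_tac].
rewrite (mean_past_noise (n := n) (V := fun w => x n w ord0 b)); [|by adapted_tac|by moments_tac|by adapted_tac|by moments_tac].
rewrite (mean_past_noise (n := n) (V := fun w => x n w ord0 b * x n w ord0 c));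
  [|by adapted_tac|by moments_tac|by adapted_tac|by moments_tac].
rewrite (mean_past_noise (n := n) (V := fun w => x n w ord0 a * x n w ord0 c));
  [|by adapted_tac|by moments_tac|by adapted_tac|by moments_tac].
rewrite (mean_past_noise (n := n) (V := fun w => x n w ord0 a * x n w ord0 b));
  [|by adapted_tac|by moments_tac|by adapted_tac|by moments_tac].
rewrite (mean_past_noise (n := n) (V := fun w => x n w ord0 a * x n w ord0 b * x n w ord0 c));
  [|by adapted_tac|by moments_tac|by adapted_tac|by moments_tac].
rewrite !(mean_coord (gx n)) !(mean_coord2 (gx n)) (mean_coord3 (gx n)).
rewrite !(contracts_linear _ aY mY).
have -> : EE (fun w => Y w * (xi n w ord0 a * xi n w ord0 b * xi n w ord0 c
    - (D1 * xi n w ord0 c + D2 * xi n w ord0 a + D3 * xi n w ord0 b))) =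
   EE (fun w => Y w * (xi n w ord0 a * xi n w ord0 b * xi n w ord0 c)) -
   (D1 * EE (fun w => Y w * xi n w ord0 c) + D2 * EE (fun w => Y w * xi n w ord0 a) +
    D3 * EE (fun w => Y w * xi n w ord0 b)).
  do 3 (rewrite -all_meanZ; [|by moments_tac]).
  do 2 (rewrite -all_meanD; [|by moments_tac|by moments_tac]).
  rewrite -all_meanB; [|by moments_tac|by moments_tac].
  by apply: eq_Rintegral => w _; ring.
by rewrite s2 -/D1 -/D2 -/D3; ring.
Qed.

End Autoregression.

Section FiniteSums.
Context (R : realType).

Lemma sqr_sum_le n (x : 'I_n -> R) :
  (\sum_(k < n) x k) ^+ 2 <= n%:R * \sum_(k < n) x k ^+ 2.
Proof.
rewrite expr2 big_distrlr/=.
apply: (@le_trans _ _ (\sum_(i < n) \sum_(j < n) (2^-1 * x i ^+ 2 + 2^-1 * x j ^+ 2))).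
  apply: ler_sum => i _; apply: ler_sum => j _.
  by have := sqr_ge0 (x i - x j); nra.
under [leLHS]eq_bigr => i _ do rewrite big_split/= sumr_const card_ord.
rewrite big_split/= sumr_const card_ord sumrMnl -mulr_sumr -mulrnDl -mulr_natl.
by rewrite le_eqVlt; apply/orP; left; apply/eqP; field.
Qed.

(** Counts the times inside the averaging window; natural subtraction keeps the count valid near
    time 0. *)
Lemma sum_window_le (n a b : nat) : (\sum_(l < n) (a <= l < b)%N <= b - a)%N.
Proof.
suff -> : (\sum_(l < n) (a <= l < b)%N = minn n b - a)%N by lia.
elim: n => [|n IH]; first by rewrite big_ord0; lia.
rewrite big_ord_recr/= IH.
by case: (leqP a n); case: (ltnP n b) => /=; lia.
Qed.

End FiniteSums.

(** * Mean-square averaging of contracting fluctuations *)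

Section Averaging.
Context (R : realType) (disp : measure_display) (Omega : measurableType disp)
  (P : probability Omega R) (d : nat).
Local Notation EE X := (Rintegral P setT X).

Lemma all_moments_sum_ord n (F : 'I_n -> Omega -> R) :
  (forall i, all_moments P (F i)) -> all_moments P (fun w => \sum_(i < n) F i w).
Proof.
move=> H; suff : forall r : seq 'I_n, all_moments P (fun w => \sum_(i <- r) F i w) by exact.
elim=> [|i r IH].
  rewrite (_ : (fun w => \sum_(i <- [::]) F i w) = fun=> 0); first exact: all_moments_cst.
  by apply/funext => w; rewrite big_nil.
rewrite (_ : (fun w => \sum_(j <- i :: r) F j w) = fun w => F i w + \sum_(j <- r) F j w).
  exact: all_momentsD.
by apply/funext => w; rewrite big_cons.
Qed.

Lemma all_mean_sum_ord n (F : 'I_n -> Omega -> R) :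
  (forall i, all_moments P (F i)) ->
  EE (fun w => \sum_(i < n) F i w) = \sum_(i < n) EE (F i).
Proof.
move=> H; suff : forall r : seq 'I_n, all_moments P (fun w => \sum_(i <- r) F i w) /\
    EE (fun w => \sum_(i <- r) F i w) = \sum_(i <- r) EE (F i).
  by move=> /(_ (index_enum 'I_n))[].
elim=> [|i r [IH1 IH2]].
  rewrite (_ : (fun w => \sum_(i <- [::]) F i w) = fun=> 0).
    by split; [exact: all_moments_cst|rewrite big_nil mean_cst].
  by apply/funext => w; rewrite big_nil.
rewrite (_ : (fun w => \sum_(j <- i :: r) F j w) = fun w => F i w + \sum_(j <- r) F j w); last first.
  by apply/funext => w; rewrite big_cons.
by split; [exact: all_momentsD|rewrite big_cons all_meanD// IH2].
Qed.

Lemma all_mean_mono X Y : all_moments P X -> all_moments P Y ->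
  (forall w, X w <= Y w) -> EE X <= EE Y.
Proof. by move=> [a Xa] [b Yb]; exact: mean_mono Xa Yb. Qed.

Lemma mean_sqr_sum_le n (F : 'I_n -> Omega -> R) :
  (forall i, all_moments P (F i)) ->
  EE (fun w => (\sum_(i < n) F i w) ^+ 2) <= n%:R * \sum_(i < n) EE (fun w => F i w ^+ 2).
Proof.
move=> H; have H2 i : all_moments P (fun w => F i w ^+ 2) by exact: all_momentsM.
rewrite -all_mean_sum_ord// -all_meanZ; last exact: all_moments_sum_ord.
apply: all_mean_mono.
- by apply: all_momentsM; exact: all_moments_sum_ord.
- by apply: all_momentsM; [exact: all_moments_cst|exact: all_moments_sum_ord].
by move=> w; exact: sqr_sum_le.
Qed.

(** [C] is the slow coefficient, [h] the fast fluctuation and [H] the past. The increment hypothesis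
    below carries the weight [h k] inside the mean because [h] is neither bounded nor assumed
    independent of the increment. *)
Context (H : nat -> set (Omega -> 'rV[R]_d)) (C h : nat -> Omega -> R)
  (b : nat -> R) (L B T lambda Delta : R).
Hypothesis adapted_mono : forall k l f, (k <= l)%N -> adapted (H k) f -> adapted (H l) f.
Hypothesis C_adapted : forall k, adapted (H k) (C k).
Hypothesis h_adapted : forall k, adapted (H k) (h k).
Hypothesis C_moments : forall k, all_moments P (C k).
Hypothesis C_bounded : forall k w, `|C k w| <= L.
Hypothesis h_moments : forall k, moments P b (h k).
Hypothesis h_contracts : contracts P H lambda h.
Hypothesis lambda0 : 0 <= lambda.
Hypothesis L0 : 0 <= L.
Hypothesis B0 : 0 <= B.
Hypothesis T0 : 0 <= T.
Hypothesis Delta0 : 0 < Delta.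
Hypothesis C_increment : forall k l, (l <= k)%N -> k%:R * Delta <= T ->
  EE (fun w => ((C k w - C l w) * h k w) ^+ 2) <= B * ((k - l)%:R * Delta).

Let h_all k : all_moments P (h k).
Proof. by exists b. Qed.

Lemma contracts_iter m n Y : adapted (H n) Y -> all_moments P Y ->
  EE (fun w => Y w * h (n + m)%N w) = lambda ^+ m * EE (fun w => Y w * h n w).
Proof.
move=> aY mY; elim: m => [|m IH]; first by rewrite addn0 expr0 mul1r.
rewrite addnS h_contracts// ?IH ?exprS ?mulrA//.
by apply: adapted_mono aY; exact: leq_addr.
Qed.

Let A : R := L ^+ 2 * (b 2 + b 2).

Let A0 : 0 <= A.
Proof.
rewrite mulr_ge0 ?sqr_ge0// addr_ge0//; exact: moments_bound_ge0 (h_moments 0%N).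
Qed.

Lemma mean_product_le (X Y : Omega -> R) k l : all_moments P X -> all_moments P Y ->
  (forall w, `|X w| <= L) -> (forall w, `|Y w| <= L) ->
  `|EE (fun w => X w * h k w * Y w * h l w)| <= A.
Proof.
move=> mX mY XL YL.
have m1 := momentsZ (L ^+ 2) (momentsM (h_moments k) (h_moments l)).
have m2 : moments P (fun q => `|L ^+ 2| ^+ q * (b (2 * q)%N + b (2 * q)%N))
    (fun w => X w * h k w * Y w * h l w).
  apply: moments_le m1 => [|w].
    apply: all_moments_measurable.
    by apply: all_momentsM => //; apply: all_momentsM => //; apply: all_momentsM.
  rewrite !normrM (ger0_norm L0).
  have -> : `|X w| * `|h k w| * `|Y w| * `|h l w| = (`|X w| * `|Y w|) * (`|h k w| * `|h l w|) by ring.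
  by rewrite ler_wpM2r ?mulr_ge0// ler_pM.
by rewrite (le_trans (mean_norm_le m2))// expr1 muln1 (ger0_norm (sqr_ge0 L)).
Qed.

(** Each coefficient is frozen [m] steps back, which costs [m%:R * Delta] by the increment
    hypothesis. In the squared sum that remains, two times at least [m] apart have a correlation of
    order [lambda ^+ m], and each time has at most [2 * m] closer partners. *)
Lemma averaging (m n : nat) : n%:R * Delta <= T ->
  EE (fun w => (\sum_(k < n) Delta * (C k w * h k w)) ^+ 2) <=
  2 * (T ^+ 2 * B + A * (T ^+ 2 + 2 * T)) * (m%:R * Delta + lambda ^+ m).
Proof.
move=> nT.
have Dge0 := ltW Delta0.
have nD0 : 0 <= n%:R * Delta by rewrite mulr_ge0.
have lm0 : 0 <= lambda ^+ m by rewrite exprn_ge0.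
have mD0 : 0 <= m%:R * Delta by rewrite mulr_ge0.
(* Natural subtraction: before time [m] the coefficient is frozen at time 0. *)
pose C' k := C (k - m)%N.
have mC' k : all_moments P (C' k) by exact: C_moments.
have aC' k : adapted (H (k - m)%N) (C' k) by exact: C_adapted.
have bC' k w : `|C' k w| <= L by exact: C_bounded.
pose X := fun w => \sum_(k < n) Delta * ((C k w - C' k w) * h k w).
pose Y := fun w => \sum_(k < n) Delta * (C' k w * h k w).
have mDh k : all_moments P (fun w => (C k w - C' k w) * h k w).
  by apply: all_momentsM => //; exact: all_momentsB.
have mCh k : all_moments P (fun w => C' k w * h k w) by exact: all_momentsM.
have mX : all_moments P X.
  by apply: all_moments_sum_ord => k; apply: all_momentsM => //; exact: all_moments_cst.
have mY : all_moments P Y.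
  by apply: all_moments_sum_ord => k; apply: all_momentsM => //; exact: all_moments_cst.
have EX : EE (fun w => X w ^+ 2) <= T ^+ 2 * B * (m%:R * Delta).
  apply: (le_trans (mean_sqr_sum_le (F := fun k w => Delta * ((C k w - C' k w) * h k w)) _)).
    by move=> k; apply: all_momentsM => //; exact: all_moments_cst.
  apply: (@le_trans _ _ (n%:R * \sum_(i < n) Delta ^+ 2 * (B * (m%:R * Delta)))).
    rewrite ler_wpM2l//; apply: ler_sum => k _.
    under eq_Rintegral do rewrite exprMn.
    rewrite all_meanZ; last exact: all_momentsM.
    rewrite ler_wpM2l ?sqr_ge0//.
    apply: le_trans (C_increment (leq_subr m k) _) _.
      by rewrite (le_trans _ nT)// ler_wpM2r// ler_nat ltnW.
    by rewrite ler_wpM2l// ler_wpM2r// ler_nat; clear; lia.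
  rewrite sumr_const card_ord -[X in _ * X]mulr_natr.
  have -> : n%:R * (Delta ^+ 2 * (B * (m%:R * Delta)) * n%:R) =
     (n%:R * Delta) ^+ 2 * (B * (m%:R * Delta)) by ring.
  by rewrite -mulrA ler_wpM2r ?mulr_ge0// lerXn2r ?nnegrE.
have EY : EE (fun w => Y w ^+ 2) <= A * (T ^+ 2 + 2 * T) * (m%:R * Delta + lambda ^+ m).
  rewrite (_ : (fun w => Y w ^+ 2) = (fun w => \sum_(k < n) \sum_(l < n)
      Delta ^+ 2 * (C' k w * h k w * C' l w * h l w))); last first.
    apply/funext => w; rewrite /Y expr2 big_distrlr/=.
    by apply: eq_bigr => k _; apply: eq_bigr => l _; ring.
  have mP k l : all_moments P (fun w => C' k w * h k w * C' l w * h l w).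
    by apply: all_momentsM => //; apply: all_momentsM => //; exact: all_momentsM.
  rewrite all_mean_sum_ord; last first.
    move=> k; apply: all_moments_sum_ord => l; apply: all_momentsM => //; exact: all_moments_cst.
  apply: (@le_trans _ _ (\sum_(k < n) \sum_(l < n) Delta ^+ 2 *
      (A * lambda ^+ m + A * (k - m <= l < k + m)%N%:R))).
    apply: ler_sum => k _; rewrite all_mean_sum_ord; last first.
      by move=> l; apply: all_momentsM => //; exact: all_moments_cst.
    apply: ler_sum => l _; rewrite all_meanZ// ler_wpM2l ?sqr_ge0//.
    apply: le_trans (ler_norm _) _.
    (* Freezing puts [C' l'] at time [l' - m], and [k' <= l' - m]: everything but [h l'] is known by
       then, so [m] contractions apply. *)
    have far k' l' : (k' + m <= l')%N ->
        `|EE (fun w => C' k' w * h k' w * C' l' w * h l' w)| <= A * lambda ^+ m.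
      move=> kl; have {2}-> : l' = ((l' - m) + m)%N by move: kl; clear; lia.
      rewrite contracts_iter.
      - rewrite normrM (ger0_norm lm0) mulrC ler_wpM2r//.
        by apply: mean_product_le => // w; exact: C_bounded.
      - apply: (@adaptedM _ _ _ _ (H (l' - m)%N)); last exact: C_adapted.
        apply: (@adaptedM _ _ _ _ (H (l' - m)%N)).
          by apply: (adapted_mono (k := (k' - m)%N)); [move: kl; clear; lia|exact: aC'].
        by apply: (adapted_mono (k := k')); [move: kl; clear; lia|exact: h_adapted].
      - by apply: all_momentsM => //; exact: all_momentsM.
    case: (boolP (k - m <= l < k + m)%N) => kl.
      rewrite mulr1 (@le_trans _ _ A)//; last by rewrite lerDr mulr_ge0.
      by apply: mean_product_le => // w; exact: C_bounded.
    rewrite mulr0 addr0.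
    have [kml|lk] := leqP (k + m) l; first exact: far.
    have lmk : (l + m <= k)%N by move: kl lk; clear; lia.
    rewrite (_ : (fun w => C' k w * h k w * C' l w * h l w) =
       (fun w => C' l w * h l w * C' k w * h k w)); first exact: far.
    by apply/funext => w; ring.
  apply: (@le_trans _ _ (\sum_(k < n) Delta ^+ 2 * (n%:R * (A * lambda ^+ m) + A * (2 * m%:R)))).
    apply: ler_sum => k _; rewrite -mulr_sumr ler_wpM2l ?sqr_ge0//.
    rewrite big_split/= sumr_const card_ord -[_ *+ n]mulr_natl lerD2l -mulr_sumr ler_wpM2l//.
    rewrite -natr_sum -natrM ler_nat.
    by apply: leq_trans (sum_window_le n (k - m) (k + m)) _; clear; lia.
  rewrite sumr_const card_ord -[_ *+ n]mulr_natl.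
  have -> : n%:R * (Delta ^+ 2 * (n%:R * (A * lambda ^+ m) + A * (2 * m%:R))) =
    A * ((n%:R * Delta) ^+ 2 * lambda ^+ m + 2 * (n%:R * Delta) * (m%:R * Delta)) by ring.
  rewrite -[leRHS]mulrA ler_wpM2l//.
  have T2 : (n%:R * Delta) ^+ 2 <= T ^+ 2 by rewrite lerXn2r ?nnegrE.
  have := ler_wpM2r lm0 T2; have := ler_wpM2r mD0 nT.
  have := mulr_ge0 (sqr_ge0 T) mD0; have := mulr_ge0 T0 lm0.
  nra.
have -> : (fun w => (\sum_(k < n) Delta * (C k w * h k w)) ^+ 2) = (fun w => (X w + Y w) ^+ 2).
  by apply/funext => w; rewrite /X /Y -big_split/=; congr (_ ^+ 2); apply: eq_bigr => k _; ring.
have mX2 : all_moments P (fun w => X w ^+ 2) by exact: all_momentsM.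
have mY2 : all_moments P (fun w => Y w ^+ 2) by exact: all_momentsM.
apply: (@le_trans _ _ (EE (fun w => 2 * (X w ^+ 2 + Y w ^+ 2)))).
  apply: all_mean_mono.
  - by apply: all_momentsM; exact: all_momentsD.
  - by apply: all_momentsM; [exact: all_moments_cst|exact: all_momentsD].
  - by move=> w; have := sqr_ge0 (X w - Y w); nra.
rewrite all_meanZ; last exact: all_momentsD.
rewrite all_meanD// -[leRHS]mulrA ler_pM2l//.
apply: (le_trans (lerD EX EY)).
rewrite [leRHS]mulrDl lerD2r mulrDr lerDl.
by rewrite !mulr_ge0// sqr_ge0.
Qed.

End Averaging.

(** * Riemann sums along paths *)

Section RiemannSums.
Context (R : realType).
Notation mu := (@lebesgue_measure R).

(** Heine's theorem, from the covering form of compactness. *)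
Lemma segment_unif_continuous (f : R -> R) (a b e : R) :
  {within `[a, b], continuous f} -> 0 < e ->
  exists2 r : R, 0 < r & forall x y, x \in `[a, b] -> y \in `[a, b] ->
    `|x - y| <= r -> `|f x - f y| <= e.
Proof.
move=> /subspace_continuousP fc e0.
have /compact_near_coveringP/near_covering_withinP cov := @segment_compact R a b.
pose Q (r : R) (x : R) := forall y, y \in `[a, b] -> `|x - y| <= r -> `|f x - f y| <= e.
have : \forall r \near 0^'+, `[a, b]%classic `<=` Q r.
  apply: cov => x abx.
  have := fc x abx; move/cvgrPdist_le => /(_ (e / 2)).
  rewrite divr_gt0// => /(_ isT); rewrite near_withinE => -[r /= r0 Hr].
  exists (ball x (r / 2), [set s | s < r / 2]); first split => //=.
  - by apply: nbhsx_ballx; rewrite divr_gt0.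
  - by apply: nbhs_right_lt; rewrite divr_gt0.
  move=> [x' s] /= [xx' sr] abx' y aby x'y.
  have x'r : ball x r x' by apply: le_ball xx'; rewrite ler_pdivrMr// mulr_natr mulr2n lerDl ltW.
  have yr : ball x r y.
    rewrite /ball/= in xx' *.
    have -> : x - y = (x - x') + (x' - y) by ring.
    rewrite (le_lt_trans (ler_normD _ _))// [ltRHS](splitr r) ltr_leD//.
    by rewrite (le_trans x'y)// ltW.
  have H1 := Hr _ x'r abx'; have H2 := Hr _ yr aby.
  have -> : f x' - f y = (f x - f y) - (f x - f x') by ring.
  by rewrite (le_trans (ler_normB _ _))// [leRHS](splitr e) lerD.
move=> H; have /filter_ex[r [r0 Hr]] : \forall r \near (0 : R)^'+,
    0 < r /\ `[a, b]%classic `<=` Q r.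
  by apply: filterI => //; exact: nbhs_right_gt.
exists r => // x y abx aby xy.
by apply: (Hr x) => //.
Qed.

Lemma Rintegral_segment_split (f : R -> R) (a b c : R) : a <= b -> b <= c ->
  mu.-integrable `[a, c] (EFin \o f) ->
  \int[mu]_(s in `[a, c]) f s = \int[mu]_(s in `[a, b]) f s + \int[mu]_(s in `[b, c]) f s.
Proof.
move=> ab bc fi.
rewrite -[X in _ = _ + X]Rintegral_itv_obnd_cbnd; last first.
  apply: integrableS fi => //.
  by apply: subset_itv; rewrite bnd_simp.
rewrite -(@Rintegral_itvB R f (BLeft a) (BRight c)) ?bnd_simp//.
by rewrite [RHS]addrC subrK.
Qed.

(** Left endpoints on [N.+1] equal cells; uniform continuity bounds the error on each cell by its
    length times [e / D]. *)
Lemma riemann_sum_cvg (f : R -> R) (a D : R) : 0 < D ->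
  {within `[a, a + D], continuous f} ->
  (fun N => D / N.+1%:R * \sum_(i < N.+1) f (a + i%:R * (D / N.+1%:R))) @ \oo -->
  \int[mu]_(s in `[a, a + D]) f s.
Proof.
move=> D0 fc.
have intf c e : a <= c -> e <= a + D -> mu.-integrable `[c, e] (EFin \o f).
  move=> ac eD; apply: continuous_compact_integrable; first exact: segment_compact.
  apply: continuous_subspaceW fc => x /=; rewrite !in_itv/= => /andP[cx xe].
  by rewrite (le_trans ac)// (le_trans xe).
apply/cvgrPdist_le => e e0.
have eD0 : 0 < e / D by rewrite divr_gt0.
have [r r0 Hr] := segment_unif_continuous fc eD0.
near=> N.
set h := D / N.+1%:R.
have h0 : 0 < h by rewrite divr_gt0.
have hr : h <= r.
  rewrite ler_pdivrMr// mulrC -ler_pdivrMr//.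
  near: N; exists (Num.truncn (D / r)) => //= N.
  move=> HN; apply: ltW; apply: lt_le_trans (truncnS_gt _) _.
  by rewrite ler_nat ltnS.
have hN : N.+1%:R * h = D by rewrite mulrCA mulfV ?mulr1// pnatr_eq0.
have piece c : a <= c -> c + h <= a + D ->
    `|\int[mu]_(s in `[c, c + h]) f s - h * f c| <= h * (e / D).
  move=> ac cD.
  have hE : \int[mu]_(s in `[c, c + h]) (f c) = h * f c.
    rewrite Rintegral_cst//= lebesgue_measure_itv/= lte_fin ltrDl h0.
    by rewrite -EFinD addrAC subrr add0r/= mulrC.
  have hE' : \int[mu]_(s in `[c, c + h]) (e / D) = h * (e / D).
    rewrite Rintegral_cst//= lebesgue_measure_itv/= lte_fin ltrDl h0.
    by rewrite -EFinD addrAC subrr add0r/= mulrC.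
  have icst (k : R) : mu.-integrable `[c, c + h] (EFin \o (fun=> k)).
    apply: continuous_compact_integrable; first exact: segment_compact.
    by apply: continuous_subspaceT => x; exact: cvg_cst.
  have i1 := intf _ _ ac cD.
  rewrite -hE -RintegralB//.
  have i2 : mu.-integrable `[c, c + h] (EFin \o (fun s => f s - f c)).
    by apply: (integrableB _ i1 (icst (f c))).
  rewrite (le_trans (le_normr_Rintegral _ i2))// -hE'.
  apply: le_Rintegral => //.
    by have := integrable_abse i2.
  move=> s /=; rewrite in_itv/= => /andP[cs sh].
  apply: Hr.
  - by rewrite in_itv/= (le_trans ac)// (le_trans sh).
  - by rewrite in_itv/= ac (le_trans _ cD)// lerDl ltW.
  - by rewrite ger0_norm ?subr_ge0// lerBlDl (le_trans sh)// lerD2l.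
have step (k : nat) : (k <= N.+1)%N ->
    `|\int[mu]_(s in `[a, a + k%:R * h]) f s - h * \sum_(i < k) f (a + i%:R * h)| <= k%:R * (h * (e / D)).
  elim: k => [_|k IH kN].
    rewrite !mul0r addr0 big_ord0 mulr0 subr0 set_itv1 Rintegral_set1.
    by rewrite normr0.
  have {}IH := IH (ltnW kN).
  have kS : k.+1%:R * h = k%:R * h + h by rewrite -natr1 mulrDl mul1r.
  have kh0 : 0 <= k%:R * h by rewrite mulr_ge0// ltW.
  have kD : k.+1%:R * h <= D by rewrite -hN ler_pM2r// ler_nat.
  have H2 : a <= a + k%:R * h by rewrite lerDl.
  have H3 : a + k%:R * h + h <= a + D by rewrite -addrA -kS lerD2l.
  have := piece _ H2 H3 => H4.
  have H6 : \int[mu]_(s in `[a, a + k.+1%:R * h]) f s =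
     \int[mu]_(s in `[a, a + k%:R * h]) f s + \int[mu]_(s in `[a + k%:R * h, a + k%:R * h + h]) f s.
    rewrite -addrA -kS; apply: Rintegral_segment_split => //.
    - by rewrite lerD2l ler_pM2r// ler_nat.
    - by apply: intf => //; rewrite lerD2l.
  rewrite H6 big_ord_recr/= mulrDr opprD addrACA (le_trans (ler_normD _ _))//.
  by rewrite -natr1 mulrDl mul1r lerD.
have := step N.+1 (leqnn _); rewrite hN => /le_trans; apply.
by rewrite mulrA hN mulrCA mulfV ?mulr1// gt_eqF.
Unshelve. all: by end_near. Qed.

Lemma continuous_segment_integrable (f : R -> R) (a b : R) :
  {within `[a, b], continuous f} -> mu.-integrable `[a, b] (EFin \o f).
Proof. by move=> fc; apply: continuous_compact_integrable => //; exact: segment_compact. Qed.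

Lemma norm_Rintegral_segment_le (f : R -> R) (a b M : R) : a <= b ->
  {within `[a, b], continuous f} -> (forall x, `|f x| <= M) ->
  `|\int[mu]_(s in `[a, b]) f s| <= M * (b - a).
Proof.
move=> ab fc fM; have fi := continuous_segment_integrable fc.
have cE : \int[mu]_(s in `[a, b]) M = M * (b - a).
  rewrite Rintegral_cst//= lebesgue_measure_itv/= lte_fin; congr (_ * _).
  by move: ab; rewrite le_eqVlt => /predU1P[->|->//]; rewrite ltxx subrr.
rewrite -cE (le_trans (le_normr_Rintegral _ fi))//; apply: le_Rintegral => //.
- by have := integrable_abse fi.
- by apply: continuous_segment_integrable; apply: continuous_subspaceT => x; exact: cvg_cst.
Qed.

(** Each step of length [D] is subdivided separately, so the times [k%:R * D] of the scheme are
    nodes for every [N]. *)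
Lemma riemann_sum_cvg_grid (f : R -> R) (D : R) (n : nat) : 0 < D ->
  {within `[0, +oo[, continuous f} ->
  (fun N => \sum_(k < n) D / N.+1%:R *
      \sum_(i < N.+1) f (k%:R * D + i%:R * (D / N.+1%:R))) @ \oo -->
  \int[mu]_(s in `[0, n%:R * D]) f s.
Proof.
move=> D0 fc; have D0' := ltW D0.
have sub a b : 0 <= a -> {within `[a, b], continuous f}.
  move=> a0; apply: continuous_subspaceW fc => x /=; rewrite !in_itv/= andbT => /andP[ax _].
  exact: le_trans ax.
elim: n => [|n IH].
  rewrite mul0r set_itv1 Rintegral_set1; under eq_fun do rewrite big_ord0.
  exact: cvg_cst.
have nD : 0 <= n%:R * D by rewrite mulr_ge0.
have nS : n.+1%:R * D = n%:R * D + D by rewrite -natr1 mulrDl mul1r.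
under eq_fun do rewrite big_ord_recr/=.
rewrite nS (@Rintegral_segment_split _ 0 (n%:R * D))//.
- apply: cvgD => //; apply: riemann_sum_cvg => //; exact: sub.
- by rewrite lerDl.
- by apply: continuous_segment_integrable; exact: sub.
Qed.

End RiemannSums.

Section Fatou.
Context (R : realType) (disp : measure_display) (Omega : measurableType disp)
  (P : probability Omega R).

(** Lets second moments be estimated on finite sums, with no integrability of the limit
    presupposed. *)
Lemma fatou_sqr (X : nat -> Omega -> R) (Y : Omega -> R) (K : \bar R) :
  (forall N, measurable_fun setT (X N)) -> measurable_fun setT Y ->
  {ae P, forall w, (X N w @[N --> \oo] --> Y w)} ->
  (forall N, (\int[P]_w (X N w ^+ 2)%:E <= K)%E) ->
  (\int[P]_w (Y w ^+ 2)%:E <= K)%E.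
Proof.
move=> mX mY XY XK.
pose f N w := (X N w ^+ 2)%:E.
have mf N : measurable_fun setT (f N).
  by apply/measurable_EFinP; exact: measurable_funX.
have f0 N w : setT w -> (0 <= f N w)%E by rewrite lee_fin sqr_ge0.
have mlim : measurable_fun setT (fun w => limn_einf (f ^~ w)).
  apply: measurableT_comp => //; apply: measurable_fun_limn_esup => N.
  exact: measurableT_comp.
have lim0 w : setT w -> (0 <= limn_einf (f ^~ w))%E.
  move=> _; rewrite limn_einf_lim; apply: lime_ge; first exact: is_cvg_einfs.
  by near=> N; apply: le_ereal_inf_tmp => _ [k /= _ <-]; exact: f0.
apply: (@le_trans _ _ (\int[P]_w limn_einf (f ^~ w))%E).
  apply: ae_ge0_le_integral => //.
  - by move=> w _; rewrite lee_fin sqr_ge0.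
  - by apply/measurable_EFinP; exact: measurable_funX.
  apply: filterS XY => w Xw _.
  have /cvg_limn_einf_sup[-> _] // : f N w @[N --> \oo] --> (Y w ^+ 2)%:E.
  apply: cvg_EFin; first by near=> N.
  exact: cvgM.
apply: le_trans (fatou _ _ _ _) _ => //.
rewrite limn_einf_lim; apply: lime_le; first exact: is_cvg_einfs.
near=> N; apply: le_trans (XK N).
by apply: ereal_inf_lbound; exists N => /=.
Unshelve. all: by end_near. Qed.

End Fatou.

Section Paths.
Context (R : realType) (d : nat).
Notation mu := (@lebesgue_measure R).

(** Continuity of paths refers to the max norm, Lipschitz bounds to the l1 norm; this links them. *)
Lemma l1norm_le_norm (v : 'rV[R]_d) : l1norm v <= d%:R * `|v|.
Proof.
rewrite /l1norm mulr_natl -[X in _ *+ X](card_ord d) -sumr_const.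
apply: ler_sum => i _.
rewrite [leRHS]/Num.Def.normr/= mx_normrE.
exact: (le_bigmax _ (fun ij => `|v ij.1 ij.2|) (ord0, i)).
Qed.

Lemma lip_path_continuous (g : 'rV[R]_d -> R) (L : R) (v : R -> 'rV[R]_d) (A : set R) :
  0 <= L -> lip L g -> {within A, continuous v} -> {within A, continuous (g \o v)}.
Proof.
move=> L0 gL /subspace_continuousP vc; apply/subspace_continuousP => x Ax.
apply/cvgrPdist_le => e e0.
have Ld0 : 0 < L * d%:R + 1 by rewrite ltr_wpDl// mulr_ge0.
have := vc x Ax; move/cvgrPdist_le => /(_ (e / (L * d%:R + 1))).
rewrite divr_gt0// => /(_ isT); apply: filterS => y H.
rewrite (le_trans (gL _ _))// (@le_trans _ _ (L * (d%:R * `|v x - v y|)))//.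
  by rewrite ler_wpM2l// l1norm_le_norm.
move: H; rewrite ler_pdivlMr// => H.
have := normr_ge0 (v x - v y); nra.
Qed.

End Paths.

(** * The error of the scheme *)

Section Preliminaries.
Context (R : realType) (d : nat).

(** The constants of a finite family are summed, so that one constant serves all indices. *)
Lemma bounded_lip_family (I : finType) (F : I -> 'rV[R]_d -> R) :
  (forall i, bounded_lip (F i)) ->
  exists2 L : R, 0 <= L & forall i, (forall x, `|F i x| <= L) /\ lip L (F i).
Proof.
move=> FB; have /choice[L HL] i : exists L : R, 0 <= L /\
    ((forall x, `|F i x| <= L) /\ lip L (F i)).
  by have [L L0 H] := FB i; exists L.
have S0 : 0 <= \sum_i L i by rewrite sumr_ge0// => i _; have [] := HL i.
have LS i : L i <= \sum_i L i.
  by rewrite (bigD1 i)//= lerDl sumr_ge0// => j _; have [] := HL j.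
exists (\sum_i L i) => // i; have [Li0 [Fb Fl]] := HL i; split => [x|x z].
  exact: le_trans (Fb x) _.
by rewrite (le_trans (Fl x z))// ler_wpM2r ?l1norm_ge0.
Qed.

Lemma l1norm_sqr_le (v : 'rV[R]_d) : l1norm v ^+ 2 <= d%:R * enorm2 v.
Proof.
rewrite (le_trans (sqr_sum_le _))// ler_wpM2l// ler_sum// => i _.
by rewrite real_normK ?num_real// expr2.
Qed.

Context (disp : measure_display) (Omega : measurableType disp)
  (P : probability Omega R).
Local Notation EE X := (Rintegral P setT X).

Lemma adapted_lip (S : set (Omega -> 'rV[R]_d)) (f : 'rV[R]_d -> R) (L : R) (X : Omega -> 'rV[R]_d) :
  0 <= L -> lip L f -> (forall i, adapted S (fun w => X w ord0 i)) ->
  adapted S (fun w => f (X w)).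
Proof.
move=> L0 fL aX.
exact: (@measurable_lip R _ (g_sigma_algebraType (gens S)) d f L X L0 fL aX).
Qed.

Lemma adapted_sum (S : set (Omega -> 'rV[R]_d)) n (F : 'I_n -> Omega -> R) :
  (forall i, adapted S (F i)) -> adapted S (fun w => \sum_(i < n) F i w).
Proof. by move=> H; exact: measurable_sum. Qed.

Lemma mean_sqr_le (b : nat -> R) X : moments P b X -> EE (fun w => X w ^+ 2) <= b 2.
Proof.
move=> Xb; rewrite -lee_fin -(mean_EFin (momentsM Xb Xb)); last first.
  by move=> w; rewrite -expr2 sqr_ge0.
apply: le_trans (Xb.2 2%N).
by under eq_integral do rewrite -expr2 -real_normK ?num_real//.
Qed.

Lemma sqrD_le (p q : R) : (p + q) ^+ 2 <= 2 * p ^+ 2 + 2 * q ^+ 2.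
Proof. by have := sqr_ge0 (p - q); nra. Qed.

Lemma mean_sqrD_le X Y : all_moments P X -> all_moments P Y ->
  EE (fun w => (X w + Y w) ^+ 2) <= 2 * EE (fun w => X w ^+ 2) + 2 * EE (fun w => Y w ^+ 2).
Proof.
move=> mX mY.
have mX2 : all_moments P (fun w => X w ^+ 2) by exact: all_momentsM.
have mY2 : all_moments P (fun w => Y w ^+ 2) by exact: all_momentsM.
rewrite -!all_meanZ// -all_meanD; [|by apply: all_momentsM => //; exact: all_moments_cst..].
apply: all_mean_mono.
- by apply: all_momentsM; exact: all_momentsD.
- by apply: all_momentsD; apply: all_momentsM => //; exact: all_moments_cst.
- by move=> w; exact: sqrD_le.
Qed.

Lemma mean_sqrZ (c : R) X : all_moments P X ->
  EE (fun w => (c * X w) ^+ 2) = c ^+ 2 * EE (fun w => X w ^+ 2).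
Proof.
move=> mX; rewrite -all_meanZ; last exact: all_momentsM.
by apply: eq_Rintegral => w _; rewrite exprMn.
Qed.

Lemma ae_mean_mono X Y : all_moments P X -> all_moments P Y ->
  (forall w, 0 <= X w) -> (forall w, 0 <= Y w) ->
  {ae P, forall w, X w <= Y w} -> EE X <= EE Y.
Proof.
move=> mX mY X0 Y0 XY; have [a Xa] := mX; have [b Yb] := mY.
rewrite -lee_fin -(mean_EFin Xa)// -(mean_EFin Yb)//.
apply: ae_ge0_le_integral => //.
- by move=> w _; rewrite lee_fin.
- exact/measurable_EFinP/Xa.1.
- by move=> w _; rewrite lee_fin.
- exact/measurable_EFinP/Yb.1.
by apply: filterS XY => w ? _; rewrite lee_fin.
Qed.

Lemma all_moments_bounded (X : Omega -> R) (M : R) : measurable_fun setT X ->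
  (forall w, `|X w| <= M) -> all_moments P X.
Proof. by move=> mX XM; eexists; exact: moments_bounded mX XM. Qed.

Lemma ler_sum_cst n (F : 'I_n -> R) (B : R) : (forall i, F i <= B) ->
  \sum_(i < n) F i <= n%:R * B.
Proof.
by move=> FB; rewrite mulr_natl -[X in _ *+ X](card_ord n) -sumr_const ler_sum.
Qed.

Lemma mean_sqr_sum_bound n (F : 'I_n -> Omega -> R) (B : R) :
  (forall i, all_moments P (F i)) -> (forall i, EE (fun om => F i om ^+ 2) <= B) ->
  EE (fun om => (\sum_(i < n) F i om) ^+ 2) <= n%:R ^+ 2 * B.
Proof.
move=> mF FB; apply: le_trans (mean_sqr_sum_le mF) _.
rewrite expr2 -[leRHS]mulrA ler_wpM2l//.
exact: ler_sum_cst.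
Qed.

Lemma mean_sqr_mean n (F : 'I_n -> Omega -> R) (B : R) : (0 < n)%N ->
  (forall j, all_moments P (F j)) -> (forall j, EE (fun om => F j om ^+ 2) <= B) ->
  EE (fun om => (n%:R^-1 * \sum_(j < n) F j om) ^+ 2) <= B.
Proof.
move=> n0 mF FB; rewrite mean_sqrZ; last exact: all_moments_sum_ord.
have n0' : 0 < n%:R :> R by rewrite ltr0n.
rewrite exprVn mulrC ler_pdivrMr ?exprn_gt0// mulrC; exact: mean_sqr_sum_bound.
Qed.

Lemma three_term_bound (x1 x2 x3 x4 y1 y2 y3 e : R) : x1 <= 2 * x2 + 2 * x3 ->
  x2 <= y1 * e -> x3 <= y2 * e -> x4 <= y3 * e ->
  2 * x1 + 2 * x4 <= (4 * y1 + 4 * y2 + 2 * y3) * e.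
Proof. by move=> *; lra. Qed.

Lemma four_term_bound (x1 x2 x3 x4 x5 x6 c1 c2 e : R) : x1 <= 2 * x3 + 2 * x4 ->
  x2 <= 2 * x5 + 2 * x6 -> x3 <= c1 * e -> x4 <= c2 * e -> x5 <= c2 * e -> x6 <= c2 * e ->
  2 * x1 + 2 * x2 <= 4 * (c1 + 3 * c2) * e.
Proof. by move=> *; lra. Qed.

Lemma mean_shift n (F : 'I_n -> R) (c : R) : (0 < n)%N ->
  n%:R^-1 * \sum_(i < n) (F i - c) = n%:R^-1 * (\sum_(i < n) F i) - c.
Proof.
by move=> n0; rewrite sumrB sumr_const card_ord mulrBr -(mulr_natl c n) mulKf// pnatr_eq0 -lt0n.
Qed.

Lemma defect_split (D z S p q m : R) :
  - (D * z) + D / m * S = - (D * (z - p)) + (D * (q - p) + D * (m^-1 * S - q)).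
Proof. by ring. Qed.

(** Discrete Gronwall with equality: the geometric sequence solves exactly the recursion in which
    each term is [z] plus [x] times the sum of the earlier ones. *)
Lemma geometric_sum m (x z : R) : z * (1 + x) ^+ m = z + x * \sum_(k < m) z * (1 + x) ^+ k.
Proof.
elim: m => [|m IHm]; first by rewrite big_ord0 expr0; ring.
by rewrite big_ord_recr/= exprSr mulrA IHm; ring.
Qed.

Lemma approx_bound (x1 x2 x3 x4 y1 y2 z e : R) : x2 <= 2 * x3 + 2 * x4 ->
  x1 <= y1 * e -> x4 <= y2 * e -> x3 <= z ->
  2 * x1 + 2 * x2 <= (2 * y1 + 4 * y2) * e + 4 * z.
Proof. by move=> *; lra. Qed.

End Preliminaries.

Section Model.
Context (R : realType) (d K : nat) (y : 'rV[R]_K) (nu : R) (Gamma : 'M[R]_K)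
  (G : 'rV[R]_d -> 'rV[R]_K) (J : nat) (T : R).
Hypothesis nu01 : nu = 0 \/ nu = 1.
Hypothesis GC2 : Ck_torus 2 G.
Hypothesis J0 : (0 < J)%N.
Hypothesis T0 : 0 < T.
Context (L C0 C1 : R) (coef : 'I_d -> 'I_d -> 'rV[R]_d -> R).
Local Notation g b theta := (gradient (Phi y Gamma G) theta ord0 b).
Hypothesis L0 : 0 <= L.
Hypothesis C00 : 0 <= C0.
Hypothesis C10 : 0 <= C1.
Hypothesis g_bounded : forall b x, `|g b x| <= L.
Hypothesis g_lip : forall b, lip L (fun x => g b x).
Hypothesis coef_bounded : forall i j x, `|coef i j x| <= L.
Hypothesis coef_lip : forall i j, lip L (coef i j).
Hypothesis quotient_bound : forall (sigma : R) (theta xi : 'rV[R]_d), 0 < sigma ->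
  `|sigma^-1 * dot_mx Gamma (G (theta + sigma *: xi) - G theta) (G theta - y)|
    <= C0 * l1norm xi.
Hypothesis quotient_expansion : forall (sigma : R) (theta xi : 'rV[R]_d), 0 < sigma ->
  `|sigma^-1 * dot_mx Gamma (G (theta + sigma *: xi) - G theta) (G theta - y)
     - \sum_(i < d) xi ord0 i * g i theta
     - sigma * \sum_(i < d) \sum_(j < d) xi ord0 i * xi ord0 j * coef i j theta|
    <= C1 * sigma ^+ beta G * l1norm xi ^+ (beta G).+1.

Context (disp : measure_display) (Omega : measurableType disp)
  (P : probability Omega R) (delta sigma Delta : R).
Hypothesis delta0 : 0 < delta.
Hypothesis sigma0 : 0 < sigma.
Hypothesis Delta0 : 0 < Delta.
Context (w : R -> Omega -> 'rV[R]_d).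
Hypothesis w_bm : brownian_motion P w.
Context (xj : nat -> 'I_J -> Omega -> 'rV[R]_d).
Hypothesis xj_gauss : forall n j, gaussian_vector P 1 (xj n j).
Hypothesis noise_indep : mutually_independent P
       (fun i : nat * option 'I_J =>
          sigma_of [set if i.2 is Some j then xj i.1 j else bm_incr Delta w i.1]).
Context (theta0 : Omega -> 'rV[R]_d).
Hypothesis theta0_rv : random_vector theta0.
Context (xi0 : 'I_J -> Omega -> 'rV[R]_d).
Hypothesis xi0_gauss : forall j, gaussian_vector P 1 (xi0 j).
Hypothesis init_indep : independent2 P
       (sigma_of ([set theta0] `|` range xi0))
       (sigma_of ([set w t | t in `[0, +oo[] `|`
                  [set xj i.1 i.2 | i in [set: nat * 'I_J]])).
Context (thetah : nat -> Omega -> 'rV[R]_d) (xih : nat -> 'I_J -> Omega -> 'rV[R]_d).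
Hypothesis thetah_xih : scheme y nu Gamma G delta sigma Delta theta0 xi0
                 (bm_incr Delta w) xj thetah xih.
Context (vartheta : R -> Omega -> 'rV[R]_d).
Hypothesis vartheta_sol : langevin_solution P (Phi y Gamma G) (nu * Num.sqrt 2) w
                   theta0 vartheta.
Local Notation EE X := (Rintegral P setT X).

(** * The filtration of the scheme and the moments of its increments *)

Let alpha : R := expR (- (Delta / delta ^+ 2)).
Let s : R := Num.sqrt (1 - expR (- (2 * Delta / delta ^+ 2))).

Let noise (i : nat * option 'I_J) : Omega -> 'rV[R]_d :=
  if i.2 is Some j then xj i.1 j else bm_incr Delta w i.1.

Let init : set (Omega -> 'rV[R]_d) := [set theta0] `|` range xi0.

Let future : set (Omega -> 'rV[R]_d) :=
  [set w t | t in `[0, +oo[] `|` [set xj i.1 i.2 | i in [set: nat * 'I_J]].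

(** Indices strictly below [n]: [hist n] determines the state at time [n], while the noise used in
    the step from [n] to [n.+1] is fresh. *)
Let hist (n : nat) : set (Omega -> 'rV[R]_d) :=
  init `|` [set noise i | i in [set i : nat * option 'I_J | (i.1 < n)%N]].

Lemma grid_ge0 (n : nat) : 0 <= n%:R * Delta.
Proof. by rewrite mulr_ge0// ltW. Qed.

Lemma w_rv (t : R) : 0 <= t -> random_vector (w t).
Proof. by case: w_bm => H _ _ _; exact: H. Qed.

Lemma noise_rv i : random_vector (noise i).
Proof.
move=> a; rewrite /noise; case: i => n [j|] /=; first by have [H _] := xj_gauss n j.
rewrite /bm_incr.
under eq_fun do rewrite !mxE.
by apply: measurable_funM => //; apply: measurable_funB; apply: w_rv; exact: grid_ge0.
Qed.

Lemma init_rv X : init X -> random_vector X.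
Proof. by move=> [->//|[j _ <-]]; have [] := xi0_gauss j. Qed.

Lemma hist_rv n X : hist n X -> random_vector X.
Proof. by move=> [/init_rv//|[i _ <-]]; exact: noise_rv. Qed.

Lemma noise_future i : sigma_of [set noise i] `<=` sigma_of future.
Proof.
apply: sigma_of_sub => _ -> a; rewrite /noise; case: i => n [j|] /=.
  by apply: adapted_coord; right; exists (n, j).
rewrite /bm_incr.
rewrite (_ : (fun om => _) = (fun om => (Num.sqrt Delta)^-1 *
   (w (n.+1%:R * Delta) om ord0 a - w (n%:R * Delta) om ord0 a))); last first.
  by apply/funext => om; rewrite !mxE.
apply: adaptedM; first exact: adapted_cst.
by apply: adaptedB; apply: adapted_coord; left => /=;
  [exists (n.+1%:R * Delta)|exists (n%:R * Delta)] => //=; rewrite in_itv/= andbT grid_ge0.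
Qed.

Lemma hist_indep n j : independent2 P (sigma_of (hist n)) (sigma_of [set xj n j]).
Proof.
apply: (@independent2_history _ _ _ P _ _ noise init future
  [set i : nat * option 'I_J | (i.1 < n)%N] (n, Some j)) => //=.
- exact: noise_rv.
- exact: init_rv.
- exact: noise_future.
- by rewrite ltnn.
Qed.

Lemma hist_mono k l f : (k <= l)%N -> adapted (hist k) f -> adapted (hist l) f.
Proof.
move=> kl; apply: adapted_sub; apply: sigma_of_sub => X HX a.
apply: adapted_coord; case: HX => [?|[i ik <-]]; first by left.
by right; exists i => //=; exact: leq_trans kl.
Qed.

Lemma xihS n j om : xih n.+1 j om = alpha *: xih n j om + s *: xj n j om.
Proof. by have [_ _ _ H] := thetah_xih om; rewrite H. Qed.

Lemma xih0 j : xih 0%N j = xi0 j.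
Proof. by apply/funext => om; have [_ H _ _] := thetah_xih om; rewrite H. Qed.

Lemma alpha_s : alpha ^+ 2 + s ^+ 2 = 1.
Proof.
rewrite /s sqr_sqrtr.
  rewrite /alpha -expRM_natl (_ : 2%:R * _ = - (2 * Delta / delta ^+ 2)); first by rewrite addrC subrK.
  by ring.
by rewrite subr_ge0 expR_le1 oppr_le0 divr_ge0 ?mulr_ge0 ?sqr_ge0 ?ltW.
Qed.

Lemma xih_adapted n j a : adapted (hist n) (fun om => xih n j om ord0 a).
Proof.
elim: n => [|n IH].
  by rewrite xih0; apply: adapted_coord; left; right; exists j.
rewrite (_ : (fun om => _) = (fun om => alpha * xih n j om ord0 a + s * xj n j om ord0 a)); last first.
  by apply/funext => om; rewrite xihS !mxE.
apply: adaptedD; apply: adaptedM; try exact: adapted_cst.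
  exact: hist_mono IH.
by apply: (@adapted_coord _ _ _ _ _ (noise (n, Some j))); right; exists (n, Some j) => /=.
Qed.

(** The finite-difference substitute for the gradient of [Phi] that the scheme evaluates at time
    [n]. *)
Let drift (n : nat) (b : 'I_d) (om : Omega) : R :=
  J%:R^-1 * \sum_(j < J) sigma^-1 * dot_mx Gamma
     (G (thetah n om + sigma *: xih n j om) - G (thetah n om)) (G (thetah n om) - y)
      * xih n j om ord0 b.

Lemma thetahS n om b : thetah n.+1 om ord0 b = thetah n om ord0 b - Delta * drift n b om
  + (nu * Num.sqrt (2 * Delta)) * bm_incr Delta w n om ord0 b.
Proof.
have [_ _ H _] := thetah_xih om; rewrite H !mxE; congr (_ - _ + _); congr (_ * _).
rewrite summxE /drift invfM -mulrA; congr (_ * _).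
rewrite big_distrr/=; apply: eq_bigr => j _.
by rewrite !mxE mulrA.
Qed.

(** Adaptedness of [thetah n] is a hypothesis because this serves inside the induction that proves
    it. *)
Lemma adapted_drift n b : (forall a, adapted (hist n) (fun om => thetah n om ord0 a)) ->
  adapted (hist n) (drift n b).
Proof.
move=> ath; rewrite /drift; apply: adaptedM; first exact: adapted_cst.
apply: adapted_sum => j; apply: adaptedM; last exact: xih_adapted.
apply: adaptedM; first exact: adapted_cst.
under eq_fun do rewrite dot_mx_weight.
apply: adapted_sum => k.
have [LG LG0 [_ HG]] := bounded_lip_G GC2 k.
have [LW LW0 [_ HW]] := bounded_lip_weight y Gamma GC2 k.
apply: adaptedM; last exact: (adapted_lip LW0 HW ath).
under eq_fun do rewrite !mxE.
apply: adaptedB; last exact: (adapted_lip LG0 HG ath).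
apply: (adapted_lip LG0 HG) => a.
under eq_fun do rewrite !mxE.
apply: adaptedD => //; apply: adaptedM; [exact: adapted_cst|exact: xih_adapted].
Qed.

Lemma thetah_adapted n a : adapted (hist n) (fun om => thetah n om ord0 a).
Proof.
elim: n a => [|n IH] a.
  rewrite (_ : thetah 0%N = theta0); first by apply: adapted_coord; left; left.
  by apply/funext => om; have [H _ _ _] := thetah_xih om.
rewrite (_ : (fun om => _) = (fun om => thetah n om ord0 a - Delta * drift n a om
  + (nu * Num.sqrt (2 * Delta)) * bm_incr Delta w n om ord0 a)); last first.
  by apply/funext => om; rewrite thetahS.
apply: adaptedD; first apply: adaptedB.
- exact: hist_mono (IH a).
- by apply: adaptedM; [exact: adapted_cst|apply: hist_mono (adapted_drift a IH)].
- apply: adaptedM; first exact: adapted_cst.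
  by apply: (@adapted_coord _ _ _ _ _ (noise (n, None))); right; exists (n, None) => /=.
Qed.

Lemma drift_adapted n b : adapted (hist n) (drift n b).
Proof. by apply: adapted_drift => a; exact: thetah_adapted. Qed.

Lemma hist_measurable n f : adapted (hist n) f -> measurable_fun setT f.
Proof. by apply: adapted_measurable => X; exact: hist_rv. Qed.

Lemma xih_subgaussian_moments n j a : moments P (gaussian_bound R) (fun om => xih n j om ord0 a).
Proof.
apply: (@xi_moments _ _ _ P d hist (fun n => xih n j) (fun n => xj n j) alpha s alpha_s) => //.
- by rewrite xih0.
- by move=> *; exact: xihS.
- by move=> *; exact: xih_adapted.
- by move=> *; exact: hist_indep.
Qed.

(** Built from [J], [d] and the normal bounds alone, hence uniform in [delta], [sigma] and
    [Delta]. *)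
Definition rho_bound : nat -> R := sum_bound J (sum_bound d (@gaussian_bound R)).

Definition drift_bound (q : nat) : R := `|C0| ^+ q * (rho_bound (2 * q) + rho_bound (2 * q)).

(** One scalar that dominates all particles at once; the drift is at most quadratic in it. *)
Let rho (n : nat) (om : Omega) : R := \sum_(j < J) l1norm (xih n j om).

Lemma rho_ge0 n om : 0 <= rho n om.
Proof. by rewrite sumr_ge0// => j _; exact: l1norm_ge0. Qed.

Lemma l1norm_le_rho n j om : l1norm (xih n j om) <= rho n om.
Proof.
by rewrite /rho (bigD1 j)//= lerDl sumr_ge0// => i _; exact: l1norm_ge0.
Qed.

Lemma rho_moments n : moments P rho_bound (rho n).
Proof.
apply: moments_sum_ord => j; apply: moments_sum_ord => a.
exact/moments_norm/xih_subgaussian_moments.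
Qed.

Lemma invJ_le1 : 0 <= (J%:R : R)^-1 <= 1.
Proof. by rewrite invr_ge0 ler0n invf_le1 ?ltr0n// ler1n. Qed.

Lemma norm_average_le (F : 'I_J -> R) (B : 'I_J -> R) : (forall j, `|F j| <= B j) ->
  `|J%:R^-1 * \sum_(j < J) F j| <= \sum_(j < J) B j.
Proof.
move=> FB; have /andP[J0' J1] := invJ_le1.
rewrite normrM (ger0_norm J0') (le_trans (ler_piMl _ J1))//.
by rewrite (le_trans (ler_norm_sum _ _ _))// ler_sum.
Qed.

Lemma drift_le n b om : `|drift n b om| <= `|C0 * (rho n om * rho n om)|.
Proof.
rewrite (ger0_norm (mulr_ge0 C00 (mulr_ge0 (rho_ge0 n om) (rho_ge0 n om)))).
apply: le_trans (norm_average_le (B := fun j => C0 * rho n om * l1norm (xih n j om)) _) _.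
  move=> j; rewrite normrM; apply: ler_pM => //.
    apply: le_trans (quotient_bound _ _ sigma0) _.
    by rewrite ler_wpM2l// l1norm_le_rho.
  exact: ler_coord_l1norm.
by rewrite -big_distrr/= mulrA.
Qed.

Lemma drift_moments n b : moments P drift_bound (drift n b).
Proof.
apply: (moments_le _ (drift_le n b)).
  exact: (hist_measurable (@drift_adapted n b)).
exact: (momentsZ C0 (momentsM (rho_moments n) (rho_moments n))).
Qed.

Lemma drift_all_moments n b : all_moments P (drift n b).
Proof. by eexists; exact: drift_moments. Qed.

Lemma w_increment_moments (a t : R) b : 0 <= a -> a < t ->
  moments P (@gaussian_bound R)
    (fun om => (Num.sqrt (t - a))^-1 * (w t om ord0 b - w a om ord0 b)).
Proof.
move=> a0 at_; have [_ _ H _] := w_bm.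
have := gaussian_vector_coord b (H _ _ a0 at_).
move=> /(gaussian_rv_subgaussian _)-/(_ _)/subgaussian_moments.
rewrite sqrtr_gt0 subr_gt0 => /(_ at_).
by under eq_fun do rewrite !mxE.
Qed.

Lemma w_increment_all_moments (a t : R) b : 0 <= a -> a <= t ->
  all_moments P (fun om => w t om ord0 b - w a om ord0 b).
Proof.
move=> a0; rewrite le_eqVlt => /predU1P[->|at_].
  by under eq_fun do rewrite subrr; exact: all_moments_cst.
have ta : Num.sqrt (t - a) != 0 by rewrite lt0r_neq0// sqrtr_gt0 subr_gt0.
rewrite (_ : (fun om => _) = (fun om => Num.sqrt (t - a) *
  ((Num.sqrt (t - a))^-1 * (w t om ord0 b - w a om ord0 b)))); last first.
  by apply/funext => om; rewrite mulrA divff// mul1r.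
apply: all_momentsM; first exact: all_moments_cst.
by eexists; exact: (w_increment_moments b a0 at_).
Qed.

(** [h] may depend on the increment, so the product is controlled by fourth moments; normalizing the
    increment first extracts the factor [t - a]. *)
Lemma mean_sqr_w_increment (a t : R) b (h : Omega -> R) (bh : nat -> R) :
  0 <= a -> a <= t -> moments P bh h ->
  EE (fun om => ((w t om ord0 b - w a om ord0 b) * h om) ^+ 2) <=
    (t - a) * (gaussian_bound R 4 + bh 4).
Proof.
move=> a0; rewrite le_eqVlt => /predU1P[->|at_] hb.
  rewrite subrr mul0r (_ : (fun om => _) = (fun=> 0)) ?mean_cst//.
  by apply/funext => om; rewrite subrr mul0r expr0n.
have ta : 0 < t - a by rewrite subr_gt0.
have W := momentsM (w_increment_moments b a0 at_) hb.
rewrite (_ : (fun om => _) = (fun om => (Num.sqrt (t - a) *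
  ((Num.sqrt (t - a))^-1 * (w t om ord0 b - w a om ord0 b) * h om)) ^+ 2)); last first.
  by apply/funext => om; rewrite !mulrA divff ?mul1r// lt0r_neq0// sqrtr_gt0.
rewrite mean_sqrZ; last by eexists; exact: W.
rewrite sqr_sqrtr; last exact: ltW.
by rewrite ler_pM2l//; exact: (mean_sqr_le W).
Qed.

Lemma mean_sqr_riemann_sum (X : nat -> Omega -> R) (B : R) n :
  (forall k, all_moments P (X k)) -> (forall k, (k < n)%N -> EE (fun om => X k om ^+ 2) <= B) ->
  EE (fun om => (\sum_(k < n) Delta * X k om) ^+ 2) <= (n%:R * Delta) ^+ 2 * B.
Proof.
move=> mX XB.
apply: le_trans (mean_sqr_sum_le _) _ => [k|].
  by apply: all_momentsM => //; exact: all_moments_cst.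
rewrite exprMn expr2 -!mulrA ler_wpM2l// (_ : n%:R * _ = \sum_(k < n) (Delta ^+ 2 * B)); last first.
  by rewrite sumr_const card_ord -[RHS]mulr_natl expr2 -!mulrA.
by apply: ler_sum => k _; rewrite mean_sqrZ// ler_wpM2l ?sqr_ge0// XB.
Qed.

Let W (k l : nat) (b : 'I_d) (om : Omega) : R :=
  w (k%:R * Delta) om ord0 b - w (l%:R * Delta) om ord0 b.

(** Writes the noise of one step as an increment of the path that drives the Langevin equation, so
    that the two noises later cancel exactly. *)
Lemma sqrt_noise (n : nat) om b :
  (nu * Num.sqrt (2 * Delta)) * bm_incr Delta w n om ord0 b =
  nu * Num.sqrt 2 * W n.+1 n b om.
Proof.
rewrite /bm_incr !mxE sqrtrM// /W; set u := _ - _.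
have S0 : Num.sqrt Delta != 0 by rewrite lt0r_neq0// sqrtr_gt0.
by field.
Qed.

Lemma thetah_increment (m l : nat) om b :
  thetah (l + m) om ord0 b = thetah l om ord0 b
    - \sum_(i < m) Delta * drift (l + i) b om + nu * Num.sqrt 2 * W (l + m) l b om.
Proof.
elim: m => [|m IH]; first by rewrite addn0 big_ord0 /W subrr mulr0 subr0 addr0.
rewrite addnS thetahS IH big_ord_recr/= sqrt_noise /W; ring.
Qed.

Lemma nu_sqr : (nu * Num.sqrt 2) ^+ 2 <= 2.
Proof.
rewrite exprMn sqr_sqrtr//; case: nu01 => ->; first by rewrite expr0n/= mul0r.
by rewrite expr1n mul1r.
Qed.

Lemma thetah_increment_all_moments k l b : (l <= k)%N ->
  all_moments P (fun om => thetah k om ord0 b - thetah l om ord0 b).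
Proof.
move=> lk; rewrite -(subnKC lk).
rewrite (_ : (fun om => _) = (fun om => nu * Num.sqrt 2 * W (l + (k - l)) l b om
    - \sum_(i < k - l) Delta * drift (l + i) b om)); last first.
  by apply/funext => om; rewrite thetah_increment; ring.
apply: all_momentsB.
  apply: all_momentsM; first exact: all_moments_cst.
  by apply: (w_increment_all_moments b (grid_ge0 l)); rewrite ler_pM2r// ler_nat leq_addr.
apply: all_moments_sum_ord => i; apply: all_momentsM; first exact: all_moments_cst.
exact: drift_all_moments.
Qed.

(** The drift contributes [(m%:R * Delta) ^+ 2], made linear by the horizon [T], and the Brownian
    part is linear already. *)
Lemma mean_sqr_increment (m l : nat) b (h : Omega -> R) (bh : nat -> R) :
  (l + m)%:R * Delta <= T -> moments P bh h ->
  EE (fun om => ((thetah (l + m) om ord0 b - thetah l om ord0 b) * h om) ^+ 2) <=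
    (2 * T * (drift_bound 4 + bh 4) + 4 * (gaussian_bound R 4 + bh 4)) * (m%:R * Delta).
Proof.
move=> lmT hb.
have mT : m%:R * Delta <= T.
  by apply: le_trans lmT; rewrite ler_pM2r// ler_nat leq_addl.
have mh : all_moments P h by exists bh.
have mdh i : all_moments P (fun om => drift (l + i) b om * h om).
  by apply: all_momentsM => //; exact: drift_all_moments.
have mS : all_moments P (fun om => \sum_(i < m) Delta * (drift (l + i) b om * h om)).
  by apply: all_moments_sum_ord => i; apply: all_momentsM => //; exact: all_moments_cst.
have lml : l%:R * Delta <= (l + m)%:R * Delta by rewrite ler_pM2r// ler_nat leq_addr.
have WE := mean_sqr_w_increment b (grid_ge0 l) lml hb.
have mW : all_moments P (fun om => W (l + m) l b om * h om).
  by apply: all_momentsM => //; exact: (w_increment_all_moments b (grid_ge0 l)).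
have b4 : 0 <= drift_bound 4 + bh 4.
  exact: (moments_bound_ge0 2 (momentsM (drift_moments 0 b) hb)).
rewrite (_ : (fun om => _) = (fun om => (-1 * (\sum_(i < m) Delta * (drift (l + i) b om * h om))
    + nu * Num.sqrt 2 * (W (l + m) l b om * h om)) ^+ 2)); last first.
  apply/funext => om; rewrite thetah_increment; congr (_ ^+ 2).
  under [in RHS]eq_bigr do rewrite mulrA.
  by rewrite -big_distrl/=; ring.
apply: le_trans (mean_sqrD_le _ _) _.
- by apply: all_momentsM => //; exact: all_moments_cst.
- by apply: all_momentsM => //; exact: all_moments_cst.
rewrite mean_sqrZ// mean_sqrZ// sqrrN expr1n mul1r [leRHS]mulrDl; apply: lerD.
  rewrite (_ : 2 * T * _ * _ = 2 * (m%:R * Delta * T * (drift_bound 4 + bh 4))); last by ring.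
  rewrite ler_pM2l//.
  apply: (le_trans (@mean_sqr_riemann_sum (fun i om => drift (l + i) b om * h om)
    (drift_bound 4 + bh 4) m _ _)) => //.
    by move=> k _; exact: (mean_sqr_le (momentsM (drift_moments _ _) hb)).
  by rewrite ler_wpM2r// expr2 ler_wpM2l ?grid_ge0.
rewrite (_ : 4 * _ * _ = 2 * (2 * (m%:R * Delta * (gaussian_bound R 4 + bh 4)))); last by ring.
rewrite ler_pM2l//; apply: ler_pM; [exact: sqr_ge0| |exact: nu_sqr|].
  by apply: Rintegral_ge0 => om _; exact: sqr_ge0.
apply: le_trans WE _; rewrite le_eqVlt; apply/orP; left; apply/eqP.
by congr (_ * _); rewrite natrD; ring.
Qed.

Definition increment_bound (b : nat -> R) : R :=
  L ^+ 2 * d%:R * (d%:R * (2 * T * (drift_bound 4 + b 4) + 4 * (gaussian_bound R 4 + b 4))).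

(** Supplies the increment hypothesis of [averaging]. Values of [f] along the scheme are taken
    bounded because [thetah] itself need not have moments. *)
Lemma mean_sqr_lip_increment f (h : Omega -> R) (bh : nat -> R) k l :
  lip L f -> (l <= k)%N -> k%:R * Delta <= T -> (forall om, `|f (thetah k om)| <= L) ->
  (forall om, `|f (thetah l om)| <= L) -> moments P bh h ->
  EE (fun om => ((f (thetah k om) - f (thetah l om)) * h om) ^+ 2) <=
    increment_bound bh * ((k - l)%:R * Delta).
Proof.
move=> fL lk kT fk fl hb; have mh : all_moments P h by exists bh.
have mf i : measurable_fun setT (fun om => f (thetah i om)).
  apply: (measurable_lip L0 fL) => a; exact: (hist_measurable (@thetah_adapted i a)).
have md a : all_moments P (fun om => (thetah k om ord0 a - thetah l om ord0 a) * h om).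
  by apply: all_momentsM => //; exact: thetah_increment_all_moments.
have md2 a : all_moments P (fun om => ((thetah k om ord0 a - thetah l om ord0 a) * h om) ^+ 2).
  exact: all_momentsM.
have mS : all_moments P (fun om => \sum_(a < d) ((thetah k om ord0 a - thetah l om ord0 a) * h om) ^+ 2).
  exact: all_moments_sum_ord.
apply: (@le_trans _ _ (EE (fun om => L ^+ 2 * d%:R *
    \sum_(a < d) ((thetah k om ord0 a - thetah l om ord0 a) * h om) ^+ 2))).
  apply: all_mean_mono.
  - have mfh : all_moments P (fun om => (f (thetah k om) - f (thetah l om)) * h om).
      apply: all_momentsM => //; apply: all_momentsB.
        exact: all_moments_bounded (mf k) fk.
      exact: all_moments_bounded (mf l) fl.
    exact: all_momentsM.
  - by apply: all_momentsM => //; exact: all_moments_cst.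
  move=> om; rewrite exprMn.
  rewrite (_ : \sum_(a < d) _ = enorm2 (thetah k om - thetah l om) * h om ^+ 2); last first.
    rewrite big_distrl/=; apply: eq_bigr => a _; rewrite !mxE exprMn -expr2//.
  rewrite mulrA ler_wpM2r ?sqr_ge0// -mulrA.
  apply: (@le_trans _ _ (L ^+ 2 * l1norm (thetah k om - thetah l om) ^+ 2)).
    rewrite -exprMn -[leLHS]real_normK ?num_real// lerXn2r ?nnegrE ?mulr_ge0 ?l1norm_ge0//.
  by rewrite ler_wpM2l ?sqr_ge0// l1norm_sqr_le.
rewrite all_meanZ// all_mean_sum_ord// -[leLHS]mulrA [leRHS](_ : _ =
  L ^+ 2 * (d%:R * (d%:R * ((2 * T * (drift_bound 4 + bh 4) +
    4 * (gaussian_bound R 4 + bh 4)) * ((k - l)%:R * Delta))))); last by rewrite /increment_bound; ring.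
apply: ler_wpM2l; first exact: sqr_ge0.
apply: ler_wpM2l => //; apply: ler_sum_cst => a.
by have := @mean_sqr_increment (k - l) l a h bh; rewrite subnKC//; apply.
Qed.

Lemma drift_bound_ge0 q : 0 <= drift_bound q.
Proof.
have H := moments_bound_ge0 (2 * q) (rho_moments 0).
by rewrite /drift_bound mulr_ge0 ?exprn_ge0// addr_ge0.
Qed.

Lemma gaussian_bound_ge0 q : 0 <= gaussian_bound R q.
Proof. by rewrite /gaussian_bound mulr_ge0// mulr_ge0// expR_ge0. Qed.

Lemma increment_bound_ge0 (b : nat -> R) : 0 <= b 4%N -> 0 <= increment_bound b.
Proof.
move=> b4; rewrite /increment_bound !mulr_ge0 ?sqr_ge0// addr_ge0// mulr_ge0//.
- by rewrite mulr_ge0// ltW.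
- by rewrite addr_ge0// drift_bound_ge0.
- by rewrite addr_ge0// gaussian_bound_ge0.
Qed.

(** * Averaging bounds for the Hermite fluctuations *)

Let err : R := Delta + ln (1 + delta^-1) * delta ^+ 2.

Lemma ln_delta_ge0 : 0 <= ln (1 + delta^-1).
Proof. by rewrite ln_ge0// lerDl invr_ge0 ltW. Qed.

Lemma err_ge0 : 0 <= err.
Proof. by rewrite addr_ge0 ?(ltW Delta0)// mulr_ge0 ?sqr_ge0// ln_delta_ge0. Qed.

(* The window of the averaging argument: long enough for the memory
   [alpha ^+ m] of the autoregression to drop below the target error. *)
Lemma averaging_window : exists m : nat, m%:R * Delta + alpha ^+ m <= 3 * err.
Proof.
set x := ln (1 + delta^-1); have x0 : 0 <= x by exact: ln_delta_ge0.
have d2 : 0 < delta ^+ 2 by rewrite exprn_gt0.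
set z := 2 * delta ^+ 2 * x / Delta.
have z0 : 0 <= z by rewrite divr_ge0 ?(ltW Delta0)// !mulr_ge0// ltW.
(* This [m] makes [m%:R * Delta] exceed [2 * delta ^+ 2 * x] by at most [Delta], while [alpha ^+ m]
   is at most [expR (- x + - x)], that is [(delta / (1 + delta)) ^+ 2]. *)
exists (Num.truncn z).+1.
have /andP[zl zu] := truncn_itv z0.
have H1 : (Num.truncn z).+1%:R * Delta <= 2 * delta ^+ 2 * x + Delta.
  rewrite -addn1 natrD mulrDl mul1r lerD2r.
  by rewrite -[leRHS](@divfK _ Delta) ?lt0r_neq0// ler_pM2r.
have H2 : alpha ^+ (Num.truncn z).+1 <= delta ^+ 2 * x.
  have xv : expR (- x) = delta / (1 + delta).
    rewrite expRN lnK; last by rewrite posrE addr_gt0// invr_gt0.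
    by field; rewrite !lt0r_neq0// addr_gt0.
  (* From [1 - x <= expR (- x)]. One of the two factors [(1 + delta)^-1] is traded for the
     logarithm; the other is at most 1. *)
  have xl : (1 + delta)^-1 <= x.
    have := expR_ge1Dx (- x); rewrite xv lerBlDl -lerBlDr; apply: le_trans.
    by rewrite le_eqVlt; apply/orP; left; apply/eqP; field; rewrite lt0r_neq0// addr_gt0.
  rewrite /alpha -expRM_natl.
  apply: (@le_trans _ _ (expR (- x + - x))).
    rewrite ler_expR -opprD mulrN lerN2 mulrA ler_pdivlMr//.
    rewrite -[leLHS](@divfK _ Delta) ?lt0r_neq0// ler_pM2r//.
    apply: le_trans (ltW zu); rewrite /z le_eqVlt; apply/orP; left; apply/eqP.
    by congr (_ / _); ring.
  rewrite expRD xv (_ : _ * _ = delta ^+ 2 * ((1 + delta)^-1 * (1 + delta)^-1)); last first.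
    by field; rewrite lt0r_neq0// addr_gt0.
  rewrite ler_pM2l//; apply: le_trans xl.
  by rewrite ler_piMr ?invr_ge0 ?invf_le1 ?addr_ge0 ?lerDl ?addr_gt0// ltW.
by apply: le_trans (lerD H1 H2) _; rewrite /err -/x; have := ltW Delta0; nra.
Qed.

(** The constant of [averaging], times 3 from [averaging_window]. *)
Definition averaging_bound (b : nat -> R) : R :=
  3 * (2 * (T ^+ 2 * increment_bound b + L ^+ 2 * (b 2 + b 2) * (T ^+ 2 + 2 * T))).

Lemma averaging_bound_ge0 (b : nat -> R) : 0 <= b 2%N -> 0 <= b 4%N -> 0 <= averaging_bound b.
Proof.
move=> b2 b4; have := increment_bound_ge0 b4; have := sqr_ge0 T; have := sqr_ge0 L.
move: T0 => /ltW T0' p q r.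
have u : 0 <= T ^+ 2 + 2 * T by rewrite addr_ge0// mulr_ge0.
have v : 0 <= b 2%N + b 2%N by rewrite addr_ge0.
by rewrite /averaging_bound mulr_ge0// mulr_ge0// addr_ge0// mulr_ge0// mulr_ge0.
Qed.

(** Since [lambda <= alpha], the window chosen for [alpha] serves the Hermite polynomials of every
    degree. *)
Lemma mean_sqr_average f (h : nat -> Omega -> R) (b : nat -> R) (lambda : R) n :
  (forall x, `|f x| <= L) -> lip L f -> (forall k, adapted (hist k) (h k)) ->
  (forall k, moments P b (h k)) -> contracts P hist lambda h ->
  0 <= lambda <= alpha -> n%:R * Delta <= T ->
  EE (fun om => (\sum_(k < n) Delta * (f (thetah k om) * h k om)) ^+ 2) <=
    averaging_bound b * err.
Proof.
move=> fb fl ah hb hc /andP[l0 la] nT; have [m mE] := averaging_window.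
have f_adapted k : adapted (hist k) (fun om => f (thetah k om)).
  by apply: (adapted_lip L0 fl) => a; exact: thetah_adapted.
apply: (le_trans (@averaging _ _ _ P d hist (fun k om => f (thetah k om)) h b L
  (increment_bound b) T lambda Delta hist_mono _ ah _ _ hb hc l0 L0 _ (ltW T0) Delta0 _ m n nT)).
- by [].
- by move=> k; exact: (all_moments_bounded P (hist_measurable (f_adapted k)) (fun om => fb (thetah k om))).
- by [].
- exact: (increment_bound_ge0 (moments_bound_ge0 _ (hb 0%N))).
- by move=> k l lk kT; apply: mean_sqr_lip_increment.
rewrite /averaging_bound (_ : 3 * (2 * ?[c]) * err = 2 * ?c * (3 * err)); last by ring.
apply: ler_wpM2l.
  have := averaging_bound_ge0 (moments_bound_ge0 _ (hb 0%N)) (moments_bound_ge0 _ (hb 0%N)).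
  by rewrite /averaging_bound pmulr_rge0.
by apply: le_trans mE; rewrite lerD2l lerXn2r// nnegrE// expR_ge0.
Qed.

Definition quadratic_bound (q : nat) : R :=
  2 ^+ q * (gaussian_bound R (2 * q) + gaussian_bound R (2 * q) + 1).

Definition product3_bound (q : nat) : R :=
  gaussian_bound R (2 * (2 * q)) + gaussian_bound R (2 * (2 * q)) + gaussian_bound R (2 * q).

Definition cubic_bound (q : nat) : R :=
  2 ^+ q * (product3_bound q +
    2 ^+ q * (2 ^+ q * (gaussian_bound R q + gaussian_bound R q) + gaussian_bound R q)).

Local Notation xi n j a om := (xih n j om ord0 a).

Lemma alpha_ge0 : 0 <= alpha. Proof. exact: expR_ge0. Qed.

Lemma alpha_le1 : alpha <= 1.
Proof. by rewrite expR_le1 oppr_le0 divr_ge0 ?sqr_ge0// ltW. Qed.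

Lemma alphaX_le (m : nat) : 0 <= alpha ^+ m.+1 <= alpha.
Proof.
rewrite exprn_ge0 ?alpha_ge0//= exprS ler_piMr ?alpha_ge0//.
by rewrite exprn_ile1 ?alpha_ge0 ?alpha_le1.
Qed.

Lemma xih0_gauss j : gaussian_vector P 1 (xih 0%N j).
Proof. by rewrite xih0. Qed.

Lemma mean_sqr_average_linear f j a n :
  (forall x, `|f x| <= L) -> lip L f -> n%:R * Delta <= T ->
  EE (fun om => (\sum_(k < n) Delta * (f (thetah k om) * xi k j a om)) ^+ 2) <=
    averaging_bound (@gaussian_bound R) * err.
Proof.
move=> fb fl nT.
apply: (@mean_sqr_average f (fun k om => xi k j a om) (@gaussian_bound R) alpha) => //.
- by move=> k; exact: xih_adapted.
- by move=> k; exact: xih_subgaussian_moments.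
- apply: (@contracts_linear _ _ _ P d hist (fun n => xih n j) (fun n => xj n j) alpha s) => //.
  + exact: alpha_s.
  + exact: xih0_gauss.
  + by move=> *; exact: xihS.
  + by move=> *; exact: xih_adapted.
  + by move=> *; exact: hist_indep.
- by rewrite alpha_ge0 lexx.
Qed.

Lemma mean_sqr_average_quadratic f j a b n :
  (forall x, `|f x| <= L) -> lip L f -> n%:R * Delta <= T ->
  EE (fun om => (\sum_(k < n) Delta *
    (f (thetah k om) * (xi k j a om * xi k j b om - (a == b)%:R))) ^+ 2) <=
    averaging_bound quadratic_bound * err.
Proof.
move=> fb fl nT.
apply: (@mean_sqr_average f (fun k om => xi k j a om * xi k j b om - (a == b)%:R)
  quadratic_bound (alpha ^+ 2)) => //.
- by move=> k; apply: adaptedB; [apply: adaptedM; exact: xih_adapted|exact: adapted_cst].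
- move=> k; apply: moments_weaken (momentsB (momentsM (xih_subgaussian_moments k j a)
    (xih_subgaussian_moments k j b)) (moments_cst P (a == b)%:R)) => q.
  rewrite /quadratic_bound ler_wpM2l ?exprn_ge0// lerD2l.
  by rewrite normr_nat; case: (a == b); rewrite ?expr1n// expr0n; case: q.
- apply: (@contracts_quadratic _ _ _ P d hist (fun n => xih n j) (fun n => xj n j) alpha s) => //.
  + exact: alpha_s.
  + exact: xih0_gauss.
  + by move=> *; exact: xihS.
  + by move=> *; exact: xih_adapted.
  + by move=> *; exact: hist_indep.
- exact: alphaX_le.
Qed.

Lemma product3_moments k j a b c :
  moments P product3_bound (fun om => xi k j a om * xi k j b om * xi k j c om).
Proof.
exact: (momentsM (momentsM (xih_subgaussian_moments k j a) (xih_subgaussian_moments k j b))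
  (xih_subgaussian_moments k j c)).
Qed.

Lemma xih_all_moments k j a : all_moments P (fun om => xi k j a om).
Proof. by eexists; exact: xih_subgaussian_moments. Qed.

Lemma natb_moments k j a (e : bool) :
  moments P (@gaussian_bound R) (fun om => e%:R * xi k j a om).
Proof.
have H := xih_subgaussian_moments k j a.
apply: (moments_le _ _ H); first by apply: measurable_funM => //; exact: H.1.
by move=> om; rewrite normrM normr_nat ler_piMl//; case: e.
Qed.

Lemma mean_sqr_average_hermite f j a b c n :
  (forall x, `|f x| <= L) -> lip L f -> n%:R * Delta <= T ->
  EE (fun om => (\sum_(k < n) Delta * (f (thetah k om) *
    (xi k j a om * xi k j b om * xi k j c om - ((a == b)%:R * xi k j c om
      + (b == c)%:R * xi k j a om + (a == c)%:R * xi k j b om)))) ^+ 2) <=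
    averaging_bound cubic_bound * err.
Proof.
move=> fb fl nT.
apply: (@mean_sqr_average f (fun k om => xi k j a om * xi k j b om * xi k j c om -
  ((a == b)%:R * xi k j c om + (b == c)%:R * xi k j a om + (a == c)%:R * xi k j b om))
  cubic_bound (alpha ^+ 3)) => //.
- move=> k; apply: adaptedB.
    by apply: adaptedM; first apply: adaptedM; exact: xih_adapted.
  by do 2?apply: adaptedD; apply: adaptedM; first [exact: adapted_cst|exact: xih_adapted].
- move=> k; exact: (momentsB (product3_moments k j a b c)
    (momentsD (momentsD (natb_moments k j c _) (natb_moments k j a _)) (natb_moments k j b _))).
- apply: (@contracts_cubic _ _ _ P d hist (fun n => xih n j) (fun n => xj n j) alpha s) => //.
  + exact: alpha_s.
  + exact: xih0_gauss.
  + by move=> *; exact: xihS.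
  + by move=> *; exact: xih_adapted.
  + by move=> *; exact: hist_indep.
- exact: alphaX_le.
Qed.

Lemma thetah_lip_moments f k : (forall x, `|f x| <= L) -> lip L f ->
  all_moments P (fun om => f (thetah k om)).
Proof.
move=> fb fl; apply: (all_moments_bounded P _ (fun om => fb (thetah k om))).
apply: hist_measurable; apply: (adapted_lip L0 fl) => a; exact: (@thetah_adapted k a).
Qed.

Lemma weighted_sum_moments f n (h : nat -> Omega -> R) :
  (forall x, `|f x| <= L) -> lip L f -> (forall k, all_moments P (h k)) ->
  all_moments P (fun om => \sum_(k < n) Delta * (f (thetah k om) * h k om)).
Proof.
move=> fb fl mh; apply: all_moments_sum_ord => k; apply: all_momentsM; first exact: all_moments_cst.
by apply: all_momentsM => //; exact: thetah_lip_moments.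
Qed.

Lemma mean_sqr_average_natb f j a (e : bool) n :
  (forall x, `|f x| <= L) -> lip L f -> n%:R * Delta <= T ->
  EE (fun om => (e%:R * \sum_(k < n) Delta * (f (thetah k om) * xi k j a om)) ^+ 2) <=
    averaging_bound (@gaussian_bound R) * err.
Proof.
move=> fb fl nT; rewrite mean_sqrZ; last first.
  by apply: (@weighted_sum_moments f n (fun k om => xi k j a om)) => // k; exact: xih_all_moments.
case: e; first by rewrite expr1n mul1r; exact: mean_sqr_average_linear.
rewrite expr0n mul0r mulr_ge0 ?err_ge0// averaging_bound_ge0 ?gaussian_bound_ge0//.
Qed.

(** One Hermite term and three linear ones; two nested uses of [mean_sqrD_le] give the factor 4. *)
Definition cubic_averaging_bound : R :=
  4 * (averaging_bound cubic_bound + 3 * averaging_bound (@gaussian_bound R)).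

(** The triple product is its Hermite polynomial plus linear terms. These contract at different
    rates, so each is averaged separately. *)
Lemma mean_sqr_average_cubic f j a b c n :
  (forall x, `|f x| <= L) -> lip L f -> n%:R * Delta <= T ->
  EE (fun om => (\sum_(k < n) Delta * (f (thetah k om) *
    (xi k j a om * xi k j b om * xi k j c om))) ^+ 2) <= cubic_averaging_bound * err.
Proof.
move=> fb fl nT.
have mx k i : all_moments P (fun om => xi k j i om) by exact: xih_all_moments.
pose S (h : nat -> Omega -> R) om := \sum_(k < n) Delta * (f (thetah k om) * h k om).
have mS (h : nat -> Omega -> R) : (forall k, all_moments P (h k)) -> all_moments P (S h).
  by move=> mh; exact: weighted_sum_moments.
pose lin k om := (a == b)%:R * xi k j c om + (b == c)%:R * xi k j a om + (a == c)%:R * xi k j b om.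
pose H := S (fun k om => xi k j a om * xi k j b om * xi k j c om - lin k om).
have mD (e : bool) i : all_moments P (fun om => e%:R * S (fun k om => xi k j i om) om).
  by apply: all_momentsM; [exact: all_moments_cst|exact: mS].
have mH : all_moments P H.
  apply: mS => k; apply: all_momentsB; first by eexists; exact: product3_moments.
  by rewrite /lin; do 2?apply: all_momentsD; apply: all_momentsM => //; exact: all_moments_cst.
rewrite (_ : (fun om => _) = (fun om => (
    (H om + (a == b)%:R * S (fun k om => xi k j c om) om) +
    ((b == c)%:R * S (fun k om => xi k j a om) om +
     (a == c)%:R * S (fun k om => xi k j b om) om)) ^+ 2)); last first.
  apply/funext => om; congr (_ ^+ 2); rewrite /H /S !big_distrr/= -!big_split/=.
  by apply: eq_bigr => k _; rewrite /lin; ring.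
apply: le_trans (mean_sqrD_le _ _) _; [exact: all_momentsD..|].
have H1 := mean_sqrD_le mH (mD (a == b) c).
have H2 := mean_sqrD_le (mD (b == c) a) (mD (a == c) b).
have := mean_sqr_average_hermite j a b c fb fl nT.
have := mean_sqr_average_natb j c (a == b) fb fl nT.
have := mean_sqr_average_natb j a (b == c) fb fl nT.
have := mean_sqr_average_natb j b (a == c) fb fl nT.
by move=> *; apply: (four_term_bound H1 H2).
Qed.

(** * Decomposition and size of the consistency error *)

Let quad (k : nat) (b : 'I_d) (om : Omega) : R := J%:R^-1 * \sum_(j < J) \sum_(a < d)
  g a (thetah k om) * (xi k j a om * xi k j b om - (a == b)%:R).

Let cubic (k : nat) (b : 'I_d) (om : Omega) : R :=
  J%:R^-1 * \sum_(j < J) \sum_(a < d) \sum_(c < d)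
    coef a c (thetah k om) * (xi k j a om * xi k j c om * xi k j b om).

(** The centering of [quad] accounts for exactly [g b], so once [quad] and the second-order term are
    removed only the Taylor remainder is left. *)
Let remainder (k : nat) (b : 'I_d) (om : Omega) : R :=
  drift k b om - g b (thetah k om) - quad k b om - sigma * cubic k b om.

(** The Taylor remainder has degree [(beta G).+1] in [xi], and the factor [xi k j b om] adds one
    more. *)
Lemma remainder_le k b om :
  `|remainder k b om| <= `|C1 * sigma ^+ beta G * rho k om ^+ (beta G).+2|.
Proof.
rewrite [leRHS]ger0_norm; last first.
  by rewrite mulr_ge0 ?exprn_ge0 ?rho_ge0// mulr_ge0// exprn_ge0// ltW.
pose r j := sigma^-1 * dot_mx Gamma (G (thetah k om + sigma *: xih k j om) - G (thetah k om))
    (G (thetah k om) - y)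
  - \sum_(a < d) xi k j a om * g a (thetah k om)
  - sigma * \sum_(a < d) \sum_(c < d) xi k j a om * xi k j c om * coef a c (thetah k om).
have -> : remainder k b om = J%:R^-1 * \sum_(j < J) r j * xi k j b om.
  have gb : g b (thetah k om) = J%:R^-1 * \sum_(j < J) g b (thetah k om).
    by rewrite sumr_const card_ord -(mulr_natl (g b (thetah k om)) J) mulKf// pnatr_eq0 -lt0n.
  rewrite /remainder gb /drift /quad /cubic mulrCA -!mulrBr; congr (_ * _).
  rewrite big_distrr/= -!sumrB; apply: eq_bigr => j _.
  have gbE : g b (thetah k om) = \sum_(a < d) g a (thetah k om) * (a == b)%:R.
    by rewrite (bigD1 b)//= eqxx mulr1 big1 ?addr0// => a /negbTE->; rewrite mulr0.
  have E1 : (\sum_(a < d) xi k j a om * g a (thetah k om)) * xi k j b om =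
      \sum_(a < d) g a (thetah k om) * (a == b)%:R +
      \sum_(a < d) g a (thetah k om) * (xi k j a om * xi k j b om - (a == b)%:R).
    by rewrite big_distrl/= -big_split/=; apply: eq_bigr => a _; ring.
  have E2 : (\sum_(a < d) \sum_(c < d) xi k j a om * xi k j c om * coef a c (thetah k om)) *
        xi k j b om =
      \sum_(a < d) \sum_(c < d) coef a c (thetah k om) *
        (xi k j a om * xi k j c om * xi k j b om).
    rewrite big_distrl/=; apply: eq_bigr => a _.
    by rewrite big_distrl/=; apply: eq_bigr => c _; ring.
  by rewrite /r !mulrBl -[sigma * _ * _]mulrA E1 E2 gbE opprD addrA.
apply: le_trans (norm_average_le (B := fun j => C1 * sigma ^+ beta G * rho k om ^+ (beta G).+1 *
  l1norm (xih k j om)) _) _.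
  move=> j; rewrite normrM; apply: ler_pM => //; last exact: ler_coord_l1norm.
  apply: le_trans (quotient_expansion _ _ sigma0) _.
  apply: ler_wpM2l; first by rewrite mulr_ge0// exprn_ge0// ltW.
  by rewrite lerXn2r// ?nnegrE ?l1norm_ge0 ?rho_ge0// l1norm_le_rho.
by rewrite -big_distrr/= -mulrA -exprSr.
Qed.

Lemma rhoX_moments k q : all_moments P (fun om => rho k om ^+ q).
Proof.
elim: q => [|q IH]; first exact: all_moments_cst.
under eq_fun do rewrite exprS.
by apply: all_momentsM => //; eexists; exact: rho_moments.
Qed.

Lemma mean_rhoX_le k q : EE (fun om => rho k om ^+ q) <= rho_bound q.
Proof.
have [bq Hq] := rhoX_moments k q.
rewrite -lee_fin -(mean_EFin Hq); last by move=> om; rewrite exprn_ge0// rho_ge0.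
apply: le_trans ((rho_moments k).2 q).
by under eq_integral do rewrite -[rho k _]ger0_norm ?rho_ge0//.
Qed.

Lemma gradient_moments k b : all_moments P (fun om => g b (thetah k om)).
Proof. by apply: (@thetah_lip_moments (fun x => g b x)). Qed.

Lemma quad_moments k b : all_moments P (quad k b).
Proof.
apply: all_momentsM; first exact: all_moments_cst.
apply: all_moments_sum_ord => j; apply: all_moments_sum_ord => a.
apply: all_momentsM; first exact: gradient_moments.
apply: all_momentsB; last exact: all_moments_cst.
by apply: all_momentsM; exact: xih_all_moments.
Qed.

Lemma cubic_moments k b : all_moments P (cubic k b).
Proof.
apply: all_momentsM; first exact: all_moments_cst.
apply: all_moments_sum_ord => j; apply: all_moments_sum_ord => a.
apply: all_moments_sum_ord => c; apply: all_momentsM.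
  exact: (thetah_lip_moments k (coef_bounded a c) (@coef_lip a c)).
by eexists; exact: product3_moments.
Qed.

Lemma remainder_moments k b : all_moments P (remainder k b).
Proof.
apply: all_momentsB; first apply: all_momentsB; first apply: all_momentsB.
- exact: drift_all_moments.
- exact: gradient_moments.
- exact: quad_moments.
- apply: all_momentsM; [exact: all_moments_cst|exact: cubic_moments].
Qed.

Lemma mean_sqr_remainder k b :
  EE (fun om => remainder k b om ^+ 2) <=
    C1 ^+ 2 * sigma ^+ (2 * beta G) * rho_bound (2 * (beta G).+2).
Proof.
apply: (@le_trans _ _ (EE (fun om => C1 ^+ 2 * sigma ^+ (2 * beta G) * rho k om ^+ (2 * (beta G).+2)))).
  apply: all_mean_mono.
  - by apply: all_momentsM; exact: remainder_moments.
  - by apply: all_momentsM; [exact: all_moments_cst|exact: rhoX_moments].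
  move=> om; rewrite -[leLHS]real_normK ?num_real//.
  rewrite [leRHS](_ : _ = `|C1 * sigma ^+ beta G * rho k om ^+ (beta G).+2| ^+ 2); last first.
    rewrite real_normK ?num_real//; set q := (beta G).+2; move: q (beta G) => q m.
    by rewrite !exprMn -!exprM (mulnC m) (mulnC q).
  by rewrite lerXn2r// ?nnegrE// remainder_le.
rewrite all_meanZ; last exact: rhoX_moments.
rewrite ler_wpM2l ?mean_rhoX_le// mulr_ge0 ?sqr_ge0// exprn_ge0// ltW//.
Qed.

Lemma mean_sqr_quad n b : n%:R * Delta <= T ->
  EE (fun om => (\sum_(k < n) Delta * quad k b om) ^+ 2) <=
    d%:R ^+ 2 * (averaging_bound quadratic_bound * err).
Proof.
move=> nT.
pose S j a om := \sum_(k < n) Delta *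
  (g a (thetah k om) * (xi k j a om * xi k j b om - (a == b)%:R)).
have mS j a : all_moments P (S j a).
  apply: (@weighted_sum_moments (fun x => g a x) n
    (fun k om => xi k j a om * xi k j b om - (a == b)%:R)) => // k.
  apply: all_momentsB; last exact: all_moments_cst.
  by apply: all_momentsM; exact: xih_all_moments.
rewrite (_ : (fun om => _) =
  (fun om => (J%:R^-1 * \sum_(j < J) \sum_(a < d) S j a om) ^+ 2)); last first.
  apply/funext => om; congr (_ ^+ 2); rewrite /quad.
  under eq_bigr do rewrite mulrCA.
  rewrite -big_distrr/=; congr (_ * _); rewrite /S.
  under eq_bigr do rewrite big_distrr/=.
  rewrite exchange_big/=; apply: eq_bigr => j _.
  under eq_bigr do rewrite big_distrr/=.
  by rewrite exchange_big.
apply: (mean_sqr_mean J0) => j; first exact: all_moments_sum_ord.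
apply: mean_sqr_sum_bound => // a.
by apply: (@mean_sqr_average_quadratic (fun x => g a x)).
Qed.

(** [B] is left open because both the averaged and the crude estimate go through here. *)
Lemma mean_sqr_cubic n b (B : R) :
  (forall j a c, EE (fun om => (\sum_(k < n) Delta *
    (coef a c (thetah k om) * (xi k j a om * xi k j c om * xi k j b om))) ^+ 2) <= B) ->
  EE (fun om => (\sum_(k < n) Delta * cubic k b om) ^+ 2) <= d%:R ^+ 4 * B.
Proof.
move=> SB.
pose S j a c om := \sum_(k < n) Delta *
  (coef a c (thetah k om) * (xi k j a om * xi k j c om * xi k j b om)).
have mS j a c : all_moments P (S j a c).
  apply: (@weighted_sum_moments (coef a c) n
    (fun k om => xi k j a om * xi k j c om * xi k j b om)) => // k.
  by eexists; exact: product3_moments.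
rewrite (_ : (fun om => _) =
  (fun om => (J%:R^-1 * \sum_(j < J) \sum_(a < d) \sum_(c < d) S j a c om) ^+ 2)); last first.
  apply/funext => om; congr (_ ^+ 2); rewrite /cubic.
  under eq_bigr do rewrite mulrCA.
  rewrite -big_distrr/=; congr (_ * _); rewrite /S.
  under eq_bigr do rewrite big_distrr/=.
  rewrite exchange_big/=; apply: eq_bigr => j _.
  under eq_bigr do rewrite big_distrr/=.
  rewrite exchange_big/=; apply: eq_bigr => a _.
  under eq_bigr do rewrite big_distrr/=.
  by rewrite exchange_big.
apply: (mean_sqr_mean J0) => j.
  by apply: all_moments_sum_ord => a; exact: all_moments_sum_ord.
rewrite (_ : d%:R ^+ 4 * B = d%:R ^+ 2 * (d%:R ^+ 2 * B)); last by rewrite mulrA -exprD.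
apply: mean_sqr_sum_bound => a; first exact: all_moments_sum_ord.
by apply: mean_sqr_sum_bound => // c; exact: SB.
Qed.

(** Bounded coefficients and moments of the triple products suffice, without averaging; it serves
    large [sigma]. *)
Lemma mean_sqr_cubic_crude n b : n%:R * Delta <= T ->
  EE (fun om => (\sum_(k < n) Delta * cubic k b om) ^+ 2) <=
    d%:R ^+ 4 * (T ^+ 2 * (L ^+ 2 * product3_bound 2)).
Proof.
move=> nT; apply: mean_sqr_cubic => j a c.
have p0 := moments_bound_ge0 2 (product3_moments 0 j a c b).
have mp k : all_moments P (fun om => xi k j a om * xi k j c om * xi k j b om).
  by eexists; exact: product3_moments.
have mc k : all_moments P (fun om => coef a c (thetah k om) *
    (xi k j a om * xi k j c om * xi k j b om)).
  apply: all_momentsM => //.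
  exact: (thetah_lip_moments k (coef_bounded a c) (@coef_lip a c)).
apply: le_trans (@mean_sqr_riemann_sum (fun k om => coef a c (thetah k om) *
    (xi k j a om * xi k j c om * xi k j b om)) (L ^+ 2 * product3_bound 2) n mc _) _.
  move=> k _; apply: (@le_trans _ _ (EE (fun om => (L * (xi k j a om * xi k j c om * xi k j b om)) ^+ 2))).
    apply: all_mean_mono.
    - by apply: all_momentsM; exact: mc.
    - by apply: all_momentsM; apply: all_momentsM => //; exact: all_moments_cst.
    move=> om; rewrite [leLHS]exprMn [leRHS]exprMn ler_wpM2r ?sqr_ge0//.
    by rewrite -[leLHS]real_normK ?num_real// lerXn2r// nnegrE.
  rewrite mean_sqrZ// ler_wpM2l ?sqr_ge0//.
  exact: (mean_sqr_le (product3_moments k j a c b)).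
apply: ler_wpM2r; first by rewrite mulr_ge0// sqr_ge0.
by rewrite lerXn2r// ?nnegrE ?grid_ge0// ltW.
Qed.

Definition consistency_bound : R :=
  4 * (d%:R ^+ 2 * averaging_bound quadratic_bound)
  + 4 * (d%:R ^+ 4 * (cubic_averaging_bound + T ^+ 2 * (L ^+ 2 * product3_bound 2)))
  + 2 * (T ^+ 2 * (C1 ^+ 2 * rho_bound (2 * (beta G).+2))).

Lemma beta_ge1 : (1 <= beta G)%N.
Proof. by rewrite /beta; case: ifP. Qed.

Lemma quadratic_bound_ge0 q : 0 <= quadratic_bound q.
Proof. by rewrite mulr_ge0 ?exprn_ge0// !addr_ge0// gaussian_bound_ge0. Qed.

Lemma product3_bound_ge0 q : 0 <= product3_bound q.
Proof. by rewrite !addr_ge0// gaussian_bound_ge0. Qed.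

Lemma cubic_bound_ge0 q : 0 <= cubic_bound q.
Proof.
rewrite mulr_ge0 ?exprn_ge0// addr_ge0 ?product3_bound_ge0// mulr_ge0 ?exprn_ge0//.
by rewrite addr_ge0 ?gaussian_bound_ge0// mulr_ge0 ?exprn_ge0// addr_ge0// gaussian_bound_ge0.
Qed.

Lemma cubic_averaging_bound_ge0 : 0 <= cubic_averaging_bound.
Proof.
rewrite /cubic_averaging_bound mulr_ge0// addr_ge0//.
  by rewrite averaging_bound_ge0// cubic_bound_ge0.
by rewrite mulr_ge0// averaging_bound_ge0// gaussian_bound_ge0.
Qed.

Lemma rho_bound_ge0 q : 0 <= rho_bound q.
Proof. exact: (moments_bound_ge0 q (rho_moments 0)). Qed.

(* For large [sigma] the averaging of the cubic term is useless, but then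
   [sigma ^+ 2] is itself below the target error [sigma ^+ (2 * beta G)]. *)
Lemma sigma_cubic_le n b : n%:R * Delta <= T ->
  sigma ^+ 2 * EE (fun om => (\sum_(k < n) Delta * cubic k b om) ^+ 2) <=
    d%:R ^+ 4 * (cubic_averaging_bound + T ^+ 2 * (L ^+ 2 * product3_bound 2)) *
      (err + sigma ^+ (2 * beta G)).
Proof.
move=> nT; set E := EE _.
have E0 : 0 <= E by apply: Rintegral_ge0 => om _; exact: sqr_ge0.
have p0 : 0 <= T ^+ 2 * (L ^+ 2 * product3_bound 2).
  by rewrite mulr_ge0 ?sqr_ge0// mulr_ge0 ?sqr_ge0// product3_bound_ge0.
have c0 := cubic_averaging_bound_ge0; have e0 := err_ge0.
have s0 : 0 <= sigma ^+ (2 * beta G) by rewrite exprn_ge0// ltW.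
rewrite -mulrA; have [s1|s1] := leP sigma 1.
  apply: (@le_trans _ _ E).
    by rewrite ler_piMl// exprn_ile1// ltW.
  apply: (@le_trans _ _ (d%:R ^+ 4 * (cubic_averaging_bound * err))).
    by apply: mean_sqr_cubic => j a c; exact: mean_sqr_average_cubic.
  by apply: ler_wpM2l; [exact: exprn_ge0|apply: ler_pM; rewrite ?lerDl].
apply: (@le_trans _ _ (sigma ^+ (2 * beta G) * (d%:R ^+ 4 * (T ^+ 2 * (L ^+ 2 * product3_bound 2))))).
  apply: ler_pM => //; first exact: sqr_ge0.
    by rewrite ler_weXn2l ?(ltW s1)// -{1}[2%N]muln1 leq_mul2l beta_ge1.
  exact: mean_sqr_cubic_crude.
rewrite mulrCA; apply: ler_wpM2l; first exact: exprn_ge0.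
by rewrite mulrC; apply: ler_pM; rewrite ?lerDr.
Qed.

Lemma mean_sqr_consistency n b : n%:R * Delta <= T ->
  EE (fun om => (\sum_(k < n) Delta * (drift k b om - g b (thetah k om))) ^+ 2) <=
    consistency_bound * (err + sigma ^+ (2 * beta G)).
Proof.
move=> nT; set E0 := err + _.
pose SQ om := \sum_(k < n) Delta * quad k b om.
pose SC om := \sum_(k < n) Delta * cubic k b om.
pose SR om := \sum_(k < n) Delta * remainder k b om.
have mQ : all_moments P SQ.
  apply: all_moments_sum_ord => k; apply: all_momentsM; first exact: all_moments_cst.
  exact: quad_moments.
have mC : all_moments P SC.
  apply: all_moments_sum_ord => k; apply: all_momentsM; first exact: all_moments_cst.
  exact: cubic_moments.
have mR : all_moments P SR.
  apply: all_moments_sum_ord => k; apply: all_momentsM; first exact: all_moments_cst.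
  exact: remainder_moments.
have msC : all_moments P (fun om => sigma * SC om).
  by apply: all_momentsM => //; exact: all_moments_cst.
rewrite (_ : (fun om => _) = (fun om => ((SQ om + sigma * SC om) + SR om) ^+ 2)); last first.
  apply/funext => om; congr (_ ^+ 2); rewrite /SQ /SC /SR big_distrr/= -!big_split/=.
  by apply: eq_bigr => k _; rewrite /remainder; ring.
apply: le_trans (mean_sqrD_le (all_momentsD mQ msC) mR) _.
have H1 := mean_sqrD_le mQ msC; rewrite (mean_sqrZ sigma mC) in H1.
have H2 := mean_sqr_quad b nT; have H3 := sigma_cubic_le b nT.
have H4 : EE (fun om => SR om ^+ 2) <=
    T ^+ 2 * (C1 ^+ 2 * sigma ^+ (2 * beta G) * rho_bound (2 * (beta G).+2)).
  have r0 : 0 <= C1 ^+ 2 * sigma ^+ (2 * beta G) * rho_bound (2 * (beta G).+2).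
    by rewrite mulr_ge0 ?rho_bound_ge0// mulr_ge0 ?sqr_ge0// exprn_ge0// ltW.
  apply: le_trans (@mean_sqr_riemann_sum (fun k => remainder k b) _ n
    (fun k => remainder_moments k b) (fun k _ => mean_sqr_remainder k b)) _.
  by apply: ler_wpM2r => //; rewrite lerXn2r// ?nnegrE ?grid_ge0// ltW.
have s0 : 0 <= sigma ^+ (2 * beta G) by rewrite exprn_ge0// ltW.
have eE : err <= E0 by rewrite lerDl.
have sE : sigma ^+ (2 * beta G) <= E0 by rewrite lerDr err_ge0.
have H2' : EE (fun om => SQ om ^+ 2) <= d%:R ^+ 2 * averaging_bound quadratic_bound * E0.
  apply: le_trans H2 _; rewrite mulrA ler_wpM2l//.
  by rewrite mulr_ge0 ?sqr_ge0// averaging_bound_ge0// quadratic_bound_ge0.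
have H4' : EE (fun om => SR om ^+ 2) <= T ^+ 2 * (C1 ^+ 2 * rho_bound (2 * (beta G).+2)) * E0.
  apply: le_trans H4 _; rewrite -[leRHS]mulrA ler_wpM2l ?sqr_ge0// [leRHS]mulrAC.
  by rewrite ler_wpM2r ?rho_bound_ge0// ler_wpM2l// sqr_ge0.
exact: (three_term_bound H1 H2' H3 H4').
Qed.

(** * The Langevin path and the rectangle rule *)

Local Notation mu := (@lebesgue_measure R).
Local Notation v t om := (vartheta t om).
Local Notation c := (nu * Num.sqrt 2).

(** The almost sure event on which the equation holds at all times at once; pathwise statements take
    it as a hypothesis. *)
Let regular_path om := [/\ w 0 om = 0,
  {within `[0, +oo[, continuous (fun t : R => v t om)} &
  forall (t : R) b, 0 <= t -> v t om ord0 b = theta0 om ord0 b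
    - \int[mu]_(s in `[0, t]) g b (v s om) + c * w t om ord0 b].

Lemma ae_regular_path : {ae P, forall om, regular_path om}.
Proof.
have [_ wc _ _] := w_bm; have [_ vc] := vartheta_sol.
apply: filterS2 wc vc => om [w0 _] [vcont vE]; split=> // t b t0.
by rewrite vE// !mxE.
Qed.

Lemma gradient_path_continuous om b : regular_path om ->
  {within `[0, +oo[, continuous (fun t : R => g b (v t om))}.
Proof.
by case=> _ vc _; exact: (@lip_path_continuous _ _ (fun x => g b x) L (fun t => v t om) _ L0 _ vc).
Qed.

Lemma gradient_path_segment om b (a t : R) : regular_path om -> 0 <= a ->
  {within `[a, t], continuous (fun t : R => g b (v t om))}.
Proof.
move=> reg a0; apply: (continuous_subspaceW _ (@gradient_path_continuous om b reg)) => x /=.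
by rewrite !in_itv/= andbT => /andP[ax _]; exact: le_trans ax.
Qed.

Lemma path_increment_le om b (a t : R) : regular_path om -> 0 <= a -> a <= t ->
  `|v t om ord0 b - v a om ord0 b| <= L * (t - a) + `|c * (w t om ord0 b - w a om ord0 b)|.
Proof.
move=> reg a0 at_; have [_ _ vE] := reg.
rewrite !vE//; last exact: le_trans at_.
rewrite (Rintegral_segment_split a0 at_); last first.
  by apply: continuous_segment_integrable; exact: gradient_path_segment.
set I1 := \int[mu]_(s in `[0, a]) _; set I2 := \int[mu]_(s in `[a, t]) _.
rewrite (_ : _ - _ = - I2 + c * (w t om ord0 b - w a om ord0 b)); last by ring.
rewrite (le_trans (ler_normD _ _))// lerD2r normrN.
by apply: norm_Rintegral_segment_le => //; exact: gradient_path_segment.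
Qed.

Lemma vartheta_rv (t : R) : 0 <= t -> random_vector (vartheta t).
Proof. by case: vartheta_sol => H _; exact: H. Qed.

Lemma gradient_path_moments (t : R) b : 0 <= t -> all_moments P (fun om => g b (v t om)).
Proof.
move=> t0; apply: (all_moments_bounded P _ (fun om => g_bounded b (v t om))).
exact: (measurable_lip L0 (@g_lip b) (vartheta_rv t0)).
Qed.

Definition path_bound : R := L ^+ 2 * (d%:R ^+ 2 * (2 * L ^+ 2 * T + 4 * (gaussian_bound R 4 + 1))).

Lemma path_bound_ge0 : 0 <= path_bound.
Proof.
rewrite /path_bound mulr_ge0 ?sqr_ge0// mulr_ge0 ?sqr_ge0//; apply: addr_ge0.
  by rewrite mulr_ge0 ?(ltW T0)// mulr_ge0 ?sqr_ge0.
by rewrite mulr_ge0// addr_ge0// gaussian_bound_ge0.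
Qed.

(** Within one step the path moves by [O(Delta)] through the drift and by the square root of that
    order through the noise; [Delta <= T] makes the square of the former [O(Delta)] too. The
    comparison is only almost sure, as it uses the equation. *)
Lemma mean_sqr_gradient_path (a t : R) b : 0 <= a -> a <= t -> t - a <= Delta -> Delta <= T ->
  EE (fun om => (g b (v t om) - g b (v a om)) ^+ 2) <= path_bound * Delta.
Proof.
move=> a0 at_ taD DT; have t0 : 0 <= t by exact: le_trans at_.
pose Y om := \sum_(i < d) (2 * (L * (t - a)) ^+ 2 + 4 * (w t om ord0 i - w a om ord0 i) ^+ 2).
have mW i : all_moments P (fun om => w t om ord0 i - w a om ord0 i) by exact: w_increment_all_moments.
have mW2 i : all_moments P (fun om => 4 * (w t om ord0 i - w a om ord0 i) ^+ 2).
  by apply: all_momentsM; [exact: all_moments_cst|exact: all_momentsM].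
have mY1 i : all_moments P (fun om => 2 * (L * (t - a)) ^+ 2 + 4 * (w t om ord0 i - w a om ord0 i) ^+ 2).
  by apply: all_momentsD => //; exact: all_moments_cst.
have mY : all_moments P Y by exact: all_moments_sum_ord.
apply: (@le_trans _ _ (EE (fun om => L ^+ 2 * d%:R * Y om))).
  apply: ae_mean_mono.
  - by apply: all_momentsM; apply: all_momentsB; exact: gradient_path_moments.
  - by apply: all_momentsM => //; exact: all_moments_cst.
  - by move=> om; exact: sqr_ge0.
  - move=> om; rewrite mulr_ge0 ?mulr_ge0 ?sqr_ge0//; apply: sumr_ge0 => i _.
    by rewrite addr_ge0// mulr_ge0// sqr_ge0.
  apply: filterS ae_regular_path => om reg.
  rewrite -[leLHS]real_normK ?num_real//.
  apply: (@le_trans _ _ ((L * l1norm (v t om - v a om)) ^+ 2)).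
    by rewrite lerXn2r ?nnegrE ?mulr_ge0 ?l1norm_ge0//; exact: g_lip.
  rewrite exprMn -mulrA ler_wpM2l ?sqr_ge0//.
  apply: le_trans (l1norm_sqr_le _) _; rewrite ler_wpM2l//; apply: ler_sum => i _.
  rewrite !mxE -expr2 -[leLHS]real_normK ?num_real//.
  have H := path_increment_le i reg a0 at_.
  set W1 := w t om ord0 i - _ in H *.
  have La : 0 <= L * (t - a) by rewrite mulr_ge0// subr_ge0.
  apply: (@le_trans _ _ ((L * (t - a) + `|c * W1|) ^+ 2)).
    by rewrite lerXn2r// nnegrE// addr_ge0.
  apply: (@le_trans _ _ (2 * (L * (t - a)) ^+ 2 + 2 * `|c * W1| ^+ 2)).
    exact: sqrD_le.
  rewrite lerD2l real_normK ?num_real// exprMn mulrA ler_wpM2r ?sqr_ge0//.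
  rewrite (_ : 4 = 2 * 2 :> R); last by rewrite -natrM.
  by rewrite ler_pM2l// nu_sqr.
rewrite all_meanZ// all_mean_sum_ord//.
rewrite (_ : path_bound * Delta = L ^+ 2 * d%:R * (d%:R *
  (2 * L ^+ 2 * T * Delta + 4 * ((gaussian_bound R 4 + 1) * Delta)))); last first.
  by rewrite /path_bound; ring.
apply: ler_wpM2l; first by rewrite mulr_ge0 ?sqr_ge0.
apply: ler_sum_cst => i.
rewrite all_meanD//; last exact: all_moments_cst.
rewrite mean_cst all_meanZ; last exact: all_momentsM.
apply: lerD.
  rewrite exprMn -!mulrA ler_pM2l//; do 2!apply: ler_wpM2l => //.
  rewrite expr2; apply: ler_pM; rewrite ?subr_ge0//; exact: le_trans taD DT.
rewrite ler_pM2l//.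
have := mean_sqr_w_increment i a0 at_ (moments_cst P 1).
rewrite normr1 expr1n; under eq_Rintegral do rewrite mulr1.
move=> /le_trans; apply; rewrite mulrC ler_wpM2l//.
by rewrite addr_ge0// gaussian_bound_ge0.
Qed.

(** Scheme and equation share the initial value and the Brownian term, so both drop out of the
    difference. *)
Lemma error_coord n b om : regular_path om ->
  thetah n om ord0 b - v (n%:R * Delta) om ord0 b =
  - (\sum_(k < n) Delta * drift k b om) + \int[mu]_(s in `[0, n%:R * Delta]) g b (v s om).
Proof.
move=> [w0 _ vE]; rewrite vE ?grid_ge0//.
have := thetah_increment n 0 om b; rewrite add0n => ->.
have [-> _ _ _] := thetah_xih om.
rewrite /W mul0r w0 mxE subr0; under eq_bigr do rewrite add0n.
by ring.
Qed.

Let grid_point (N k i : nat) : R := k%:R * Delta + i%:R * (Delta / N.+1%:R).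

Lemma grid_point_ge0 N k i : 0 <= grid_point N k i.
Proof. by rewrite addr_ge0 ?grid_ge0// mulr_ge0// divr_ge0// ltW. Qed.

(** The error with the time integral replaced by Riemann sums: a finite sum of random variables,
    open to mean-square estimates. *)
Let approx (n : nat) (b : 'I_d) (N : nat) (om : Omega) : R :=
  - (\sum_(k < n) Delta * drift k b om) +
  \sum_(k < n) Delta / N.+1%:R * \sum_(i < N.+1) g b (v (grid_point N k i) om).

Lemma approx_cvg n b om : regular_path om ->
  approx n b N om @[N --> \oo] --> thetah n om ord0 b - v (n%:R * Delta) om ord0 b.
Proof.
move=> reg; rewrite error_coord//; apply: cvgD; first exact: cvg_cst.
exact: (@riemann_sum_cvg_grid R (fun t : R => g b (v t om)) Delta n Delta0
  (@gradient_path_continuous om b reg)).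
Qed.

(** The rectangle-rule error of one step in discrete form; its mean square is bounded uniformly in
    [N]. *)
Let path_defect (b : 'I_d) (N k : nat) (om : Omega) : R :=
  N.+1%:R^-1 * \sum_(i < N.+1) (g b (v (grid_point N k i) om) - g b (v (k%:R * Delta) om)).

Let drift_error (b : 'I_d) (k : nat) (om : Omega) : R :=
  g b (v (k%:R * Delta) om) - g b (thetah k om).

Lemma approxE n b N om : approx n b N om =
  -1 * (\sum_(k < n) Delta * (drift k b om - g b (thetah k om))) +
  (\sum_(k < n) Delta * drift_error b k om + \sum_(k < n) Delta * path_defect b N k om).
Proof.
rewrite /approx mulN1r -!sumrN -!big_split/=; apply: eq_bigr => k _.
rewrite /path_defect (@mean_shift R N.+1 (fun i => g b (v (grid_point N k i) om)))//.
rewrite /drift_error; set S := \sum_(i < N.+1) _.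
exact: defect_split.
Qed.

Lemma drift_error_moments b k : all_moments P (drift_error b k).
Proof.
exact: (all_momentsB (gradient_path_moments b (grid_ge0 k)) (gradient_moments k b)).
Qed.

Lemma path_defect_moments b N k : all_moments P (path_defect b N k).
Proof.
apply: all_momentsM; first exact: all_moments_cst.
apply: all_moments_sum_ord => i.
exact: (all_momentsB (gradient_path_moments b (grid_point_ge0 N k i))
  (gradient_path_moments b (grid_ge0 k))).
Qed.

Lemma approx_moments n b N : all_moments P (approx n b N).
Proof.
apply: all_momentsD.
  under eq_fun do rewrite -mulN1r.
  apply: all_momentsM; first exact: all_moments_cst.
  apply: all_moments_sum_ord => k; apply: all_momentsM; first exact: all_moments_cst.
  exact: drift_all_moments.
apply: all_moments_sum_ord => k; apply: all_momentsM; first exact: all_moments_cst.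
by apply: all_moments_sum_ord => i; apply: gradient_path_moments; exact: grid_point_ge0.
Qed.

Lemma mean_sqr_path_defect b N k : Delta <= T ->
  EE (fun om => path_defect b N k om ^+ 2) <= path_bound * Delta.
Proof.
move=> DT; apply: mean_sqr_mean => // i.
  exact: (all_momentsB (gradient_path_moments b (grid_point_ge0 N k i))
    (gradient_path_moments b (grid_ge0 k))).
apply: mean_sqr_gradient_path => //.
- exact: grid_ge0.
- by rewrite lerDl mulr_ge0// divr_ge0// ltW.
- rewrite /grid_point addrAC subrr add0r mulrCA ler_piMr//; first exact: ltW.
  by rewrite ler_pdivrMr// mul1r ler_nat ltnW.
Qed.

Let target : R := err + sigma ^+ (2 * beta G).

(** [u] stands for bounds already known at earlier times; two nested squares give the weights 2 and
    4. *)
Lemma mean_sqr_approx n b N (u : nat -> R) : n%:R * Delta <= T ->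
  (forall k, (k < n)%N -> EE (fun om => drift_error b k om ^+ 2) <= u k) ->
  EE (fun om => approx n b N om ^+ 2) <=
    (2 * consistency_bound + 4 * (T ^+ 2 * path_bound)) * target +
    4 * (T * Delta * \sum_(k < n) u k).
Proof.
move=> nT uE.
have mM : all_moments P (fun om => \sum_(k < n) Delta * (drift k b om - g b (thetah k om))).
  apply: all_moments_sum_ord => k; apply: all_momentsM; first exact: all_moments_cst.
  by apply: all_momentsB; [exact: drift_all_moments|exact: gradient_moments].
have mD k : all_moments P (fun om => Delta * drift_error b k om).
  by apply: all_momentsM; [exact: all_moments_cst|exact: drift_error_moments].
have mDS : all_moments P (fun om => \sum_(k < n) Delta * drift_error b k om).
  by apply: all_moments_sum_ord => k.
have mS : all_moments P (fun om => \sum_(k < n) Delta * path_defect b N k om).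
  apply: all_moments_sum_ord => k; apply: all_momentsM; first exact: all_moments_cst.
  exact: path_defect_moments.
under eq_Rintegral do rewrite approxE.
have mM' := all_momentsM (all_moments_cst P (-1)) mM.
have H1 := mean_sqrD_le mM' (all_momentsD mDS mS).
have H2 := mean_sqrD_le mDS mS.
rewrite (mean_sqrZ (-1) mM) sqrrN expr1n mul1r in H1.
have H3 := mean_sqr_consistency b nT.
have p0 := path_bound_ge0.
have H4 : EE (fun om => (\sum_(k < n) Delta * path_defect b N k om) ^+ 2) <= T ^+ 2 * path_bound * target.
  apply: (@le_trans _ _ (T ^+ 2 * (path_bound * Delta))).
    apply: le_trans (@mean_sqr_riemann_sum (path_defect b N) (path_bound * Delta) n _ _) _.
    - by move=> k; exact: path_defect_moments.
    (* Some [k < n] forces [1 <= n], hence [Delta <= n%:R * Delta <= T]; if [Delta] exceeds [T] the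
       sum is empty. *)
    - move=> k kn; apply: mean_sqr_path_defect; apply: le_trans nT.
      by rewrite ler_peMl ?(ltW Delta0)// ler1n (leq_trans _ kn).
    - rewrite ler_wpM2r ?(mulr_ge0 p0 (ltW Delta0))//.
      by rewrite lerXn2r// ?nnegrE ?grid_ge0// ltW.
  rewrite -mulrA ler_wpM2l ?sqr_ge0// ler_wpM2l// /target /err -addrA lerDl.
  by rewrite addr_ge0 ?exprn_ge0 ?(ltW sigma0)// mulr_ge0 ?sqr_ge0 ?ln_delta_ge0.
have H5 : EE (fun om => (\sum_(k < n) Delta * drift_error b k om) ^+ 2) <= T * Delta * \sum_(k < n) u k.
  apply: le_trans (mean_sqr_sum_le mD) _.
  have H k : (k < n)%N -> EE (fun om => (Delta * drift_error b k om) ^+ 2) <= Delta ^+ 2 * u k.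
    move=> kn; rewrite mean_sqrZ; last exact: drift_error_moments.
    by rewrite ler_wpM2l ?sqr_ge0// uE.
  apply: (@le_trans _ _ (n%:R * \sum_(k < n) (Delta ^+ 2 * u k))).
    by rewrite ler_wpM2l//; apply: ler_sum => k _; exact: H.
  rewrite -big_distrr/= expr2 !mulrA -[leLHS]mulrA -[leRHS]mulrA ler_wpM2r//.
  rewrite mulr_ge0 ?(ltW Delta0)//; apply: sumr_ge0 => k _; apply: le_trans (uE k _) => //.
  by apply: Rintegral_ge0 => om _; exact: sqr_ge0.
apply: le_trans H1 _; move: H2 H3 H4 H5; rewrite -/target.
exact: approx_bound.
Qed.

Lemma error_measurable n b :
  measurable_fun setT (fun om => thetah n om ord0 b - v (n%:R * Delta) om ord0 b).
Proof.
apply: measurable_funB; first exact: (hist_measurable (@thetah_adapted n b)).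
by apply: vartheta_rv; exact: grid_ge0.
Qed.

(** * Closing the discrete Gronwall argument *)

Definition error_bound : R :=
  d%:R * (2 * consistency_bound + 4 * (T ^+ 2 * path_bound)).

Definition growth_rate : R := d%:R * (4 * T * (L ^+ 2 * d%:R)).

(** Extended-valued integrals are kept: square integrability of the error comes out of the
    estimate. *)
Lemma mean_enorm2_le n (B : R) :
  (forall b, (\int[P]_om ((thetah n om ord0 b - v (n%:R * Delta) om ord0 b) ^+ 2)%:E <= B%:E)%E) ->
  (\int[P]_om (enorm2 (thetah n om - v (n%:R * Delta) om))%:E <= (d%:R * B)%:E)%E.
Proof.
move=> EB.
under eq_integral do rewrite /enorm2 /dot -sumEFin.
rewrite ge0_integral_sum//; last 2 first.
- move=> b; under eq_fun do rewrite !mxE.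
  by apply/measurable_EFinP; apply: measurable_funM; exact: error_measurable.
- by move=> b om _; rewrite lee_fin -expr2 sqr_ge0.
apply: (@le_trans _ _ (\sum_(b < d) B%:E)%E).
  apply: lee_sum => b _; apply: le_trans (EB b).
  by under eq_integral do rewrite !mxE -expr2.
by rewrite sumEFin sumr_const card_ord mulr_natl.
Qed.

Lemma mean_sqr_drift_error_le b k (u : R) :
  (\int[P]_om (enorm2 (thetah k om - v (k%:R * Delta) om))%:E <= u%:E)%E ->
  EE (fun om => drift_error b k om ^+ 2) <= L ^+ 2 * d%:R * u.
Proof.
move=> Eu; have [bd Hd] := all_momentsM (drift_error_moments b k) (drift_error_moments b k).
have me : measurable_fun setT (fun om => (enorm2 (thetah k om - v (k%:R * Delta) om))%:E).
  apply/measurable_EFinP; apply: measurable_sum => a.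
  by under eq_fun do rewrite !mxE; apply: measurable_funM; exact: error_measurable.
have e0 om : 0 <= enorm2 (thetah k om - v (k%:R * Delta) om).
  by apply: sumr_ge0 => a _; rewrite -expr2 sqr_ge0.
rewrite -lee_fin -(mean_EFin Hd); last by move=> om; rewrite -expr2 sqr_ge0.
apply: (@le_trans _ _ (\int[P]_om ((L ^+ 2 * d%:R)%:E * (enorm2 (thetah k om - v (k%:R * Delta) om))%:E))%E).
  apply: ge0_le_integral => //.
  - by move=> om _; rewrite lee_fin -expr2 sqr_ge0.
  - exact/measurable_EFinP/Hd.1.
  - exact: measurable_funeM.
  move=> om _; rewrite -EFinM lee_fin -expr2 -[leLHS]real_normK ?num_real//.
  apply: (@le_trans _ _ ((L * l1norm (v (k%:R * Delta) om - thetah k om)) ^+ 2)).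
    by rewrite lerXn2r ?nnegrE ?mulr_ge0 ?l1norm_ge0//; exact: g_lip.
  rewrite exprMn -[leRHS]mulrA ler_wpM2l ?sqr_ge0//; apply: le_trans (l1norm_sqr_le _) _.
  rewrite ler_wpM2l//; apply: ler_sum => a _; rewrite !mxE -!expr2.
  by rewrite -sqrrN opprB.
rewrite ge0_integralZl//; last 2 first.
- by move=> om _; rewrite lee_fin.
- by rewrite lee_fin mulr_ge0// sqr_ge0.
rewrite [leRHS]EFinM; apply: lee_wpmul2l => //.
by rewrite lee_fin mulr_ge0// sqr_ge0.
Qed.

(** The bound is the exact solution of the recursion that [mean_sqr_approx], summed over the [d]
    coordinates, produces; the induction step therefore closes by an equality of constants. *)
Lemma mean_error_le n : n%:R * Delta <= T ->
  (\int[P]_om (enorm2 (thetah n om - v (n%:R * Delta) om))%:E <=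
    (error_bound * target * (1 + growth_rate * Delta) ^+ n)%:E)%E.
Proof.
elim/ltn_ind: n => n IH nT.
pose u k := error_bound * target * (1 + growth_rate * Delta) ^+ k.
have uE b k : (k < n)%N -> EE (fun om => drift_error b k om ^+ 2) <= L ^+ 2 * d%:R * u k.
  move=> kn; apply: mean_sqr_drift_error_le; apply: IH => //.
  by apply: le_trans nT; rewrite ler_pM2r// ler_nat ltnW.
pose B := (2 * consistency_bound + 4 * (T ^+ 2 * path_bound)) * target +
    4 * (T * Delta * \sum_(k < n) (L ^+ 2 * d%:R * u k)).
have -> : error_bound * target * (1 + growth_rate * Delta) ^+ n = d%:R * B.
  rewrite geometric_sum /B -[X in _ + _ * X = _]/(\sum_(k < n) u k).
  rewrite -[in RHS]big_distrr/=.
  by move: (\sum_(k < n) u k) => S; rewrite /error_bound /growth_rate; ring.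
apply: mean_enorm2_le => b.
(* The bound on [approx n b N] does not depend on [N], so it survives the limit. *)
apply: (@fatou_sqr _ _ _ P (approx n b)).
- by move=> N; exact: all_moments_measurable (approx_moments n b N).
- exact: error_measurable.
- by apply: filterS ae_regular_path => om; exact: approx_cvg.
move=> N; have [ba Ha] := all_momentsM (approx_moments n b N) (approx_moments n b N).
rewrite (mean_EFin Ha); last by move=> om; rewrite -expr2 sqr_ge0.
rewrite lee_fin; exact: (mean_sqr_approx N nT (uE b)).
Qed.

Definition final_bound : R := error_bound * expR (growth_rate * T).

Lemma consistency_bound_ge0 : 0 <= consistency_bound.
Proof.
rewrite /consistency_bound !addr_ge0//.
- by rewrite mulr_ge0// mulr_ge0 ?sqr_ge0// averaging_bound_ge0// quadratic_bound_ge0.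
- rewrite mulr_ge0// mulr_ge0// addr_ge0 ?cubic_averaging_bound_ge0// mulr_ge0 ?sqr_ge0//.
  by rewrite mulr_ge0 ?sqr_ge0// product3_bound_ge0.
- by rewrite mulr_ge0// mulr_ge0 ?sqr_ge0// mulr_ge0 ?sqr_ge0// rho_bound_ge0.
Qed.

(** [1 + growth_rate * Delta] is below its exponential, and [n%:R * Delta <= T] makes the growth
    factor independent of [Delta]. *)
Lemma mean_error_final n : n%:R * Delta <= T ->
  (\int[P]_om (enorm2 (thetah n om - v (n%:R * Delta) om))%:E <= (final_bound * target)%:E)%E.
Proof.
move=> nT; apply: le_trans (mean_error_le nT) _; rewrite lee_fin.
have t0 : 0 <= target by rewrite addr_ge0 ?err_ge0// exprn_ge0// ltW.
have p0 := path_bound_ge0; have c0 := consistency_bound_ge0.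
have A0 : 0 <= error_bound.
  rewrite /error_bound mulr_ge0//; apply: addr_ge0; first by rewrite mulr_ge0.
  by rewrite mulr_ge0// mulr_ge0// sqr_ge0.
have r0 : 0 <= growth_rate.
  by rewrite /growth_rate mulr_ge0// mulr_ge0 ?mulr_ge0 ?sqr_ge0// ltW.
rewrite /final_bound mulrAC ler_wpM2r// ler_wpM2l//.
apply: (@le_trans _ _ (expR (growth_rate * Delta) ^+ n)).
  rewrite lerXn2r ?nnegrE ?expR_ge0 ?expR_ge1Dx// addr_ge0// mulr_ge0// ltW//.
by rewrite -expRM_natl ler_expR mulrCA ler_wpM2l.
Qed.

End Model.

Theorem theorem2p2 (R : realType) (d K : nat) (y : 'rV[R]_K) (nu : R)
    (Gamma : 'M[R]_K) (G : 'rV[R]_d -> 'rV[R]_K)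
    (hnu : nu = 0 \/ nu = 1) (hGamma : spd Gamma) (hG : Ck_torus 2 G)
    (J : nat) (hJ : (0 < J)%N) (T : R) (hT : 0 < T) :
  exists C : R,
  forall (disp : measure_display) (Omega : measurableType disp)
    (P : probability Omega R)
    (delta sigma Delta : R) (hdelta : 0 < delta) (hsigma : 0 < sigma)
    (hDelta : 0 < Delta)
    (w : R -> Omega -> 'rV[R]_d) (hw : brownian_motion P w)
    (xj : nat -> 'I_J -> Omega -> 'rV[R]_d)
    (hxj : forall n j, gaussian_vector P 1 (xj n j))
    (hindep : mutually_independent P
       (fun i : nat * option 'I_J =>
          sigma_of [set if i.2 is Some j then xj i.1 j else bm_incr Delta w i.1]))
    (theta0 : Omega -> 'rV[R]_d) (htheta0 : random_vector theta0)
    (xi0 : 'I_J -> Omega -> 'rV[R]_d)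
    (hxi0 : forall j, gaussian_vector P 1 (xi0 j))
    (hxi0_indep : mutually_independent P (fun j : 'I_J => sigma_of [set xi0 j]))
    (hinit : independent2 P
       (sigma_of ([set theta0] `|` range xi0))
       (sigma_of ([set w t | t in `[0, +oo[] `|`
                  [set xj i.1 i.2 | i in [set: nat * 'I_J]])))
    (thetah : nat -> Omega -> 'rV[R]_d) (xih : nat -> 'I_J -> Omega -> 'rV[R]_d)
    (hscheme : scheme y nu Gamma G delta sigma Delta theta0 xi0
                 (bm_incr Delta w) xj thetah xih)
    (vartheta : R -> Omega -> 'rV[R]_d)
    (hvartheta : langevin_solution P (Phi y Gamma G) (nu * Num.sqrt 2) w
                   theta0 vartheta),
  (ereal_sup [set 'E_P[fun omega =>
                enorm2 (thetah n omega - vartheta (n%:R * Delta) omega)%R]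
             | n in [set n : nat | (n%:R <= T / Delta)%R]]
   <= (C * (Delta + sigma ^+ (2 * beta G) + ln (1 + delta^-1) * delta ^+ 2))%:E)%E.
Proof.
have [Gsym _] := hGamma.
have [C0 C00 HC0] := difference_quotient_bound y Gamma hG.
have [coef [C1 [C10 coefB HC1]]] := difference_quotient_expansion y Gsym hG.
have [Lg Lg0 HLg] := bounded_lip_family (bounded_lip_gradient y Gsym hG).
have [Lc Lc0 HLc] := bounded_lip_family (fun ij : 'I_d * 'I_d => coefB ij.1 ij.2).
(* Gradient and expansion coefficients come with separate constants; [Lg + Lc] serves both. *)
have weaken L L' f : L <= L' -> (forall x, `|f x| <= L) /\ lip L f ->
    (forall x : 'rV[R]_d, `|f x| <= L') /\ lip L' f.
  move=> LL [fb fl]; split => [x|x z]; first exact: le_trans (fb x) LL.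
  by apply: le_trans (fl x z) _; rewrite ler_wpM2r// l1norm_ge0.
have {}HLg b := weaken _ (Lg + Lc) _ (ler_wpDr Lc0 (lexx Lg)) (HLg b).
have {}HLc a b := weaken _ (Lg + Lc) _ (ler_wpDl Lg0 (lexx Lc)) (HLc (a, b)).
(* Every argument comes from the problem data, so the constant precedes the probability space and
   the three parameters. *)
exists (final_bound G J T (Lg + Lc) C0 C1) => disp Omega P delta sigma Delta.
move=> delta0 sigma0 Delta0 w w_bm xj xj_gauss noise_indep theta0 theta0_rv xi0 xi0_gauss _.
move=> init_indep thetah xih thetah_xih vartheta vartheta_sol.
apply: ge_ereal_sup => _ [n /= nT <-].
rewrite unlock.
have {}nT : n%:R * Delta <= T by rewrite -ler_pdivlMr.
have := @mean_error_final R d K y nu Gamma G J T hnu hG hJ hT (Lg + Lc) C0 C1 coef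
  (addr_ge0 Lg0 Lc0) C00 C10 (fun b => (HLg b).1) (fun b => (HLg b).2)
  (fun a b => (HLc a b).1) (fun a b => (HLc a b).2) HC0 HC1 disp Omega P delta sigma Delta
  delta0 sigma0 Delta0 w w_bm xj xj_gauss noise_indep theta0 theta0_rv xi0 xi0_gauss
  init_indep thetah xih thetah_xih vartheta vartheta_sol n nT.
by rewrite [Delta + _ + _]addrAC.
Qed.
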